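(* Let $G:\mathbb B^n\to\mathbb C^n$ be an infinitesimal generator. Suppose that $(\ast)$ the function $z\mapsto |\langle G(z),e_1\rangle|/|z_1-1|$ is bounded on every Korányi region $K(e_1,R)$, $R\ge 1$, and $(\ast\ast)$ for each $j=2,\dots,n$ the function $z\mapsto |\langle G(z),e_j\rangle|/|z_1-1|^{1/2}$ is bounded on every Korányi region $K(e_1,R)$, $R\geq 1$. Then $e_1$ is a boundary regular null point for $G$. Moreover, if $\beta\in\mathbb R$ denotes the dilation of $G$ at $e_1$, then: (1') $\langle dG_z(e_1),e_1\rangle$ and $\langle dG_z(e_h),e_k\rangle$ ($h,k=2,\dots,n$) are bounded on every Korányi region; (1'') $\langle dG_z(e_j),e_1\rangle/(1-z_1)^{1/2}$ is bounded on every Korányi region for $j=2,\dots,n$; (1''') $(1-z_1)^{1/2}\langle dG_z(e_1),e_j\rangle$ is bounded on every Korányi region for $j=2,\dots,n$; (2) $\angle_K\lim_{z\to e_1}\frac{\langle G(z),e_1\rangle}{z_1-1}=\beta$; (3) $\angle_K\lim_{z\to e_1}\langle dG_z(e_1),e_1\rangle=\beta$; (4) $\angle_K\lim_{z\to e_1}\langle dG_z(e_j),e_1\rangle=0$ for $j=2,\dots,n$.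
   Context: $\mathbb B^n$ is the open unit ball of $\mathbb C^n$, $\mathbb D$ the unit disc, $\langle z,w\rangle=\sum_j z_j\overline{w_j}$, $\{e_1,\dots,e_n\}$ the standard basis; $z=(z_1,z'')\in\mathbb C\times\mathbb C^{n-1}$. $(1-z_1)^{1/2}$ denotes the principal branch. A holomorphic map $G:\mathbb B^n\to\mathbb C^n$ is an infinitesimal generator if for every $z_0\in\mathbb B^n$ the Cauchy problem $\dot x(t)=G(x(t))$, $x(0)=z_0$, has a solution $x:[0,+\infty)\to\mathbb B^n$. Korányi region: for $R\ge1$, $K(e_1,R)=\{z\in\mathbb B^n:|1-z_1|\le\frac R2(1-\|z\|^2)\}$. Restricted $K$-limit: $\angle_K\lim_{z\to e_1}f(z)=L$ means that for every sequence $z_k\in\mathbb B^n$ with $z_k\to e_1$, $\|z_k-\langle z_k,e_1\rangle e_1\|^2/(1-|\langle z_k,e_1\rangle|^2)\to0$ and $\langle z_k,e_1\rangle\to1$ non-tangentially in $\mathbb D$, one has $f(z_k)\to L$. Let $u_{\mathbb B^n}(z)=-\frac{1-\|z\|^2}{|1-z_1|^2}$ and, for $w\in\mathbb C^n$, $d(u_{\mathbb B^n})_z\cdot w=\frac{d}{dt}\big|_{t=0}u_{\mathbb B^n}(z+tw)$ ($t$ real). The point $e_1$ is a boundary regular null point (BRNP) of the infinitesimal generator $G$ if there is $b\in\mathbb R$ with $d(u_{\mathbb B^n})_z\cdot G(z)+b\,u_{\mathbb B^n}(z)\le0$ for all $z\in\mathbb B^n$; then the dilation of $G$ at $e_1$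 is $\beta:=-\inf_{z\in\mathbb B^n}\frac{d(u_{\mathbb B^n})_z\cdot G(z)}{u_{\mathbb B^n}(z)}\in\mathbb R$. *)

(* Defs.v *)
From Stdlib Require Import Reals.
From mathcomp Require Import ssreflect ssrfun ssrbool eqtype ssrnat fintype bigop.
Open Scope R_scope.

Definition C := (R * R)%type.
Definition RtoC (r : R) : C := (r, 0).
Definition Czero : C := (0, 0).
Definition Cone : C := (1, 0).
Definition Cadd (a b : C) : C := (fst a + fst b, snd a + snd b).
Definition Copp (a : C) : C := (- fst a, - snd a).
Definition Csub (a b : C) : C := Cadd a (Copp b).
Definition Cmul (a b : C) : C :=
  (fst a * fst b - snd a * snd b, fst a * snd b + snd a * fst b).
Definition Cconj (a : C) : C := (fst a, - snd a).
Definition Cnorm2 (a : C) : R := fst a ^ 2 + snd a ^ 2.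
Definition Cmod (a : C) : R := sqrt (Cnorm2 a).
Definition Cinv (a : C) : C := (fst a / Cnorm2 a, - snd a / Cnorm2 a).
Definition Cdiv (a b : C) : C := Cmul a (Cinv b).
(* principal branch of the square root (branch cut on the negative real axis) *)
Definition Csqrt (a : C) : C :=
  (sqrt ((Cmod a + fst a) / 2),
   (if Rlt_dec (snd a) 0 then -1 else 1) * sqrt ((Cmod a - fst a) / 2)).

(* ---------- C^n, indexed by 'I_n (index 0 is the first coordinate) ---------- *)
Definition vec (n : nat) := 'I_n -> C.
Definition vadd {n} (u v : vec n) : vec n := fun i => Cadd (u i) (v i).
Definition vsub {n} (u v : vec n) : vec n := fun i => Csub (u i) (v i).
Definition vscal {n} (c : C) (v : vec n) : vec n := fun i => Cmul c (v i).
Definition vscalR {n} (t : R) (v : vec n) : vec n := vscal (RtoC t) v.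
Definition inner {n} (z w : vec n) : C :=
  \big[Cadd/Czero]_(i < n) Cmul (z i) (Cconj (w i)).
Definition vnorm2 {n} (z : vec n) : R := \big[Rplus/0]_(i < n) Cnorm2 (z i).
Definition vnorm {n} (z : vec n) : R := sqrt (vnorm2 z).
(* basis n k = e_{k+1}; so basis n 0 = e_1 *)
Definition basis (n k : nat) : vec n :=
  fun i => if nat_of_ord i == k then Cone else Czero.
Definition ball {n} (z : vec n) : Prop := vnorm2 z < 1.
Definition coord1 {n} (z : vec n) : C := inner z (basis n 0).

Definition Clinear {n} (L : vec n -> vec n) : Prop :=
  forall (a : C) (u v : vec n) (i : 'I_n),
    L (vadd (vscal a u) v) i = vadd (vscal a (L u)) (L v) i.
Definition is_cderiv {n} (G : vec n -> vec n) (z : vec n) (L : vec n -> vec n) : Prop :=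
  Clinear L /\
  forall eps, 0 < eps -> exists delta, 0 < delta /\
    forall h : vec n, ball (vadd z h) -> 0 < vnorm h < delta ->
      vnorm (vsub (vsub (G (vadd z h)) (G z)) (L h)) <= eps * vnorm h.

Definition has_deriv_on_halfline {n} (x : R -> vec n) (t : R) (v : vec n) : Prop :=
  forall eps, 0 < eps -> exists delta, 0 < delta /\
    forall s, 0 <= s -> 0 < Rabs (s - t) < delta ->
      vnorm (vsub (vsub (x s) (x t)) (vscalR (s - t) v)) <= eps * Rabs (s - t).
Definition inf_generator {n} (G : vec n -> vec n) : Prop :=
  forall z0 : vec n, ball z0 ->
    exists x : R -> vec n,
      (forall i, x 0 i = z0 i) /\
      (forall t, 0 <= t -> ball (x t)) /\
      (forall t, 0 <= t -> has_deriv_on_halfline x t (G (x t))).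

Definition Koranyi {n} (Rr : R) (z : vec n) : Prop :=
  ball z /\ Cmod (Csub Cone (coord1 z)) <= Rr / 2 * (1 - vnorm2 z).
Definition bounded_on_Koranyi {n} (f : vec n -> R) : Prop :=
  forall Rr, 1 <= Rr -> exists M, forall z : vec n, Koranyi Rr z -> Rabs (f z) <= M.

Definition nontangential (w : nat -> C) : Prop :=
  exists M, forall k, Cmod (Csub Cone (w k)) <= M * (1 - Cmod (w k)).
Definition K_lim {n} (f : vec n -> C) (L : C) : Prop :=
  forall zs : nat -> vec n,
    (forall k, ball (zs k)) ->
    Un_cv (fun k => vnorm (vsub (zs k) (basis n 0))) 0 ->
    Un_cv (fun k => vnorm2 (vsub (zs k) (vscal (coord1 (zs k)) (basis n 0)))
                     / (1 - Cnorm2 (coord1 (zs k)))) 0 ->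
    Un_cv (fun k => Cmod (Csub (coord1 (zs k)) Cone)) 0 ->
    nontangential (fun k => coord1 (zs k)) ->
    Un_cv (fun k => Cmod (Csub (f (zs k)) L)) 0.

Definition uB {n} (z : vec n) : R :=
  - (1 - vnorm2 z) / Cnorm2 (Csub Cone (coord1 z)).
Definition du_is {n} (z w : vec n) (l : R) : Prop :=
  derivable_pt_lim (fun t => uB (vadd z (vscalR t w))) 0 l.
Definition BRNP {n} (G : vec n -> vec n) : Prop :=
  exists b : R, forall z : vec n, ball z ->
    exists l, du_is z (G z) l /\ l + b * uB z <= 0.
(* beta = - inf_{z in B^n} (du_z . G(z)) / u(z) = sup_z -(du_z . G(z))/u(z) *)
Definition is_dilation {n} (G : vec n -> vec n) (beta : R) : Prop :=
  is_lub (fun y => exists (z : vec n) l, ball z /\ du_is z (G z) l /\ y = - (l / uB z)) beta.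

(* Main.v *)
(** Along a trajectory the natural quantity is [- uB]. In the Siegel model of the ball it is
    the real part of a holomorphic function with values in the right half-plane, as long as
    one stays on a fixed complex geodesic through [e_1]; off the geodesic it is smaller. So
    the flow of [G], which is holomorphic in the initial point, induces on each geodesic
    holomorphic self-maps of the half-plane starting from the identity, and the infinitesimal
    Schwarz-Pick inequality [|h'(w)| Re w <= Re h(w)] shows that
    [Re Q(x + i y) / x] is nonincreasing in [x], where [Q] is the induced field.
    Its limit as [x] tends to infinity is, by the growth hypotheses and Cauchy estimates in
    Koranyi regions, the same for every geodesic and every [y], and is minus the radial limit
    of [Re (G_1 / (z_1 - 1))]. This yields the boundary regular null point, identifies the
    dilation [beta] with that radial limit, and makes [Q(w) + beta w] on the geodesic through
    the origin a function with nonnegative real part that is [o(w)]; the latter is a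
    non-tangential limit, which Cauchy estimates spread to restricted K-limits.

    The differentiability hypothesis is pointwise, so Cauchy's estimates rest on Goursat's
    lemma; the flow is differentiated by applying Gronwall to its difference quotients. *)

From HB Require Import structures.
From Coquelicot Require Import Coquelicot.
From Stdlib Require Import Reals Lra Lia FunctionalExtensionality ClassicalEpsilon.
Require Import Defs.
From mathcomp Require Import ssreflect ssrfun ssrbool eqtype ssrnat fintype bigop.
Open Scope R_scope.
Set Implicit Arguments.
Unset Strict Implicit.
Unset Printing Implicit Defensive.

Declare Scope cx_scope.
Delimit Scope cx_scope with cx.
Bind Scope cx_scope with Defs.C.
Notation "a + b" := (Cadd a%cx b%cx) : cx_scope.
Notation "a - b" := (Csub a%cx b%cx) : cx_scope.
Notation "- a" := (Copp a%cx) : cx_scope.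
Notation "a * b" := (Cmul a%cx b%cx) : cx_scope.
Notation "a / b" := (Cdiv a%cx b%cx) : cx_scope.
Notation "1" := Cone : cx_scope.
Notation "0" := Czero : cx_scope.

(** * Complex arithmetic *)

(* The operations of [Defs] are convertible to those of Coquelicot's complex numbers. *)
Add Field C_field : (Coquelicot.Complex.C_field_theory :
  field_theory Czero Cone Cadd Cmul Csub Copp Cdiv Cinv eq).

Lemma C_ext (a b : C) : fst a = fst b -> snd a = snd b -> a = b.
Proof. by case: a b => [a1 a2] [b1 b2] /= -> ->. Qed.

Ltac cx_unfold :=
  rewrite /Cdiv /Cinv /Csub /Cadd /Copp /Cmul /Cconj /RtoC /Cone /Czero /Cnorm2 /=.
Ltac cx_ring := apply C_ext; cx_unfold; ring.

Lemma Cnorm2_ge0 (a : C) : 0 <= Cnorm2 a.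
Proof. by rewrite /Cnorm2; nra. Qed.

Lemma Cnorm2_gt0 (a : C) : a <> 0%cx -> 0 < Cnorm2 a.
Proof.
move=> a0; case: (Cnorm2_ge0 a) => // N0; case: a0.
by apply C_ext; rewrite /Cnorm2 /= in N0 *; nra.
Qed.

Lemma Cmod_ge0 (a : C) : 0 <= Cmod a.
Proof. exact: sqrt_pos. Qed.

Lemma Cmod_sqr (a : C) : Cmod a ^ 2 = Cnorm2 a.
Proof. by rewrite /Cmod pow2_sqrt //; exact: Cnorm2_ge0. Qed.

Lemma Cmod0 : Cmod 0 = 0.
Proof. exact: Coquelicot.Complex.Cmod_0. Qed.

Lemma Cmod1 : Cmod 1 = 1.
Proof. exact: Coquelicot.Complex.Cmod_1. Qed.

Lemma Cmod_RtoC (x : R) : Cmod (RtoC x) = Rabs x.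
Proof. exact: Coquelicot.Complex.Cmod_R. Qed.

Lemma Cmod_imaginary (y : R) : Cmod (0, y) = Rabs y.
Proof. by rewrite -sqrt_Rsqr_abs; congr sqrt; rewrite /Cnorm2 /Rsqr /=; ring. Qed.

Lemma Cmod_RtoC_ge0 (x : R) : 0 <= x -> Cmod (RtoC x) = x.
Proof. by move=> x0; rewrite Cmod_RtoC Rabs_pos_eq. Qed.

Lemma Cmod_eq0 (a : C) : Cmod a = 0 -> a = 0%cx.
Proof. exact: Coquelicot.Complex.Cmod_eq_0. Qed.

Lemma Cmod_gt0 (a : C) : a <> 0%cx -> 0 < Cmod a.
Proof. by move/Cnorm2_gt0; exact: sqrt_lt_R0. Qed.

Lemma Cmod_neq0 (a : C) : 0 < Cmod a -> a <> 0%cx.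
Proof. by move=> a0 E; rewrite E Cmod0 in a0; lra. Qed.

Lemma Cmod_mul (a b : C) : Cmod (a * b)%cx = Cmod a * Cmod b.
Proof. exact: Coquelicot.Complex.Cmod_mult. Qed.

Lemma Cmod_inv (a : C) : a <> 0%cx -> Cmod (Cinv a) = / Cmod a.
Proof. exact: Coquelicot.Complex.Cmod_inv. Qed.

Lemma Cmod_div (a b : C) : b <> 0%cx -> Cmod (a / b)%cx = Cmod a / Cmod b.
Proof. by move=> b0; rewrite Cmod_mul Cmod_inv. Qed.

Lemma Cmod_conj (a : C) : Cmod (Cconj a) = Cmod a.
Proof. exact: Coquelicot.Complex.Cmod_conj. Qed.

Lemma Cmod_opp (a : C) : Cmod (- a)%cx = Cmod a.
Proof. exact: Coquelicot.Complex.Cmod_opp. Qed.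

Lemma Cmod_subC (a b : C) : Cmod (a - b)%cx = Cmod (b - a)%cx.
Proof. by rewrite -Cmod_opp; congr Cmod; ring. Qed.

Lemma Cmod_add (a b : C) : Cmod (a + b)%cx <= Cmod a + Cmod b.
Proof. exact: Coquelicot.Complex.Cmod_triangle. Qed.

Lemma Cmod_sub (a b : C) : Cmod (a - b)%cx <= Cmod a + Cmod b.
Proof. by rewrite -(Cmod_opp b); exact: Cmod_add. Qed.

Lemma Cmod_dist_triangle (a b c : C) :
  Cmod (a - c)%cx <= Cmod (a - b)%cx + Cmod (b - c)%cx.
Proof.
have -> : (a - c)%cx = ((a - b) + (b - c))%cx by ring.
exact: Cmod_add.
Qed.

Lemma Cmod_le_dist (a b : C) : Cmod a <= Cmod b + Cmod (a - b)%cx.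
Proof.
have {1}-> : a = (b + (a - b))%cx by ring.
exact: Cmod_add.
Qed.

Lemma Rabs_fst_le_Cmod (a : C) : Rabs (fst a) <= Cmod a.
Proof. by apply: Rle_trans (Rmax_l _ _) (Coquelicot.Complex.Rmax_Cmod a). Qed.

Lemma Rabs_snd_le_Cmod (a : C) : Rabs (snd a) <= Cmod a.
Proof. by apply: Rle_trans (Rmax_r _ _) (Coquelicot.Complex.Rmax_Cmod a). Qed.

Lemma fst_le_Cmod (a : C) : fst a <= Cmod a.
Proof. exact: Rle_trans (Rle_abs _) (Rabs_fst_le_Cmod a). Qed.

Lemma Cmod_le_of_Cnorm2 (a : C) (m : R) : 0 <= m -> Cnorm2 a <= m ^ 2 -> Cmod a <= m.
Proof.
by move=> m0 h; rewrite -(sqrt_pow2 m m0); exact: sqrt_le_1_alt.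
Qed.

Lemma Cmod_le_fst_snd (a : C) : Cmod a <= Rabs (fst a) + Rabs (snd a).
Proof.
have a1 := Rabs_pos (fst a); have a2 := Rabs_pos (snd a).
by apply: Cmod_le_of_Cnorm2; rewrite /Cnorm2 -?(pow2_abs (fst a)) -?(pow2_abs (snd a)); nra.
Qed.

Lemma fst_mul_conj_le (a b : C) : fst (a * Cconj b)%cx <= Cmod a * Cmod b.
Proof. by rewrite -(Cmod_conj b) -Cmod_mul; exact: fst_le_Cmod. Qed.

Lemma Cmod_sub_ge (a b : C) : Cmod a - Cmod b <= Cmod (a - b)%cx.
Proof. by have := Cmod_le_dist a b; lra. Qed.

(* Bounding [Re (l a)] for all unimodular [l] reduces modulus estimates to real ones. *)
Lemma Cmod_le_by_rotation (a : C) (m : R) :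
  (forall l : C, Cmod l = 1 -> fst (l * a)%cx <= m) -> Cmod a <= m.
Proof.
move=> le_m; case: (Req_dec (Cmod a) 0) => [E|N].
  by have := le_m _ Cmod1; rewrite (Cmod_eq0 E) Cmod0 /=; lra.
have a0 : 0 < Cmod a by have := Cmod_ge0 a; lra.
have := le_m (Cconj a * RtoC (/ Cmod a))%cx.
have -> : fst (Cconj a * RtoC (/ Cmod a) * a)%cx = Cmod a.
  transitivity (Cnorm2 a / Cmod a); first by cx_unfold; field; lra.
  by rewrite -Cmod_sqr; field; lra.
apply; rewrite Cmod_mul Cmod_conj Cmod_RtoC_ge0; first by field; lra.
by apply/Rlt_le/Rinv_0_lt_compat.
Qed.

Lemma one_sub_Cnorm2_le (a : C) : Cmod a <= 1 -> 1 - Cnorm2 a <= 2 * Cmod (1 - a)%cx.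
Proof.
by move=> a1; have := Cmod_sub_ge 1 a; rewrite Cmod1 -Cmod_sqr; have := Cmod_ge0 a; nra.
Qed.

Lemma Cmod_Csqrt (a : C) : Cmod (Csqrt a) = sqrt (Cmod a).
Proof.
rewrite {1}/Cmod; congr sqrt; rewrite /Csqrt.
have /Rabs_le_between fst_a := Rabs_fst_le_Cmod a.
set s := (if _ then _ else _); have s2 : s ^ 2 = 1 by rewrite /s; case: Rlt_dec => ? /=; ring.
transitivity (sqrt ((Cmod a + fst a) / 2) ^ 2 + s ^ 2 * sqrt ((Cmod a - fst a) / 2) ^ 2).
  by rewrite /Cnorm2 /=; ring.
by rewrite s2 !pow2_sqrt; lra.
Qed.

(** * Complex differentiability *)

Notation CR := Coquelicot.Complex.C_R_NormedModule.

Section Filterdiff.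
Variable U : NormedModule R_AbsRing.
Implicit Types (p q lp lq : U -> R) (f g lf lg : U -> C) (x : U).

Lemma filterdiff_eq_Rlin p lp lq x : (forall h, lp h = lq h) ->
  filterdiff (V := R_NormedModule) p (locally x) lp ->
  filterdiff (V := R_NormedModule) p (locally x) lq.
Proof. by move=> E p_lp; apply: filterdiff_ext_lin p_lp E. Qed.

Lemma filterdiff_eq_Clin f lf lg x : (forall h, lf h = lg h) ->
  filterdiff (V := CR) f (locally x) lf -> filterdiff (V := CR) f (locally x) lg.
Proof. by move=> E f_lf; apply: filterdiff_ext_lin f_lf E. Qed.

Lemma filterdiff_pair (V W : NormedModule R_AbsRing) (k lk : U -> V) (m lm : U -> W) x :
  filterdiff k (locally x) lk -> filterdiff m (locally x) lm ->
  filterdiff (V := prod_NormedModule _ V W) (fun t => (k t, m t)) (locally x)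
    (fun h => (lk h, lm h)).
Proof.
move=> k_lk m_lm; apply: (filterdiff_comp'_2 k m pair x lk lm pair k_lk m_lm).
apply: (filterdiff_ext (fun t => t)); first by case.
by apply: filterdiff_ext_lin; [exact: filterdiff_id | case].
Qed.

Lemma filterdiff_fst f lf x : filterdiff (V := CR) f (locally x) lf ->
  filterdiff (V := R_NormedModule) (fun t => fst (f t)) (locally x) (fun h => fst (lf h)).
Proof.
move=> f_lf; apply: (filterdiff_comp' (V := CR) f fst x lf fst f_lf).
exact/filterdiff_linear/is_linear_fst.
Qed.

Lemma filterdiff_snd f lf x : filterdiff (V := CR) f (locally x) lf ->
  filterdiff (V := R_NormedModule) (fun t => snd (f t)) (locally x) (fun h => snd (lf h)).
Proof.
move=> f_lf; apply: (filterdiff_comp' (V := CR) f snd x lf snd f_lf).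
exact/filterdiff_linear/is_linear_snd.
Qed.

Lemma filterdiff_Rmult p q lp lq x :
  filterdiff (V := R_NormedModule) p (locally x) lp ->
  filterdiff (V := R_NormedModule) q (locally x) lq ->
  filterdiff (V := R_NormedModule) (fun t => p t * q t) (locally x)
    (fun h => lp h * q x + p x * lq h).
Proof. exact: (@filterdiff_mult_fct R_AbsRing U p q x lp lq Rmult_comm). Qed.

Lemma filterdiff_Rinv p lp x : p x <> 0 ->
  filterdiff (V := R_NormedModule) p (locally x) lp ->
  filterdiff (V := R_NormedModule) (fun t => / p t) (locally x) (fun h => - lp h / p x ^ 2).
Proof.
move=> p0 p_lp; have inv_diff := is_derive_inv (fun t => t) (p x) _ (is_derive_id _) p0.
apply: filterdiff_eq_Rlin (filterdiff_comp' _ _ _ _ _ p_lp inv_diff) => h.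
by rewrite /scal /= /mult /one /=; field.
Qed.

Lemma filterdiff_Cnorm2 f lf x : filterdiff (V := CR) f (locally x) lf ->
  filterdiff (V := R_NormedModule) (fun t => Cnorm2 (f t)) (locally x)
    (fun h => 2 * (fst (f x) * fst (lf h) + snd (f x) * snd (lf h))).
Proof.
move=> f_lf; have [f1 f2] := (filterdiff_fst f_lf, filterdiff_snd f_lf).
apply: (filterdiff_ext (V := R_NormedModule) (fun t => fst (f t) * fst (f t) + snd (f t) * snd (f t))).
  by move=> t; rewrite /Cnorm2 /=; ring.
apply: filterdiff_eq_Rlin
  (filterdiff_plus_fct _ _ _ _ (filterdiff_Rmult f1 f1) (filterdiff_Rmult f2 f2)) => h.
by rewrite /plus /=; ring.
Qed.

Lemma filterdiff_Cmul f g lf lg x :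
  filterdiff (V := CR) f (locally x) lf -> filterdiff (V := CR) g (locally x) lg ->
  filterdiff (V := CR) (fun t => f t * g t)%cx (locally x)
    (fun h => lf h * g x + f x * lg h)%cx.
Proof.
move=> f_lf g_lg.
have [f1 f2] := (filterdiff_fst f_lf, filterdiff_snd f_lf).
have [g1 g2] := (filterdiff_fst g_lg, filterdiff_snd g_lg).
apply: filterdiff_eq_Clin (filterdiff_pair
  (filterdiff_minus_fct _ _ _ _ (filterdiff_Rmult f1 g1) (filterdiff_Rmult f2 g2))
  (filterdiff_plus_fct _ _ _ _ (filterdiff_Rmult f1 g2) (filterdiff_Rmult f2 g1))) => h.
by rewrite /minus /plus /opp /=; cx_ring.
Qed.

Lemma filterdiff_Cinv g lg x : g x <> 0%cx ->
  filterdiff (V := CR) g (locally x) lg ->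
  filterdiff (V := CR) (fun t => Cinv (g t)) (locally x) (fun h => - (lg h / (g x * g x)))%cx.
Proof.
move=> /Cnorm2_gt0 g0 g_lg.
have [g1 g2] := (filterdiff_fst g_lg, filterdiff_opp_fct _ _ (filterdiff_snd g_lg)).
have inv_diff := filterdiff_Rinv (Rgt_not_eq _ _ g0) (filterdiff_Cnorm2 g_lg).
apply: filterdiff_eq_Clin
  (filterdiff_pair (filterdiff_Rmult g1 inv_diff) (filterdiff_Rmult g2 inv_diff)) => h.
move: (g x) (lg h) g0 => [a b] [p q]; rewrite /opp /=; cx_unfold => g0.
by apply C_ext; rewrite /=; field; split; nra.
Qed.

Lemma filterdiff_Cdiv f g lf lg x : g x <> 0%cx ->
  filterdiff (V := CR) f (locally x) lf -> filterdiff (V := CR) g (locally x) lg ->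
  filterdiff (V := CR) (fun t => f t / g t)%cx (locally x)
    (fun h => (lf h * g x - f x * lg h) / (g x * g x))%cx.
Proof.
move=> g0 f_lf g_lg; apply: filterdiff_eq_Clin (filterdiff_Cmul f_lf (filterdiff_Cinv g0 g_lg)) => h.
by cbv beta; field.
Qed.

Lemma filterdiff_Cadd f g lf lg x :
  filterdiff (V := CR) f (locally x) lf -> filterdiff (V := CR) g (locally x) lg ->
  filterdiff (V := CR) (fun t => f t + g t)%cx (locally x) (fun h => lf h + lg h)%cx.
Proof. exact: filterdiff_plus_fct. Qed.

Lemma filterdiff_Csub f g lf lg x :
  filterdiff (V := CR) f (locally x) lf -> filterdiff (V := CR) g (locally x) lg ->
  filterdiff (V := CR) (fun t => f t - g t)%cx (locally x) (fun h => lf h - lg h)%cx.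
Proof. exact: filterdiff_minus_fct. Qed.

Lemma filterdiff_Cconst (a : C) x :
  filterdiff (V := CR) (fun _ : U => a) (locally x) (fun _ => 0%cx).
Proof. exact: (filterdiff_const (V := CR)). Qed.

End Filterdiff.

Definition is_cderive (F : C -> C) (z d : C) : Prop :=
  filterdiff (K := R_AbsRing) (U := CR) (V := CR) F (locally (T := CR) z) (fun h => d * h)%cx.

Lemma is_cderive_val (F : C -> C) (z d d' : C) : is_cderive F z d -> d = d' -> is_cderive F z d'.
Proof. by move=> Fd <-. Qed.

Lemma is_cderive_ext (F J : C -> C) (z d : C) :
  (forall x, F x = J x) -> is_cderive F z d -> is_cderive J z d.
Proof. by move=> E; apply: filterdiff_ext. Qed.

Lemma is_cderive_const (a z : C) : is_cderive (fun _ => a) z 0.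
Proof. by apply: filterdiff_eq_Clin (filterdiff_Cconst (U := CR) a z) => h; ring. Qed.

Lemma is_cderive_id (z : C) : is_cderive (fun x => x) z 1.
Proof. by apply: (@filterdiff_eq_Clin CR) (filterdiff_id _) => h; symmetry; ring. Qed.

Section Derivatives.
Variables (F J : C -> C) (z d d' : C).
Hypotheses (F_d : is_cderive F z d) (J_d' : is_cderive J z d').

Lemma is_cderive_add : is_cderive (fun x => F x + J x)%cx z (d + d')%cx.
Proof. by apply: filterdiff_eq_Clin (filterdiff_Cadd F_d J_d') => h; ring. Qed.

Lemma is_cderive_sub : is_cderive (fun x => F x - J x)%cx z (d - d')%cx.
Proof. by apply: filterdiff_eq_Clin (filterdiff_Csub F_d J_d') => h; ring. Qed.

Lemma is_cderive_mul : is_cderive (fun x => F x * J x)%cx z (d * J z + F z * d')%cx.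
Proof. by apply: filterdiff_eq_Clin (filterdiff_Cmul F_d J_d') => h; ring. Qed.

Lemma is_cderive_div : J z <> 0%cx ->
  is_cderive (fun x => F x / J x)%cx z ((d * J z - F z * d') / (J z * J z))%cx.
Proof. by move=> J0; apply: filterdiff_eq_Clin (filterdiff_Cdiv J0 F_d J_d') => h; field. Qed.

End Derivatives.

Lemma is_cderive_scal (F : C -> C) (z d a : C) :
  is_cderive F z d -> is_cderive (fun x => a * F x)%cx z (a * d)%cx.
Proof. by move=> F_d; apply: is_cderive_val (is_cderive_mul (is_cderive_const a z) F_d) _; ring. Qed.

Lemma is_cderive_comp (F J : C -> C) (z d d' : C) :
  is_cderive J z d' -> is_cderive F (J z) d -> is_cderive (fun x => F (J x)) z (d * d')%cx.
Proof.
by move=> J_d' F_d; apply: (@filterdiff_eq_Clin CR) (filterdiff_comp' _ _ _ _ _ J_d' F_d) => h; ring.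
Qed.

Notation is_path_derive := (is_derive (K := R_AbsRing) (V := CR)).

Lemma filterdiff_norm_eps (U V : NormedModule R_AbsRing) (f l : U -> V) (x : U) :
  filterdiff f (locally x) l <->
  is_linear l /\ forall eps, 0 < eps -> exists delta, 0 < delta /\ forall y,
    norm (minus y x) < delta ->
    norm (minus (minus (f y) (f x)) (l (minus y x))) <= eps * norm (minus y x).
Proof.
split=> [[lin f_l]|[lin f_l]]; split=> //.
  move=> e e0.
  case: (locally_norm_le_locally _ _ (f_l x (fun P h => h) (mkposreal e e0))) => -[delta d0] delta_le.
  by exists delta; split.
move=> y /is_filter_lim_locally_unique <- [e e0].
case: (f_l e e0) => delta [d0 delta_le]; apply: locally_le_locally_norm.
by exists (mkposreal delta d0).
Qed.

Lemma is_cderive_eps (F : C -> C) (z d : C) :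
  is_cderive F z d <->
  forall eps, 0 < eps -> exists delta, 0 < delta /\ forall h : C, Cmod h < delta ->
    Cmod (F (z + h) - F z - d * h)%cx <= eps * Cmod h.
Proof.
have normE (h : C) : norm (V := CR) h = Cmod h by rewrite -Coquelicot.Complex.Cmod_norm.
have minusE (a b : C) : minus (G := CR) a b = (a - b)%cx by [].
have lin : is_linear (U := CR) (V := CR) (fun h => d * h)%cx.
  by have [] := is_cderive_val (is_cderive_scal d (is_cderive_id z)) (_ : _ = d); first ring.
split=> [/filterdiff_norm_eps [_ F_d] e e0|F_d].
  case: (F_d e e0) => delta [d0 delta_le]; exists delta; split=> // h hh.
  have := delta_le (z + h)%cx; rewrite !normE !minusE.
  have -> : (z + h - z)%cx = h by ring.
  exact.
apply/(@filterdiff_norm_eps CR CR); split=> // e e0; case: (F_d e e0) => delta [d0 delta_le].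
exists delta; split=> // y; rewrite !normE !minusE => /delta_le.
by have -> : (z + (y - z))%cx = y by ring.
Qed.

Lemma is_path_derive_eps (f : R -> C) (t : R) (d : C) :
  (forall eps, 0 < eps -> exists delta, 0 < delta /\ forall s, Rabs (s - t) < delta ->
    Cmod (f s - f t - RtoC (s - t) * d)%cx <= eps * Rabs (s - t)) ->
  is_path_derive f t d.
Proof.
move=> f_d; apply/filterdiff_norm_eps; split.
  exact: is_linear_scal_l.
move=> e e0; case: (f_d e e0) => delta [d0 delta_le]; exists delta; split=> // s /delta_le.
rewrite -Coquelicot.Complex.Cmod_norm.
have -> // : (f s - f t - RtoC (s - t) * d)%cx = minus (G := CR) (minus (f s) (f t)) (scal (minus s t) d).
rewrite [scal _ _](_ : _ = (RtoC (s - t) * d)%cx) //.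
by apply C_ext; rewrite /= /scal /= /mult /= /minus /plus /opp /=; ring.
Qed.

Lemma is_path_derive_sub (f g : R -> C) (t : R) (d d' : C) :
  is_path_derive f t d -> is_path_derive g t d' ->
  is_path_derive (fun s => f s - g s)%cx t (d - d')%cx.
Proof. exact: is_derive_minus. Qed.

Lemma scal_RtoC (s : R) (d : C) : scal (V := CR) s d = (RtoC s * d)%cx.
Proof. by apply C_ext; rewrite /= /scal /= /mult /=; ring. Qed.

Lemma is_path_derive_comp (F : C -> C) (f : R -> C) (t : R) (d d' : C) :
  is_path_derive f t d -> is_cderive F (f t) d' ->
  is_path_derive (fun s => F (f s)) t (d' * d)%cx.
Proof.
move=> f_d F_d'; apply: (@filterdiff_eq_Clin R_NormedModule) (filterdiff_comp' _ _ _ _ _ f_d F_d') => h.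
by rewrite !scal_RtoC; ring.
Qed.

Lemma is_path_derive_scal (f : R -> C) (t : R) (a d : C) :
  is_path_derive f t d -> is_path_derive (fun s => a * f s)%cx t (a * d)%cx.
Proof.
move=> f_d; apply: (is_path_derive_comp (F := fun z => (a * z)%cx)) f_d _.
by apply: is_cderive_val (is_cderive_scal a (is_cderive_id _)) _; ring.
Qed.

Lemma is_path_derive_line (a b : C) (t : R) : is_path_derive (fun s => a + RtoC s * b)%cx t b.
Proof.
apply: is_path_derive_eps => e e0; exists 1; split; first lra.
move=> s _; have -> : (a + RtoC s * b - (a + RtoC t * b) - RtoC (s - t) * b)%cx = 0%cx by cx_ring.
by rewrite Cmod0; have := Rabs_pos (s - t); nra.
Qed.

Lemma is_derive_fst_path (f : R -> C) (t : R) (d : C) :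
  is_path_derive f t d -> is_derive (fun s => fst (f s)) t (fst d).
Proof. by move=> f_d; exact: (filterdiff_fst (U := R_NormedModule) f_d). Qed.

Lemma is_derive_Cnorm2_path (f : R -> C) (t : R) (d : C) : is_path_derive f t d ->
  is_derive (fun s => Cnorm2 (f s)) t (2 * fst (f t * Cconj d)%cx).
Proof.
move=> f_d; apply: (@filterdiff_eq_Rlin R_NormedModule) (filterdiff_Cnorm2 f_d) => h.
by rewrite !scal_RtoC /scal /= /mult /=; cx_unfold; ring.
Qed.

Lemma is_derive_fst_line (F : C -> C) (a b d : C) (t : R) :
  is_cderive F (a + RtoC t * b)%cx d ->
  is_derive (fun s => fst (F (a + RtoC s * b)%cx)) t (fst (d * b)%cx).
Proof.
move=> F_d'; apply: is_derive_fst_path; exact: is_path_derive_comp (is_path_derive_line a b t) F_d'.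
Qed.

Definition ex_cderive (F : C -> C) (z : C) : Prop := exists d, is_cderive F z d.

Definition Cderive (F : C -> C) (z : C) : C := epsilon (inhabits Czero) (is_cderive F z).

Lemma Cderive_correct (F : C -> C) (z : C) : ex_cderive F z -> is_cderive F z (Cderive F z).
Proof. exact: epsilon_spec. Qed.

Lemma is_cderive_continuous (F : C -> C) (z d : C) : is_cderive F z d ->
  forall e, 0 < e -> exists delta, 0 < delta /\
    forall x, Cmod (x - z)%cx < delta -> Cmod (F x - F z)%cx <= e.
Proof.
move=> /is_cderive_eps F_d e e0; case: (F_d 1 Rlt_0_1) => a [a0 a_le]; have d0 := Cmod_ge0 d.
exists (Rmin a (e / (Cmod d + 1))); split.
  by apply: Rmin_pos => //; apply: Rdiv_lt_0_compat; lra.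
move=> x xz; have xa := Rlt_le_trans _ _ _ xz (Rmin_l _ _).
have {xz} : Cmod (x - z)%cx * (Cmod d + 1) < e.
  by apply/Rlt_div_r; [lra | exact: Rlt_le_trans xz (Rmin_r _ _)].
have := a_le _ xa; have -> : (z + (x - z))%cx = x by ring.
by have := Cmod_le_dist (F x - F z)%cx (d * (x - z))%cx; rewrite Cmod_mul; lra.
Qed.

Lemma is_derive_continuity_pt (f : R -> R) (t l : R) : is_derive f t l -> continuity_pt f t.
Proof. by move=> D; apply/continuity_pt_filterlim/ex_derive_continuous; exists l. Qed.

Lemma nonincreasing_of_is_derive (f df : R -> R) (a b : R) : a <= b ->
  (forall t, a <= t <= b -> is_derive f t (df t)) ->
  (forall t, a < t < b -> df t <= 0) -> f b <= f a.
Proof.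
move=> ab D df0; case: (Req_dec a b) => [->|ab_neq]; first lra.
case: (MVT_cor2 f df a b) => [||c [E c_in]]; first lra.
  by move=> t /D /is_derive_Reals.
by have := df0 c c_in; nra.
Qed.

Lemma mean_value_ineq (F F' : C -> C) (a b : C) (m : R) :
  (forall t, 0 <= t <= 1 -> is_cderive F (a + RtoC t * b)%cx (F' (a + RtoC t * b)%cx)) ->
  (forall t, 0 <= t <= 1 -> Cmod (F' (a + RtoC t * b)%cx * b)%cx <= m) ->
  Cmod (F (a + b) - F a)%cx <= m.
Proof.
move=> F_F' F'_le; apply: Cmod_le_by_rotation => l l1.
have D t : 0 <= t <= 1 -> is_derive (fun t => fst (l * F (a + RtoC t * b))%cx) t
    (fst (l * F' (a + RtoC t * b) * b)%cx).
  move=> t01; apply: (is_derive_fst_line (F := fun z => (l * F z)%cx)).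
  by apply: is_cderive_scal; exact: F_F'.
case: (MVT_cor2 _ _ 0 1 Rlt_0_1 (fun t t01 => proj1 (is_derive_Reals _ _ _) (D t t01))) => c [E c_in].
have -> : fst (l * (F (a + b) - F a))%cx = fst (l * (F' (a + RtoC c * b) * b))%cx.
  move: E; have -> : (a + RtoC 1 * b)%cx = (a + b)%cx by cx_ring.
  have -> : (a + RtoC 0 * b)%cx = a by cx_ring.
  have -> : (l * F' (a + RtoC c * b) * b)%cx = (l * (F' (a + RtoC c * b) * b))%cx by ring.
  set w := (l * (_ * b))%cx => E; transitivity (fst w * (1 - 0)); last by ring.
  by rewrite -E; cx_unfold; ring.
apply: Rle_trans (fst_le_Cmod _) _; rewrite Cmod_mul l1 Rmult_1_l.
by apply: F'_le; lra.
Qed.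

Lemma exp_le (x y : R) : x <= y -> exp x <= exp y.
Proof. by case=> [/exp_increasing|->]; lra. Qed.

Lemma gronwall (f df : R -> R) (T A B K : R) :
  0 <= T -> 0 <= B -> 0 <= K -> f 0 <= A ->
  (forall t, 0 <= t <= T -> is_derive f t (df t)) ->
  (forall t, 0 < t < T -> df t <= K * f t + B) ->
  f T <= (A + B * T) * exp (K * T).
Proof.
move=> T0 B0 K0 f0_le f_df df_le; pose g t := f t * exp (- (K * t)) - B * t.
suff : g T <= g 0.
  rewrite /g !Rmult_0_r Ropp_0 exp_0 Rmult_1_r exp_Ropp => gT_le.
  by apply/Rle_div_l; [exact: exp_pos | rewrite /Rdiv; lra].
apply: (@nonincreasing_of_is_derive g
  (fun t => df t * exp (- (K * t)) + f t * (- K * exp (- (K * t))) - B)) => // t t_in.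
  apply: (is_derive_minus (V := R_NormedModule)); last by auto_derive => //; ring.
  by apply: is_derive_mult; [exact: f_df | auto_derive => //; ring | exact: Rmult_comm].
have exp_gt0 := exp_pos (- (K * t)).
have exp_le1 : exp (- (K * t)) <= 1 by rewrite -exp_0; apply: exp_le; nra.
by have := df_le t t_in; nra.
Qed.

(** * Goursat's lemma *)

Lemma dependent_choice (T : Type) (P : T -> Prop) (E : T -> T -> Prop) (x : T) :
  P x -> (forall y, P y -> exists z, P z /\ E y z) ->
  exists s : nat -> T, s O = x /\ forall k, P (s k) /\ E (s k) (s (S k)).
Proof.
move=> Px next; pose f y := epsilon (inhabits y) (fun z => P z /\ E y z).
have fP y : P y -> P (f y) /\ E y (f y).
  by move=> /next; exact: (epsilon_spec (inhabits y) (fun z => P z /\ E y z)).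
exists (fun k => iter k f x); split=> // k.
suff Pk : P (iter k f x) by split=> //; have [] := fP _ Pk.
by elim: k => [|k /fP []].
Qed.

Lemma nested_intervals (u v : nat -> R) :
  (forall k, u k <= u (S k)) -> (forall k, v (S k) <= v k) -> (forall k, u k <= v k) ->
  exists x, forall k, u k <= x <= v k.
Proof.
move=> u_incr v_decr uv.
have u_mono k j : (k <= j)%N -> u k <= u j.
  move=> /subnK <-; elim: (j - k)%N => [|i IH]; first by rewrite add0n; lra.
  by rewrite addSn; have := u_incr (i + k)%N; lra.
have v_mono k j : (k <= j)%N -> v j <= v k.
  move=> /subnK <-; elim: (j - k)%N => [|i IH]; first by rewrite add0n; lra.
  by rewrite addSn; have := v_decr (i + k)%N; lra.
have u_le_v k j : u k <= v j.
  by have := u_mono k _ (leq_maxl k j); have := v_mono j _ (leq_maxr k j); have := uv (maxn k j); lra.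
case: (completeness (fun r => exists k, r = u k)).
- by exists (v O) => r [k ->].
- by exists (u O), O.
move=> x [x_ub x_lub]; exists x => k; split; first by apply: x_ub; exists k.
by apply: x_lub => r [j ->].
Qed.

Record rectangle := Rectangle { left : R; right : R; bottom : R; top : R }.

Definition in_rectangle (r : rectangle) (x y : R) : Prop :=
  left r <= x <= right r /\ bottom r <= y <= top r.

Definition subrectangle (r' r : rectangle) : Prop :=
  left r <= left r' <= right r' /\ right r' <= right r /\
  bottom r <= bottom r' <= top r' /\ top r' <= top r.

Definition quarter (r' r : rectangle) : Prop :=
  subrectangle r' r /\ right r' - left r' = (right r - left r) / 2 /\
  top r' - bottom r' = (top r - bottom r) / 2.

Definition perimeter (r : rectangle) : R := (right r - left r) + (top r - bottom r).

Lemma nested_quarters (s : nat -> rectangle) : (forall k, quarter (s (S k)) (s k)) ->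
  exists x y, forall k, in_rectangle (s k) x y /\ perimeter (s k) = perimeter (s O) * (/ 2) ^ k.
Proof.
rewrite /quarter /subrectangle => s_quarter.
have s_ordered k : left (s k) <= right (s k) /\ bottom (s k) <= top (s k) by have := s_quarter k; lra.
case: (@nested_intervals (fun k => left (s k)) (fun k => right (s k))) => [k|k|k|x x_in].
- by have := s_quarter k; lra.
- by have := s_quarter k; lra.
- by have := s_ordered k; lra.
case: (@nested_intervals (fun k => bottom (s k)) (fun k => top (s k))) => [k|k|k|y y_in].
- by have := s_quarter k; lra.
- by have := s_quarter k; lra.
- by have := s_ordered k; lra.
exists x, y => k; split; first by split.
elim: k => [|k IH] /=; first by rewrite Rmult_1_r.
by have := s_quarter k; rewrite /perimeter in IH *; lra.
Qed.

Lemma rectangle_bisection (Good : rectangle -> Prop) (r : rectangle) :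
  subrectangle r r ->
  (forall q, subrectangle q r -> (forall q', quarter q' q -> Good q') -> Good q) ->
  (forall x y, in_rectangle r x y -> exists delta, 0 < delta /\
     forall q, subrectangle q r -> in_rectangle q x y -> perimeter q < delta -> Good q) ->
  Good r.
Proof.
move=> rr of_quarters locally_good; apply: NNPP => bad.
case: (@dependent_choice _ (fun q => subrectangle q r /\ ~ Good q) (fun q q' => quarter q' q) r).
- by [].
- move=> q [qr q_bad]; apply: NNPP => N; apply: q_bad; apply: of_quarters => // q' q'q.
  apply: NNPP => q'_bad; apply: N; exists q'; split=> //; split=> //.
  by move: q'q qr; rewrite /quarter /subrectangle; lra.
move=> s [s0 s_quarter]; case: (@nested_quarters s) => [k|x [y s_xy]]; first by case: (s_quarter k).
have r_xy : in_rectangle r x y by rewrite -s0; case: (s_xy O).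
case: (locally_good x y r_xy) => delta [d0 near_good].
have p0 : 0 <= perimeter r by move: rr; rewrite /subrectangle /perimeter; lra.
case: (@pow_lt_1_zero (/ 2) _ (delta / (perimeter r + 1))) => [||N /(_ N (le_n _))].
- by rewrite Rabs_pos_eq; lra.
- by apply: Rdiv_lt_0_compat; lra.
have h0 : 0 < (/ 2) ^ N by apply: pow_lt; lra.
rewrite Rabs_pos_eq => [/Rlt_div_r hN|]; last lra.
have {}hN : (/ 2) ^ N * (perimeter r + 1) < delta by apply: hN; lra.
have [[sN bad_N] _] := s_quarter N; have [N_xy pN] := s_xy N.
by apply: bad_N; apply: near_good => //; rewrite pN s0; lra.
Qed.

Definition circulation (P Q : R -> R -> R) (r : rectangle) : R :=
  RInt (fun u => P u (bottom r)) (left r) (right r)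
  + RInt (fun v => Q (right r) v) (bottom r) (top r)
  - RInt (fun u => P u (top r)) (left r) (right r)
  - RInt (fun v => Q (left r) v) (bottom r) (top r).

Lemma RInt_near_const (f : R -> R) (a b m e : R) : a <= b -> ex_RInt f a b ->
  (forall t, a <= t <= b -> Rabs (f t - m) <= e) ->
  Rabs (RInt f a b - m * (b - a)) <= (b - a) * e.
Proof.
move=> ab f_int f_near.
have -> : RInt f a b - m * (b - a) = RInt (fun t => minus (f t) m) a b.
  rewrite RInt_minus // ?RInt_const; last exact: ex_RInt_const.
  by rewrite /minus /plus /opp /scal /= /mult /=; ring.
apply: abs_RInt_le_const => //.
by apply: ex_RInt_minus => //; apply: ex_RInt_const.
Qed.

Lemma differentiable_pt_lim_continuous_l (f : R -> R -> R) (x y lx ly : R) :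
  differentiable_pt_lim f x y lx ly -> continuous (fun u => f u y) x.
Proof.
move=> f_diff; apply/continuity_pt_filterlim/derivable_continuous_pt; exists (lx * 1 + ly * 0).
apply: (derivable_pt_lim_comp_2d f (fun u => u) (fun _ => y)) => //.
  exact: derivable_pt_lim_id.
exact: derivable_pt_lim_const.
Qed.

Lemma differentiable_pt_lim_continuous_r (f : R -> R -> R) (x y lx ly : R) :
  differentiable_pt_lim f x y lx ly -> continuous (fun v => f x v) y.
Proof.
move=> f_diff; apply/continuity_pt_filterlim/derivable_continuous_pt; exists (lx * 0 + ly * 1).
apply: (derivable_pt_lim_comp_2d f (fun _ => x) (fun v => v)) => //.
  exact: derivable_pt_lim_const.
exact: derivable_pt_lim_id.
Qed.

Lemma differentiable_pt_lim_perimeter (f : R -> R -> R) (x y lx ly eta : R) :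
  differentiable_pt_lim f x y lx ly -> 0 < eta ->
  exists delta, 0 < delta /\ forall q u v, in_rectangle q x y -> perimeter q < delta ->
    in_rectangle q u v -> Rabs (f u v - f x y - (lx * (u - x) + ly * (v - y))) <= eta * perimeter q.
Proof.
move=> f_diff e0; case: (f_diff (mkposreal eta e0)) => [[delta d0] /= delta_le].
exists delta; split=> // q u v; rewrite /in_rectangle /perimeter => xy_q q_small uv_q.
have ux : Rabs (u - x) <= right q - left q by apply: Rabs_le; lra.
have vy : Rabs (v - y) <= top q - bottom q by apply: Rabs_le; lra.
apply: Rle_trans (delta_le u v _ _) _; try lra.
by apply: Rmult_le_compat_l; [lra | apply: Rmax_lub; lra].
Qed.

Section Goursat.
Variables (P Q : R -> R -> R) (r : rectangle).
Hypothesis PQ_closed : forall x y, in_rectangle r x y -> exists px m qy,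
  differentiable_pt_lim P x y px m /\ differentiable_pt_lim Q x y m qy.

Lemma closed_ex_RInt_l (a b y : R) : left r <= a -> a <= b -> b <= right r ->
  bottom r <= y <= top r -> ex_RInt (fun u => P u y) a b.
Proof.
move=> ra ab br ry; apply: ex_RInt_continuous => x.
rewrite Rmin_left ?Rmax_right // => xab.
case: (PQ_closed (x := x) (y := y)) => [|px [m [qy [P_diff _]]]]; first by split; lra.
exact: differentiable_pt_lim_continuous_l P_diff.
Qed.

Lemma closed_ex_RInt_r (c d x : R) : bottom r <= c -> c <= d -> d <= top r ->
  left r <= x <= right r -> ex_RInt (fun v => Q x v) c d.
Proof.
move=> rc cd dr rx; apply: ex_RInt_continuous => y.
rewrite Rmin_left ?Rmax_right // => ycd.
case: (PQ_closed (x := x) (y := y)) => [|px [m [qy [_ Q_diff]]]]; first by split; lra.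
exact: differentiable_pt_lim_continuous_r Q_diff.
Qed.

Lemma circulation_quarters (a b c d : R) : let x := (a + b) / 2 in let y := (c + d) / 2 in
  subrectangle (Rectangle a b c d) r ->
  circulation P Q (Rectangle a b c d) =
    circulation P Q (Rectangle a x c y) + circulation P Q (Rectangle x b c y)
    + circulation P Q (Rectangle a x y d) + circulation P Q (Rectangle x b y d).
Proof.
move=> x y; rewrite /subrectangle /= => qr.
have xab : a <= x <= b by rewrite /x; lra.
have ycd : c <= y <= d by rewrite /y; lra.
have P_split v : bottom r <= v <= top r ->
    RInt (fun u => P u v) a b = RInt (fun u => P u v) a x + RInt (fun u => P u v) x b.
  by move=> rv; rewrite -(RInt_Chasles _ a x b) //; apply: closed_ex_RInt_l; lra.
have Q_split u : left r <= u <= right r ->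
    RInt (fun v => Q u v) c d = RInt (fun v => Q u v) c y + RInt (fun v => Q u v) y d.
  by move=> ru; rewrite -(RInt_Chasles _ c y d) //; apply: closed_ex_RInt_r; lra.
by rewrite /circulation /= !P_split ?Q_split; try lra; ring.
Qed.

(* The linear part of the form has no circulation, since its mixed coefficients agree. *)
Lemma circulation_small (x y e : R) : in_rectangle r x y -> 0 < e -> exists delta, 0 < delta /\
  forall q, subrectangle q r -> in_rectangle q x y -> perimeter q < delta ->
    Rabs (circulation P Q q) <= e * perimeter q ^ 2.
Proof.
move=> r_xy e0; case: (PQ_closed r_xy) => px [m [qy [P_diff Q_diff]]].
case: (differentiable_pt_lim_perimeter (eta := e / 2) P_diff) => [|d1 [d10 near_P]]; first lra.
case: (differentiable_pt_lim_perimeter (eta := e / 2) Q_diff) => [|d2 [d20 near_Q]]; first lra.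
exists (Rmin d1 d2); split; first exact: Rmin_pos.
move=> q qr q_xy q_small; have := Rmin_l d1 d2; have := Rmin_r d1 d2 => min2 min1.
have {}near_P u v := near_P q u v q_xy ltac:(lra).
have {}near_Q u v := near_Q q u v q_xy ltac:(lra).
move: qr near_P near_Q; rewrite /subrectangle /circulation /in_rectangle.
move: q {q_xy q_small} => [a b c d] /=; set p := perimeter _ => qr near_P near_Q.
have iP v : c <= v <= d -> ex_RInt (fun u => P u v) a b by move=> ?; apply: closed_ex_RInt_l; lra.
have iQ u : a <= u <= b -> ex_RInt (fun v => Q u v) c d by move=> ?; apply: closed_ex_RInt_r; lra.
have P_edges : Rabs (RInt (fun u => P u c - P u d) a b - m * (c - d) * (b - a)) <= (b - a) * (e * p).
  apply: RInt_near_const => [||t ht]; first lra.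
    by apply: (ex_RInt_minus (V := R_NormedModule)); apply: iP; lra.
  have := near_P t c ltac:(lra); have := near_P t d ltac:(lra).
  by move=> /Rabs_le_between ? /Rabs_le_between ?; apply: Rabs_le; lra.
have Q_edges : Rabs (RInt (fun v => Q b v - Q a v) c d - m * (b - a) * (d - c)) <= (d - c) * (e * p).
  apply: RInt_near_const => [||t ht]; first lra.
    by apply: (ex_RInt_minus (V := R_NormedModule)); apply: iQ; lra.
  have := near_Q b t ltac:(lra); have := near_Q a t ltac:(lra).
  by move=> /Rabs_le_between ? /Rabs_le_between ?; apply: Rabs_le; lra.
have P_minus : RInt (fun u => P u c - P u d) a b = RInt (fun u => P u c) a b - RInt (fun u => P u d) a b.
  by apply: (RInt_minus (V := R_CompleteNormedModule)); apply: iP; lra.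
have Q_minus : RInt (fun v => Q b v - Q a v) c d = RInt (fun v => Q b v) c d - RInt (fun v => Q a v) c d.
  by apply: (RInt_minus (V := R_CompleteNormedModule)); apply: iQ; lra.
rewrite P_minus in P_edges; rewrite Q_minus in Q_edges.
have -> : e * p ^ 2 = (b - a) * (e * p) + (d - c) * (e * p) by rewrite /p /perimeter /=; ring.
by move: P_edges Q_edges => /Rabs_le_between ? /Rabs_le_between ?; apply: Rabs_le; lra.
Qed.

Lemma circulation_le_perimeter (e : R) : subrectangle r r -> 0 < e ->
  Rabs (circulation P Q r) <= e * perimeter r ^ 2.
Proof.
move=> rr e0; pose Good q := Rabs (circulation P Q q) <= e * perimeter q ^ 2.
apply: (@rectangle_bisection Good) => //; rewrite /Good.
  move=> [a b c d] qr of_quarters; rewrite circulation_quarters //.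
  have quarter_le q' : quarter q' (Rectangle a b c d) ->
      Rabs (circulation P Q q') <= e * perimeter (Rectangle a b c d) ^ 2 / 4.
    move=> q'q; apply: Rle_trans (of_quarters _ q'q) _; case: q'q => _.
    by rewrite /perimeter /= => -[-> ->]; apply: Req_le; field.
  have := quarter_le (Rectangle a ((a + b) / 2) c ((c + d) / 2)).
  have := quarter_le (Rectangle ((a + b) / 2) b c ((c + d) / 2)).
  have := quarter_le (Rectangle a ((a + b) / 2) ((c + d) / 2) d).
  have := quarter_le (Rectangle ((a + b) / 2) b ((c + d) / 2) d).
  move: qr; rewrite /quarter /subrectangle /= => qr q1 q2 q3 q4.
  move/Rabs_le_between: (q1 ltac:(lra)); move/Rabs_le_between: (q2 ltac:(lra)).
  move/Rabs_le_between: (q3 ltac:(lra)); move/Rabs_le_between: (q4 ltac:(lra)).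
  by move=> ? ? ? ?; apply: Rabs_le; lra.
by move=> x y r_xy; case: (circulation_small r_xy e0) => delta delta_le; exists delta.
Qed.

(* Only differentiability at each point is assumed, so Green's formula is not available. *)
Lemma goursat : subrectangle r r -> circulation P Q r = 0.
Proof.
move=> rr; apply: NNPP => /Rabs_pos_lt N; set z := Rabs _ in N.
have p2 := pow2_ge_0 (perimeter r); set p := perimeter r ^ 2 in p2.
have e0 : 0 < z / (2 * (p + 1)) by apply: Rdiv_lt_0_compat; lra.
have := circulation_le_perimeter rr e0; rewrite -/z -/p.
have -> : z / (2 * (p + 1)) * p = z / 2 - z / (2 * (p + 1)) by field; lra.
by lra.
Qed.

End Goursat.

(** * Circle means *)

Lemma is_cderive_differentiable_fst (F : C -> C) (x y : R) (d : C) : is_cderive F (x, y) d ->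
  differentiable_pt_lim (fun u v => fst (F (u, v))) x y (fst d) (- snd d).
Proof.
move=> /(filterdiff_fst (U := CR)) F_d; apply/filterdiff_differentiable_pt_lim.
apply: (filterdiff_ext (U := CR) (V := R_NormedModule) (fun z => fst (F z))); first by case.
by apply: (@filterdiff_eq_Rlin CR) F_d => h; cx_unfold; ring.
Qed.

Lemma is_cderive_differentiable_snd (F : C -> C) (x y : R) (d : C) : is_cderive F (x, y) d ->
  differentiable_pt_lim (fun u v => snd (F (u, v))) x y (snd d) (fst d).
Proof.
move=> /(filterdiff_snd (U := CR)) F_d; apply/filterdiff_differentiable_pt_lim.
apply: (filterdiff_ext (U := CR) (V := R_NormedModule) (fun z => snd (F z))); first by case.
by apply: (@filterdiff_eq_Rlin CR) F_d => h; cx_unfold; ring.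
Qed.

Lemma holomorphic_circulation (F : C -> C) (r : rectangle) : subrectangle r r ->
  (forall x y, in_rectangle r x y -> ex_cderive F (x, y)) ->
  circulation (fun x y => snd (F (x, y))) (fun x y => fst (F (x, y))) r = 0.
Proof.
move=> rr F_diff; apply: goursat => // x y /F_diff [d F_d]; exists (snd d), (fst d), (- snd d).
by split; [exact: is_cderive_differentiable_snd | exact: is_cderive_differentiable_fst].
Qed.

Definition cis (t : R) : C := (cos t, sin t).

Definition cexp (z : C) : C := (RtoC (exp (fst z)) * cis (snd z))%cx.

Lemma Cmod_cis (t : R) : Cmod (cis t) = 1.
Proof.
rewrite -sqrt_1 /Cmod; congr sqrt; rewrite /Cnorm2 /cis /=.
by have := sin2_cos2 t; rewrite /Rsqr; lra.
Qed.

Lemma Cmod_circle (r t : R) : 0 <= r -> Cmod (RtoC r * cis t)%cx = r.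
Proof. by move=> r0; rewrite Cmod_mul Cmod_cis Cmod_RtoC_ge0 // Rmult_1_r. Qed.

Lemma Cmod_cexp (z : C) : Cmod (cexp z) = exp (fst z).
Proof. by apply: Cmod_circle; exact/Rlt_le/exp_pos. Qed.

Lemma is_cderive_cexp (z : C) : is_cderive cexp z (cexp z).
Proof.
have Dexp : filterdiff (U := CR) (V := R_NormedModule) (fun w => exp (fst w)) (locally (T := CR) z)
    (fun h => fst h * exp (fst z)).
  apply: (filterdiff_comp' (U := CR) fst exp z fst (fun h => h * exp (fst z))).
    exact/filterdiff_linear/is_linear_fst.
  exact: (proj2 (is_derive_Reals _ _ _) (derivable_pt_lim_exp _)).
have Dtrig (f : R -> R) l : derivable_pt_lim f (snd z) l ->
    filterdiff (U := CR) (V := R_NormedModule) (fun w => f (snd w)) (locally (T := CR) z)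
      (fun h => snd h * l).
  move=> /is_derive_Reals Df; apply: (filterdiff_comp' (U := CR) snd f z snd (fun h => h * l)) Df.
  exact/filterdiff_linear/is_linear_snd.
have Dcos := filterdiff_Rmult Dexp (Dtrig _ _ (derivable_pt_lim_cos _)).
have Dsin := filterdiff_Rmult Dexp (Dtrig _ _ (derivable_pt_lim_sin _)).
apply: (filterdiff_ext (U := CR) (V := CR)
  (fun w => (exp (fst w) * cos (snd w), exp (fst w) * sin (snd w)))).
  by move=> w; rewrite /cexp /cis; cx_ring.
by apply: (@filterdiff_eq_Clin CR) (filterdiff_pair Dcos Dsin) => h; rewrite /cexp /cis; cx_ring.
Qed.

Section CircleMean.
Variables (k : C -> C) (L : C) (rho : R).
Hypothesis k_diff : forall z, 0 < Cmod z < rho -> ex_cderive k z.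

Let mean (r : R) : R := RInt (fun t => fst (k (RtoC r * cis t)%cx)) 0 (2 * PI).

Lemma ex_cderive_comp_cexp (z : C) : exp (fst z) < rho -> ex_cderive (fun w => k (cexp w)) z.
Proof.
move=> z_rho; case: (@k_diff (cexp z)) => [|d k_d].
  by rewrite Cmod_cexp; have := exp_pos (fst z); lra.
by exists (d * cexp z)%cx; exact: is_cderive_comp (is_cderive_cexp z) k_d.
Qed.

Lemma circle_ex_RInt (r : R) : 0 < r < rho ->
  ex_RInt (fun t => fst (k (RtoC r * cis t)%cx)) 0 (2 * PI).
Proof.
move=> r_rho; apply: ex_RInt_continuous => t _.
case: (@ex_cderive_comp_cexp (ln r, t)) => [|d k_d]; first by rewrite exp_ln; lra.
have := differentiable_pt_lim_continuous_r (is_cderive_differentiable_fst k_d).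
apply: continuous_ext => s; rewrite /cexp exp_ln //=; lra.
Qed.

Lemma circle_mean_const (r r' : R) : 0 < r -> r <= r' -> r' < rho -> mean r = mean r'.
Proof.
move=> r0 rr' r'_rho; have pi0 := PI_RGT_0.
have ln_le : ln r <= ln r' by apply: ln_le.
pose q := Rectangle (ln r) (ln r') 0 (2 * PI).
have qq : subrectangle q q by rewrite /subrectangle /=; lra.
have q_diff x y : in_rectangle q x y -> ex_cderive (fun w => k (cexp w)) (x, y).
  move=> [/= xr _]; apply: ex_cderive_comp_cexp; rewrite /=; apply: Rle_lt_trans r'_rho.
  by rewrite -(exp_ln r'); [apply: exp_le; lra | lra].
have := holomorphic_circulation qq q_diff.
rewrite /circulation /cexp /mean /= !exp_ln; try lra.
by rewrite /cis cos_2PI sin_2PI cos_0 sin_0; lra.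
Qed.

Hypothesis k_lim : forall e, 0 < e -> exists delta, 0 < delta /\
  forall z, 0 < Cmod z < delta -> Cmod (k z - L)%cx <= e.

Lemma circle_mean_near_lim (e : R) : 0 < e -> exists delta, 0 < delta /\
  forall r, 0 < r < rho -> r < delta -> Rabs (mean r - 2 * PI * fst L) <= 2 * PI * e.
Proof.
move=> /k_lim [delta [d0 k_near]]; exists delta; split=> // r r_rho r_small; have pi0 := PI_RGT_0.
have := @RInt_near_const _ 0 (2 * PI) (fst L) e _ (circle_ex_RInt r_rho).
rewrite Rminus_0_r (Rmult_comm (fst L)); apply=> [|t _]; first lra.
apply: Rle_trans (Rabs_fst_le_Cmod (k (RtoC r * cis t) - L)%cx) _.
by apply: k_near; rewrite Cmod_circle; lra.
Qed.

Lemma circle_mean (r : R) : 0 < r < rho ->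
  is_RInt (fun t => fst (k (RtoC r * cis t)%cx)) 0 (2 * PI) (2 * PI * fst L).
Proof.
move=> r_rho; have pi0 := PI_RGT_0.
suff <- : mean r = 2 * PI * fst L by apply: RInt_correct; exact: circle_ex_RInt.
apply: cond_eq => e e0.
case: (@circle_mean_near_lim (e / (4 * PI))) => [|delta [d0 mean_near]].
  by apply: Rdiv_lt_0_compat; lra.
have m0 : 0 < Rmin r (delta / 2) by apply: Rmin_pos; lra.
have := Rmin_l r (delta / 2); have := Rmin_r r (delta / 2) => min_delta min_r.
rewrite -(circle_mean_const m0 min_r); last lra.
apply: Rle_lt_trans (mean_near (Rmin r (delta / 2)) _ _) _; try lra.
have -> : 2 * PI * (e / (4 * PI)) = e / 2 by field; lra.
lra.
Qed.

End CircleMean.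

(** * Holomorphic functions with nonnegative real part *)

Lemma is_cderive_quotient_lim (F : C -> C) (d : C) : is_cderive F 0 d ->
  forall e, 0 < e -> exists delta, 0 < delta /\
    forall z, 0 < Cmod z < delta -> Cmod ((F z - F 0) / z - d)%cx <= e.
Proof.
move=> /is_cderive_eps F_d e e0; case: (F_d e e0) => a [a0 F_near]; exists a; split=> // z [z0 za].
have := F_near z za; have -> : (0 + z)%cx = z by ring.
have zn := Cmod_neq0 z0.
have -> : ((F z - F 0) / z - d)%cx = ((F z - F 0 - d * z) / z)%cx by field.
by rewrite Cmod_div // => h; apply/Rle_div_l.
Qed.

Section CaratheodoryUnitCircle.
Variables (F : C -> C) (d l : C) (rho : R).
Hypothesis rho_gt1 : 1 < rho.
Hypothesis F_diff : forall z, Cmod z < rho -> ex_cderive F z.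
Hypothesis F_d : is_cderive F 0 d.

(* The second term is holomorphic and vanishes at [0], so it does not change the circle mean,
   but on the unit circle it turns the real part into a multiple of [Re F]. *)
Let kernel (z : C) : C := (l * ((F z - F 0) / z) + z * (Cconj l * F z + Cconj (l * F 0)))%cx.

Let is_cderive_correction (z d' : C) : is_cderive F z d' ->
  is_cderive (fun z => z * (Cconj l * F z + Cconj (l * F 0)))%cx z
    (1 * (Cconj l * F z + Cconj (l * F 0)) + z * (Cconj l * d' + 0))%cx.
Proof.
move=> Fd'; apply: is_cderive_mul; first exact: is_cderive_id.
by apply: is_cderive_add (is_cderive_const _ _); exact: is_cderive_scal.
Qed.

Lemma caratheodory_kernel_diff (z : C) : 0 < Cmod z < rho -> ex_cderive kernel z.
Proof.
move=> [z0 z_rho]; case: (F_diff z_rho) => d' Fd'; eexists.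
apply: is_cderive_add; last exact: is_cderive_correction Fd'.
apply: is_cderive_scal; apply: is_cderive_div; [|exact: is_cderive_id|exact: Cmod_neq0].
exact: is_cderive_sub Fd' (is_cderive_const _ _).
Qed.

Lemma caratheodory_kernel_lim (e : R) : Cmod l = 1 -> 0 < e -> exists delta, 0 < delta /\
  forall z, 0 < Cmod z < delta -> Cmod (kernel z - l * d)%cx <= e.
Proof.
move=> l1 e0; case: (is_cderive_quotient_lim F_d (e := e / 2)) => [|a [a0 F_near]]; first lra.
case: (is_cderive_continuous (is_cderive_correction F_d) (e := e / 2)) => [|b [b0 correction_near]].
  by lra.
exists (Rmin a b); split; first exact: Rmin_pos.
move=> z [z0 z_small].
have {}F_near := F_near z (conj z0 (Rlt_le_trans _ _ _ z_small (Rmin_l _ _))).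
have := correction_near z; have -> : (z - 0)%cx = z by ring.
move=> /(_ (Rlt_le_trans _ _ _ z_small (Rmin_r _ _))) {}correction_near.
set q := (z * _ - _)%cx in correction_near.
have -> : (kernel z - l * d)%cx = (l * ((F z - F 0) / z - d) + q)%cx by rewrite /kernel /q; ring.
by apply: Rle_trans (Cmod_add _ _) _; rewrite Cmod_mul l1; lra.
Qed.

Lemma caratheodory_kernel_fst (t : R) :
  fst (kernel (RtoC 1 * cis t)%cx) = 2 * fst (l * Cconj (cis t))%cx * fst (F (RtoC 1 * cis t)%cx).
Proof.
have -> : (RtoC 1 * cis t)%cx = cis t by cx_ring.
have inv_cis : Cinv (cis t) = Cconj (cis t).
  by rewrite /Cinv -Cmod_sqr Cmod_cis /Cconj; apply C_ext; rewrite /=; field.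
by rewrite /kernel /Cdiv inv_cis; cx_unfold; ring.
Qed.

Lemma caratheodory_unit_circle : Cmod l = 1 ->
  (forall t, 0 <= fst (F (RtoC 1 * cis t)%cx)) -> fst (l * d)%cx <= 2 * fst (F 0%cx).
Proof.
move=> l1 F_ge0; have pi0 := PI_RGT_0.
have kernel_mean := circle_mean caratheodory_kernel_diff
  (fun e => @caratheodory_kernel_lim e l1) (conj Rlt_0_1 rho_gt1).
have F_mean : is_RInt (fun t => fst (F (RtoC 1 * cis t)%cx)) 0 (2 * PI) (2 * PI * fst (F 0%cx)).
  apply: (@circle_mean F (F 0%cx) rho); [by move=> z [_ /F_diff] | move=> e e0 | lra].
  case: (is_cderive_continuous F_d e0) => a [a0 F_near]; exists a; split=> // z [_ za].
  by apply: F_near; have -> : (z - 0)%cx = z by ring.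
have two_F_mean : is_RInt (fun t => 2 * fst (F (RtoC 1 * cis t)%cx)) 0 (2 * PI)
    (2 * (2 * PI * fst (F 0%cx))).
  exact: (is_RInt_scal (V := R_NormedModule)).
suff : 2 * PI * fst (l * d)%cx <= 2 * (2 * PI * fst (F 0%cx)) by nra.
apply: is_RInt_le kernel_mean two_F_mean _ => [|t _]; first lra.
rewrite caratheodory_kernel_fst Rmult_assoc; apply: Rmult_le_compat_l; first lra.
have := fst_mul_conj_le l (cis t); rewrite l1 Cmod_cis; have := F_ge0 t; nra.
Qed.

End CaratheodoryUnitCircle.

Lemma is_cderive_dilate (F : C -> C) (a b z d : C) : is_cderive F (a + b * z)%cx d ->
  is_cderive (fun w => F (a + b * w)%cx) z (d * b)%cx.
Proof.
move=> F_d; apply: (is_cderive_comp (J := fun w => a + b * w)%cx) _ F_d; apply: is_cderive_val.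
  by apply: is_cderive_add (is_cderive_const _ _) (is_cderive_scal _ (is_cderive_id _)).
by ring.
Qed.

Lemma caratheodory_estimate (F : C -> C) (d : C) (rho : R) : 0 < rho ->
  (forall z, Cmod z < rho -> ex_cderive F z) -> is_cderive F 0 d ->
  (forall z, Cmod z < rho -> 0 <= fst (F z)) ->
  rho * Cmod d <= 2 * fst (F 0%cx).
Proof.
move=> rho0 F_diff F_d F_ge0.
have line0 (b : C) : (0 + b * 0)%cx = 0%cx by ring.
have below_rho r : 0 < r < rho -> r * Cmod d <= 2 * fst (F 0%cx).
  move=> r_rho; rewrite -{1}(Cmod_RtoC_ge0 (x := r)); last lra.
  rewrite Rmult_comm -Cmod_mul; apply: Cmod_le_by_rotation => l l1.
  have := @caratheodory_unit_circle (fun z => F (0 + RtoC r * z)%cx) (d * RtoC r)%cx l (rho / r).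
  have inside z : Cmod z < rho / r -> Cmod (0 + RtoC r * z)%cx < rho.
    have -> : (0 + RtoC r * z)%cx = (RtoC r * z)%cx by ring.
    rewrite Cmod_mul Cmod_RtoC_ge0; last lra.
    by rewrite Rmult_comm; apply Rlt_div_r; lra.
  rewrite line0; apply=> //.
  - by apply/Rlt_div_r; lra.
  - by move=> z /inside /F_diff [d' Fd']; exists (d' * RtoC r)%cx; exact: is_cderive_dilate.
  - by apply: is_cderive_dilate; rewrite line0.
  - by move=> t; apply/F_ge0/inside; rewrite Cmod_circle; [apply/Rlt_div_r|]; lra.
have F00 : 0 <= fst (F 0%cx) by apply: F_ge0; rewrite Cmod0.
apply: Rnot_lt_le => N; have d0 : 0 < Cmod d by nra.
set y := 2 * fst (F 0%cx) in below_rho N; have y0 : 0 <= y / Cmod d.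
  by apply: Rdiv_le_0_compat; rewrite /y; lra.
have y_rho : y / Cmod d < rho by apply/Rlt_div_l.
have := below_rho ((rho + y / Cmod d) / 2) ltac:(lra).
have -> : (rho + y / Cmod d) / 2 * Cmod d = (rho * Cmod d + y) / 2 by field; lra.
lra.
Qed.

Lemma cauchy_estimate (F : C -> C) (d : C) (rho m : R) : 0 < rho ->
  (forall z, Cmod z < rho -> ex_cderive F z) -> is_cderive F 0 d ->
  (forall z, Cmod z < rho -> Cmod (F z) <= m) ->
  Cmod d <= 4 * m / rho.
Proof.
move=> rho0 F_diff F_d F_le; apply/Rle_div_r => //; rewrite Rmult_comm.
have F_fst z : Cmod z < rho -> - m <= fst (F z) <= m.
  by move=> /F_le h; apply/Rabs_le_between; exact: Rle_trans (Rabs_fst_le_Cmod _) h.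
have F0 : Cmod 0 < rho by rewrite Cmod0.
have := @caratheodory_estimate (fun z => RtoC m + F z)%cx d rho rho0.
suff -> : fst (RtoC m + F 0)%cx = m + fst (F 0%cx).
  move=> est; apply: Rle_trans (est _ _ _) _.
  - by move=> z /F_diff [d' Fd']; eexists; exact: is_cderive_add (is_cderive_const _ _) Fd'.
  - by apply: is_cderive_val (is_cderive_add (is_cderive_const _ _) F_d) _; ring.
  - by move=> z /F_fst; cx_unfold; lra.
  - by have := F_fst _ F0; lra.
by [].
Qed.

Lemma bounded_holomorphic_lipschitz (F : C -> C) (rho m : R) : 0 < rho ->
  (forall z, Cmod z < rho -> ex_cderive F z) ->
  (forall z, Cmod z < rho -> Cmod (F z) <= m) ->
  forall z h, Cmod z < rho / 2 -> Cmod (z + h)%cx < rho / 2 ->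
    Cmod (F (z + h) - F z)%cx <= 8 * m / rho * Cmod h.
Proof.
move=> rho0 F_diff F_le z h z_small zh_small.
have seg t : 0 <= t <= 1 -> Cmod (z + RtoC t * h)%cx < rho / 2.
  move=> t01; have -> : (z + RtoC t * h)%cx = (RtoC (1 - t) * z + RtoC t * (z + h))%cx by cx_ring.
  apply: Rle_lt_trans (Cmod_add _ _) _; rewrite !Cmod_mul !Cmod_RtoC_ge0; try lra.
  by case: (Rle_lt_dec t (1 / 2)); have := Cmod_ge0 z; have := Cmod_ge0 (z + h)%cx; nra.
have cderive_seg t : 0 <= t <= 1 -> is_cderive F (z + RtoC t * h)%cx (Cderive F (z + RtoC t * h)%cx).
  by move=> /seg t_small; apply/Cderive_correct/F_diff; lra.
apply: (mean_value_ineq cderive_seg) => t t01; rewrite Cmod_mul.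
apply: Rmult_le_compat_r; first exact: Cmod_ge0.
move: (seg t t01) (cderive_seg t t01); set w := (z + RtoC t * h)%cx => w_small w_d.
have -> : 8 * m / rho = 4 * m / (rho / 2) by field; lra.
have inside u : Cmod u < rho / 2 -> Cmod (w + 1 * u)%cx < rho.
  by move=> u_small; have := Cmod_add w (1 * u)%cx; rewrite Cmod_mul Cmod1; lra.
have w0 : (w + 1 * 0)%cx = w by ring.
apply: (@cauchy_estimate (fun u => F (w + 1 * u)%cx)); first lra.
- by move=> u /inside /F_diff [d Fd]; eexists; exact: is_cderive_dilate Fd.
- apply: is_cderive_val; first by apply: is_cderive_dilate; rewrite w0; exact: w_d.
  by ring.
- by move=> u /inside; exact: F_le.
Qed.

Lemma bounded_holomorphic_derive_lipschitz (F : C -> C) (d d' : C) (rho m : R) (z : C) : 0 < rho ->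
  (forall z, Cmod z < rho -> ex_cderive F z) ->
  (forall z, Cmod z < rho -> Cmod (F z) <= m) ->
  Cmod z < rho / 4 -> is_cderive F 0 d -> is_cderive F z d' ->
  Cmod (d' - d)%cx <= 128 * m / rho ^ 2 * Cmod z.
Proof.
move=> rho0 F_diff F_le z_small F_d F_d'.
have inside u : Cmod u < rho / 4 -> Cmod (z + 1 * u)%cx < rho / 2.
  by move=> u_small; have := Cmod_add z (1 * u)%cx; rewrite Cmod_mul Cmod1; lra.
have -> : 128 * m / rho ^ 2 * Cmod z = 4 * (8 * m / rho * Cmod z) / (rho / 4) by field; lra.
apply: (@cauchy_estimate (fun u => F (z + 1 * u) - F u)%cx); first lra.
- move=> u u_small; have [e Fe] : ex_cderive F (z + 1 * u)%cx.
    by apply: F_diff; have := inside u u_small; lra.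
  have [e' Fe'] : ex_cderive F u by apply: F_diff; lra.
  by eexists; exact: is_cderive_sub (is_cderive_dilate Fe) Fe'.
- apply: is_cderive_val; first apply: is_cderive_sub F_d; first apply: is_cderive_dilate.
    by rewrite (_ : (z + 1 * 0)%cx = z); [exact: F_d' | ring].
  by ring.
- move=> u u_small; have := @bounded_holomorphic_lipschitz F rho m rho0 F_diff F_le u z.
  have -> : (z + 1 * u)%cx = (u + z)%cx by ring.
  by apply; have := Cmod_add u z; lra.
Qed.

Lemma bounded_holomorphic_taylor (F : C -> C) (d : C) (rho m : R) (z : C) : 0 < rho ->
  (forall z, Cmod z < rho -> ex_cderive F z) ->
  (forall z, Cmod z < rho -> Cmod (F z) <= m) ->
  Cmod z < rho / 4 -> is_cderive F 0 d ->
  Cmod (F z - F 0 - d * z)%cx <= 128 * m / rho ^ 2 * Cmod z ^ 2.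
Proof.
move=> rho0 F_diff F_le z_small F_d.
have seg t : 0 <= t <= 1 -> Cmod (0 + RtoC t * z)%cx <= Cmod z.
  move=> t01; have -> : (0 + RtoC t * z)%cx = (RtoC t * z)%cx by ring.
  by rewrite Cmod_mul Cmod_RtoC_ge0; have := Cmod_ge0 z; nra.
have F_seg t : 0 <= t <= 1 -> is_cderive F (0 + RtoC t * z)%cx (Cderive F (0 + RtoC t * z)%cx).
  by move=> /seg t_le; apply/Cderive_correct/F_diff; lra.
have := @mean_value_ineq (fun u => F u - d * u)%cx (fun u => Cderive F u - d)%cx 0 z
  (128 * m / rho ^ 2 * Cmod z ^ 2).
have -> : (F (0 + z) - d * (0 + z) - (F 0 - d * 0))%cx = (F z - F 0 - d * z)%cx.
  by have -> : (0 + z)%cx = z; ring.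
have m0 : 0 <= m by apply: Rle_trans (Cmod_ge0 _) (F_le 0%cx _); rewrite Cmod0.
have K0 : 0 <= 128 * m / rho ^ 2 by apply: Rdiv_le_0_compat; [lra | exact: pow_lt].
apply=> t t01; have t_le := seg t t01.
  apply: is_cderive_val (is_cderive_sub (F_seg t t01) (is_cderive_scal d (is_cderive_id _))) _.
  by ring.
rewrite Cmod_mul (_ : _ * Cmod z ^ 2 = 128 * m / rho ^ 2 * Cmod z * Cmod z); last by field; lra.
apply: Rmult_le_compat_r; first exact: Cmod_ge0.
apply: Rle_trans (bounded_holomorphic_derive_lipschitz rho0 F_diff F_le _ F_d (F_seg t t01)) _.
  by lra.
exact: Rmult_le_compat_l.
Qed.

Definition half_plane (z : C) : Prop := 0 < fst z.

Lemma halfplane_schwarz_pick (h : C -> C) (w d : C) :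
  (forall z, half_plane z -> ex_cderive h z) ->
  (forall z, half_plane z -> 0 <= fst (h z)) ->
  half_plane w -> is_cderive h w d -> Cmod d * fst w <= fst (h w).
Proof.
move=> h_diff h_ge0 w0 h_d.
pose mobius (z : C) : C := ((w + Cconj w * z) / (1 - z))%cx.
have mobius0 : mobius 0%cx = w by rewrite /mobius; field; apply: Cmod_neq0; rewrite Cmod1; lra.
have one_sub_neq0 z : Cmod z < 1 -> (1 - z)%cx <> 0%cx.
  by move=> z1; apply: Cmod_neq0; have := Cmod_sub_ge 1 z; rewrite Cmod1; lra.
have mobius_diff z : Cmod z < 1 ->
    is_cderive mobius z ((Cconj w * (1 - z) + (w + Cconj w * z)) / ((1 - z) * (1 - z)))%cx.
  move=> /one_sub_neq0 z1; apply: is_cderive_val.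
    apply: is_cderive_div z1 => //.
      by apply: is_cderive_add (is_cderive_const _ _) (is_cderive_scal _ (is_cderive_id _)).
    by apply: is_cderive_sub (is_cderive_const _ _) (is_cderive_id _).
  by cbv beta; field.
have mobius_half_plane z : Cmod z < 1 -> half_plane (mobius z).
  move=> z1; have := Cnorm2_gt0 (one_sub_neq0 _ z1); rewrite /half_plane.
  have -> : fst (mobius z) = fst w * (1 - Cnorm2 z) / Cnorm2 (1 - z)%cx.
    by rewrite /mobius; have := Cnorm2_gt0 (one_sub_neq0 _ z1); cx_unfold => ?; field; lra.
  move=> D; apply: Rdiv_lt_0_compat => //; apply: Rmult_lt_0_compat => //.
  by rewrite -Cmod_sqr; have := Cmod_ge0 z; nra.
have := @caratheodory_estimate (fun z => h (mobius z)) (d * RtoC (2 * fst w))%cx 1 Rlt_0_1.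
rewrite mobius0 Cmod_mul Cmod_RtoC_ge0; last by rewrite /half_plane in w0; lra.
move=> est; suff : 1 * (Cmod d * (2 * fst w)) <= 2 * fst (h w) by lra.
apply: est => [z z1||z z1]; last exact/h_ge0/mobius_half_plane.
  have [d' h_d'] := h_diff _ (mobius_half_plane _ z1); eexists.
  exact: is_cderive_comp (mobius_diff _ z1) h_d'.
apply: is_cderive_val.
  by apply: is_cderive_comp; [apply: mobius_diff; rewrite Cmod0; lra | rewrite mobius0; exact: h_d].
congr Cmul; transitivity (Cconj w + w)%cx; last by cx_ring.
by field; apply: Cmod_neq0; rewrite Cmod1; lra.
Qed.

Section HalfPlane.
Variable h : C -> C.
Hypothesis h_diff : forall z, half_plane z -> ex_cderive h z.
Hypothesis h_ge0 : forall z, half_plane z -> 0 <= fst (h z).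

Let h_line (a b : C) (t : R) : half_plane (a + RtoC t * b)%cx ->
  is_derive (fun s => fst (h (a + RtoC s * b)%cx)) t (fst (Cderive h (a + RtoC t * b) * b)%cx).
Proof. by move=> /h_diff /Cderive_correct; exact: is_derive_fst_line. Qed.

Lemma halfplane_Cderive_le (z : C) : half_plane z -> Cmod (Cderive h z) <= fst (h z) / fst z.
Proof.
move=> z0; apply/Rle_div_r => //.
exact: halfplane_schwarz_pick h_diff h_ge0 z0 (Cderive_correct (h_diff z0)).
Qed.

Lemma halfplane_ratio_nonincreasing (x x' y : R) : 0 < x -> x <= x' ->
  fst (h (x', y)) / x' <= fst (h (x, y)) / x.
Proof.
move=> x0 xx'; have lineE t : (t, y) = ((0, y)%R + RtoC t * 1)%cx by cx_ring.
pose h' t := fst (Cderive h (t, y)).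
apply: (@nonincreasing_of_is_derive (fun t => fst (h (t, y)) / t)
  (fun t => (h' t * t - fst (h (t, y))) / t ^ 2) x x' xx') => t t_in.
  have := @h_line (0, y) 1%cx t; rewrite -lineE => /(_ ltac:(rewrite /half_plane /=; lra)) D.
  have {}D : is_derive (fun s => fst (h (s, y))) t (h' t).
    rewrite /h' (_ : fst _ = fst (Cderive h (t, y) * 1)%cx); last by cx_unfold; ring.
    by apply: is_derive_ext D => s; rewrite -lineE.
  rewrite -[fst (h (t, y))]Rmult_1_r.
  by apply: is_derive_div D (is_derive_id _) _; lra.
have t0 : half_plane (t, y) by rewrite /half_plane /=; lra.
have /Rle_div_r := halfplane_Cderive_le t0 => /(_ t0) /= SP.
have := fst_le_Cmod (Cderive h (t, y)); rewrite -/(h' t) => h'_le.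
by apply/Rle_div_l; nra.
Qed.

Lemma halfplane_harnack (x y : R) : 0 < x ->
  fst (h (x, y)) <= exp (Rabs y / x) * fst (h (x, 0)).
Proof.
move=> x0.
have along (b : C) T : fst b = 0 -> Cmod b = 1 -> 0 <= T ->
    fst (h ((x, 0)%R + RtoC T * b)%cx) <= exp (T / x) * fst (h (x, 0)).
  move=> b1 b2 T0; have in_half_plane t : half_plane ((x, 0)%R + RtoC t * b)%cx.
    by rewrite /half_plane; cx_unfold; rewrite b1; lra.
  have := @gronwall (fun t => fst (h ((x, 0)%R + RtoC t * b)%cx)) _ T (fst (h (x, 0))) 0 (/ x)
    T0 (Rle_refl 0) (Rlt_le _ _ (Rinv_0_lt_compat _ x0)) _ (fun t _ => h_line (in_half_plane t)).
  rewrite Rmult_0_l Rplus_0_r Rmult_comm (Rmult_comm (/ x)); apply=> [|t _].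
    by rewrite (_ : ((x, 0)%R + RtoC 0 * b)%cx = (x, 0)); [lra | cx_ring].
  have := halfplane_Cderive_le (in_half_plane t); set z := (_ + _)%cx.
  have -> : fst z = x by rewrite /z; cx_unfold; rewrite b1; ring.
  have := fst_le_Cmod (Cderive h z * b)%cx; rewrite Cmod_mul b2 /Rdiv; lra.
case: (Rle_lt_dec 0 y) => y0.
  have := @along (0, 1) y; rewrite Rabs_pos_eq //.
  have -> : ((x, 0)%R + RtoC y * (0, 1)%R)%cx = (x, y) by cx_ring.
  by apply=> //; rewrite Cmod_imaginary Rabs_R1.
have := @along (- (0, 1)%R)%cx (- y); rewrite Rabs_left //.
have -> : ((x, 0)%R + RtoC (- y) * - (0, 1)%R)%cx = (x, y) by cx_ring.
apply; [by rewrite /= Ropp_0 | by rewrite Cmod_opp Cmod_imaginary Rabs_R1 | lra].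
Qed.

Lemma halfplane_vertical_increment (x y M e : R) : 0 < x -> Rabs y <= M * x ->
  fst (h (x, 0)) <= e * x -> Cmod (h (x, y) - h (x, 0)%R)%cx <= M * exp M * e * x.
Proof.
move=> x0 y_le h_le; have -> : (x, y) = ((x, 0)%R + (0, y)%R)%cx by cx_ring.
have z_half_plane t : half_plane ((x, 0)%R + RtoC t * (0, y)%R)%cx.
  by rewrite /half_plane; cx_unfold; lra.
apply: (@mean_value_ineq h (Cderive h)) => t t01; first exact/Cderive_correct/h_diff/z_half_plane.
have := halfplane_Cderive_le (z_half_plane t).
have -> : ((x, 0)%R + RtoC t * (0, y)%R)%cx = (x, t * y) by cx_ring.
have ty_le : Rabs (t * y) / x <= M.
  apply/Rle_div_l => //; apply: Rle_trans y_le; rewrite Rabs_mult Rabs_pos_eq; last lra.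
  by have := Rabs_pos y; nra.
have := halfplane_harnack (t * y) x0; have := exp_le ty_le; have := exp_pos M.
have -> : Cmod (Cderive h (x, (t * y)%R) * (0, y)%R)%cx = Cmod (Cderive h (x, t * y)) * Rabs y.
  by rewrite Cmod_mul Cmod_imaginary.
move=> M_pos exp_le_M h_harnack /Rle_div_r => /(_ x0) /= h'_le.
have h0 : 0 <= fst (h (x, 0)) by apply: h_ge0.
have h_M : fst (h (x, (t * y)%R)) <= exp M * (e * x).
  by apply: Rle_trans h_harnack _; apply: Rmult_le_compat => //; exact/Rlt_le/exp_pos.
have h'_M : Cmod (Cderive h (x, (t * y)%R)) <= exp M * e by apply: (Rmult_le_reg_r x); lra.
have -> : M * exp M * e * x = exp M * e * (M * x) by ring.
by apply: Rmult_le_compat => //; [exact: Cmod_ge0 | exact: Rabs_pos].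
Qed.

Lemma halfplane_horizontal_increment (x0 x e : R) : 0 < x0 -> x0 <= x ->
  (forall t, x0 <= t -> fst (h (t, 0)) <= e * t) ->
  Cmod (h (x, 0)%R - h (x0, 0)%R)%cx <= e * (x - x0).
Proof.
move=> x00 x0x h_le; have -> : (x, 0) = ((x0, 0)%R + RtoC (x - x0))%cx by cx_ring.
have seg t : ((x0, 0)%R + RtoC t * RtoC (x - x0))%cx = (x0 + t * (x - x0), 0) by cx_ring.
apply: (@mean_value_ineq h (Cderive h)) => t t01; rewrite seg; set s := x0 + t * (x - x0).
  by apply/Cderive_correct/h_diff; rewrite /half_plane /s /=; nra.
have s_ge : x0 <= s by rewrite /s; nra.
have s0 : half_plane (s, 0) by rewrite /half_plane /=; lra.
rewrite Cmod_mul Cmod_RtoC_ge0; last lra; apply: Rmult_le_compat_r; first lra.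
apply: Rle_trans (halfplane_Cderive_le s0) _; apply/Rle_div_l => //.
exact: h_le.
Qed.

Lemma halfplane_sublinear (x0 x y M e : R) : 0 < x0 -> x0 <= x -> 0 <= e ->
  Rabs y <= M * x -> (forall t, x0 <= t -> fst (h (t, 0)) <= e * t) ->
  Cmod (h (x, y)) <= Cmod (h (x0, 0)) + (1 + M * exp M) * e * x.
Proof.
move=> x00 x0x e0 y_le h_le.
have := halfplane_vertical_increment (Rlt_le_trans _ _ _ x00 x0x) y_le (h_le x x0x).
have := halfplane_horizontal_increment x00 x0x h_le.
have := Cmod_dist_triangle (h (x, y)) (h (x, 0)%R) (h (x0, 0)%R).
have := Cmod_le_dist (h (x, y)) (h (x0, 0)%R).
have : e * (x - x0) <= e * x by apply: Rmult_le_compat_l; lra.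
lra.
Qed.

End HalfPlane.

(** * Vectors *)

HB.instance Definition _ := Monoid.isComLaw.Build R 0 Rplus
  (fun x y z => esym (Rplus_assoc x y z)) Rplus_comm Rplus_0_l.

Lemma CaddA : associative Cadd. Proof. by move=> a b c; ring. Qed.
Lemma CaddC : commutative Cadd. Proof. by move=> a b; ring. Qed.
Lemma Cadd0 : left_id Czero Cadd. Proof. by move=> a; ring. Qed.

HB.instance Definition _ := Monoid.isComLaw.Build C Czero Cadd CaddA CaddC Cadd0.

Section RealSums.
Variable n : nat.
Implicit Types f g : 'I_n -> R.

Lemma sumR_le f g : (forall i, f i <= g i) ->
  \big[Rplus/0]_(i < n) f i <= \big[Rplus/0]_(i < n) g i.
Proof. by move=> fg; apply: (big_ind2 Rle) => [|* |i _]; [lra | lra | exact: fg]. Qed.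

Lemma sumR_ge0 (P : pred 'I_n) f : (forall i, 0 <= f i) -> 0 <= \big[Rplus/0]_(i < n | P i) f i.
Proof. by move=> f0; apply: (big_ind (Rle 0)) => [|* |i _]; [lra | lra | exact: f0]. Qed.

Lemma sumR_scal (a : R) f :
  \big[Rplus/0]_(i < n) (a * f i) = a * \big[Rplus/0]_(i < n) f i.
Proof. by rewrite (big_morph (fun x => a * x) (id1 := 0) (op1 := Rplus)) // => [x y|] /=; ring. Qed.

Lemma sumR_const (a : R) : \big[Rplus/0]_(i < n) a = INR n * a.
Proof.
rewrite big_const_ord; elim: (n) => [|k IH]; first by rewrite /=; ring.
by rewrite iterS IH S_INR; ring.
Qed.

Lemma sumR_add f g : \big[Rplus/0]_(i < n) (f i + g i) =
  \big[Rplus/0]_(i < n) f i + \big[Rplus/0]_(i < n) g i.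
Proof. exact: big_split. Qed.

Lemma sumR_delta (j : 'I_n) (a : R) : \big[Rplus/0]_(i < n) (if i == j then a else 0) = a.
Proof. by rewrite -big_mkcond big_pred1_eq. Qed.

Lemma sumR_term_le f (j : 'I_n) : (forall i, 0 <= f i) -> f j <= \big[Rplus/0]_(i < n) f i.
Proof.
move=> f0; rewrite [X in _ <= X](bigD1 j) //=.
have := sumR_ge0 (fun i => i != j) f0; set s := (\big[_/_]_(_ | _) _); lra.
Qed.

Lemma uniform_bound (P : 'I_n -> R -> Prop) :
  (forall i x y, x <= y -> P i x -> P i y) -> (forall i, exists x, P i x) ->
  exists x, 0 <= x /\ forall i, P i x.
Proof.
move=> P_mono P_ex; pose f i := epsilon (inhabits 0) (P i).
have Pf i : P i (f i) by exact: (epsilon_spec (inhabits 0) (P i) (P_ex i)).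
exists (\big[Rplus/0]_(i < n) Rabs (f i)); split; first by apply: sumR_ge0 => i; exact: Rabs_pos.
move=> i; apply: P_mono (Pf i); apply: Rle_trans (Rle_abs _) _.
by apply: (sumR_term_le (f := fun i => Rabs (f i))) => j; exact: Rabs_pos.
Qed.

End RealSums.

Section Norms.
Variable n : nat.
Implicit Types u v z p : vec n.

Definition vzero : vec n := fun _ => Czero.

Definition norm1 v : R := \big[Rplus/0]_(i < n) Cmod (v i).

Lemma vec_ext u v : (forall i, u i = v i) -> u = v.
Proof. exact: functional_extensionality. Qed.

Lemma norm1_ge0 v : 0 <= norm1 v.
Proof. by apply: sumR_ge0 => i; exact: Cmod_ge0. Qed.

Lemma norm1_coord v (i : 'I_n) : Cmod (v i) <= norm1 v.
Proof. by apply: (sumR_term_le (f := fun i => Cmod (v i))) => j; exact: Cmod_ge0. Qed.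

Lemma norm1_add u v : norm1 (vadd u v) <= norm1 u + norm1 v.
Proof. by rewrite /norm1 -sumR_add; apply: sumR_le => i; exact: Cmod_add. Qed.

Lemma norm1_scal (a : C) v : norm1 (vscal a v) = Cmod a * norm1 v.
Proof. by rewrite /norm1 -sumR_scal; apply: eq_bigr => i _; exact: Cmod_mul. Qed.

Lemma norm1_eq0 v : norm1 v = 0 -> v = vzero.
Proof.
move=> v0; apply: vec_ext => i; apply: Cmod_eq0.
by have := norm1_coord v i; have := Cmod_ge0 (v i); lra.
Qed.

Lemma norm1_zero : norm1 vzero = 0.
Proof. by rewrite /norm1 big1 // => i _; exact: Cmod0. Qed.

Lemma vnorm2_zero : vnorm2 vzero = 0.
Proof. by rewrite /vnorm2 big1 // => i _; rewrite /Cnorm2 /=; ring. Qed.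

Lemma vnorm2_ge0 v : 0 <= vnorm2 v.
Proof. by apply: sumR_ge0 => i; exact: Cnorm2_ge0. Qed.

Lemma vnorm_sqr v : vnorm v ^ 2 = vnorm2 v.
Proof. by rewrite /vnorm pow2_sqrt //; exact: vnorm2_ge0. Qed.

Lemma Cnorm2_coord v (i : 'I_n) : Cnorm2 (v i) <= vnorm2 v.
Proof. by apply: (sumR_term_le (f := fun i => Cnorm2 (v i))) => j; exact: Cnorm2_ge0. Qed.

Lemma Cmod_coord v (i : 'I_n) : Cmod (v i) <= vnorm v.
Proof. by apply: sqrt_le_1_alt; exact: Cnorm2_coord. Qed.

Lemma Cnorm2_coord2 v (i j : 'I_n) : i != j -> Cnorm2 (v i) + Cnorm2 (v j) <= vnorm2 v.
Proof.
move=> ij; rewrite /vnorm2 (bigD1 j) //= (bigD1 i) //=.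
have := sumR_ge0 (fun k => (k != j) && (k != i)) (fun k => Cnorm2_ge0 (v k)).
by set s := (\big[_/_]_(_ | _) _); lra.
Qed.

Lemma ball_Cmod_lt1 z (i : 'I_n) : ball z -> Cmod (z i) < 1.
Proof.
rewrite /ball => z1; have := Cnorm2_coord z i; rewrite -Cmod_sqr.
by have := Cmod_ge0 (z i); nra.
Qed.

Lemma vnorm2_le_norm1 v : vnorm2 v <= norm1 v ^ 2.
Proof.
have -> : norm1 v ^ 2 = \big[Rplus/0]_(i < n) (norm1 v * Cmod (v i)).
  by rewrite sumR_scal -/(norm1 v); ring.
apply: sumR_le => i; rewrite -Cmod_sqr.
by have := norm1_coord v i; have := Cmod_ge0 (v i); nra.
Qed.

Lemma vnorm_le_norm1 v : vnorm v <= norm1 v.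
Proof.
rewrite /vnorm -(sqrt_pow2 (norm1 v)); last exact: norm1_ge0.
by apply: sqrt_le_1_alt; exact: vnorm2_le_norm1.
Qed.

Lemma norm1_le_vnorm v : norm1 v <= INR n * vnorm v.
Proof. by rewrite -sumR_const; apply: sumR_le => i; exact: Cmod_coord. Qed.

Lemma norm1_sqr_le v : norm1 v ^ 2 <= INR n ^ 2 * vnorm2 v.
Proof.
rewrite -vnorm_sqr -Rpow_mult_distr; apply: pow_incr; split; first exact: norm1_ge0.
exact: norm1_le_vnorm.
Qed.

Lemma norm1_lt_of_vnorm2 v (r : R) : 0 < r -> vnorm2 v <= r ^ 2 / (INR n ^ 2 + 1) -> norm1 v < r.
Proof.
move=> r0 /Rle_div_r v_le; have n2 := pow2_ge_0 (INR n); apply: Rnot_le_lt => r_le.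
have : r ^ 2 <= norm1 v ^ 2 by apply: pow_incr; lra.
have := norm1_sqr_le v; have := v_le ltac:(lra); have := pow_lt r 2 r0; have := vnorm2_ge0 v; nra.
Qed.

Lemma vadd_vzero z : vadd z vzero = z.
Proof. by apply: vec_ext => i; rewrite /vadd /vzero; ring. Qed.

Lemma vscal1 v : vscal 1 v = v.
Proof. by apply: vec_ext => i; rewrite /vscal; ring. Qed.

Lemma vadd_vscal0 z v : vadd z (vscal 0 v) = z.
Proof. by apply: vec_ext => i; rewrite /vadd /vscal; ring. Qed.

Lemma vadd_vscal1_vsub u v : vadd v (vscal 1 (vsub u v)) = u.
Proof. by apply: vec_ext => i; rewrite /vadd /vscal /vsub; ring. Qed.

Lemma vsub_vadd z v : vsub (vadd z v) z = v.
Proof. by apply: vec_ext => i; rewrite /vsub /vadd; ring. Qed.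

Lemma vadd_vsub z p : vadd p (vsub z p) = z.
Proof. by apply: vec_ext => i; rewrite /vsub /vadd; ring. Qed.

Lemma vadd_vscal_add z v (a b : C) :
  vadd z (vscal (a + b) v) = vadd (vadd z (vscal a v)) (vscal b v).
Proof. by apply: vec_ext => i; rewrite /vadd /vscal; ring. Qed.

Lemma norm1_dist_triangle u v z : norm1 (vsub u z) <= norm1 (vsub u v) + norm1 (vsub v z).
Proof.
rewrite (_ : vsub u z = vadd (vsub u v) (vsub v z)); first exact: norm1_add.
by apply: vec_ext => i; rewrite /vsub /vadd; ring.
Qed.

Lemma ball_open p : ball p -> exists delta, 0 < delta /\ forall x, norm1 (vsub x p) < delta -> ball x.
Proof.
rewrite /ball => p1; exists (Rmin 1 ((1 - vnorm2 p) / 4)); split; first by apply: Rmin_pos; lra.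
move=> x x_near; set h := vsub x p in x_near.
have h1 := Rlt_le_trans _ _ _ x_near (Rmin_l _ _); have h2 := Rlt_le_trans _ _ _ x_near (Rmin_r _ _).
suff : vnorm2 x <= vnorm2 p + 3 * norm1 h by lra.
rewrite /vnorm2 /norm1 -sumR_scal -sumR_add; apply: sumR_le => i.
have x_i : x i = (p i + h i)%cx by rewrite /h /vsub; ring.
have p_i := ball_Cmod_lt1 i p1; have h_i := norm1_coord h i.
have := Cmod_add (p i) (h i); rewrite -x_i -!Cmod_sqr.
by have := Cmod_ge0 (x i); have := Cmod_ge0 (p i); have := Cmod_ge0 (h i); nra.
Qed.

End Norms.

Arguments vzero {n}.

(** * Holomorphic maps of the ball *)

Section ComplexLinear.
Variables (n : nat) (L : vec n -> vec n).
Hypothesis L_lin : Clinear L.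

Lemma clinear_zero (i : 'I_n) : L vzero i = 0%cx.
Proof.
have := L_lin 1%cx vzero vzero i.
have -> : vadd (vscal 1 vzero) vzero = (vzero : vec n).
  by apply: vec_ext => j; rewrite /vadd /vscal /vzero; ring.
rewrite /vadd /vscal => E.
by transitivity (1 * L vzero i + L vzero i - L vzero i)%cx; [ring | rewrite -E; ring].
Qed.

Lemma clinear_scal (a : C) (v : vec n) (i : 'I_n) : L (vscal a v) i = (a * L v i)%cx.
Proof.
have := L_lin a v vzero i.
have -> : vadd (vscal a v) vzero = vscal a v.
  by apply: vec_ext => j; rewrite /vadd /vscal /vzero; ring.
by move=> ->; rewrite /vadd /vscal clinear_zero; ring.
Qed.

Lemma clinear_sub (u v : vec n) (i : 'I_n) : L (vsub u v) i = (L u i - L v i)%cx.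
Proof.
have -> : vsub u v = vadd (vscal (- (1)) v) u.
  by apply: vec_ext => j; rewrite /vsub /vadd /vscal; ring.
by rewrite L_lin /vadd /vscal; ring.
Qed.

Lemma clinear_expand (h : vec n) (i : 'I_n) :
  L h i = \big[Cadd/Czero]_(j < n) (h j * L (basis n j) i)%cx.
Proof.
pose trunc (k : nat) : vec n := fun j => if (j < k)%N then h j else Czero.
suff expand k : (k <= n)%N ->
    L (trunc k) i = \big[Cadd/Czero]_(j < n | (j < k)%N) (h j * L (basis n j) i)%cx.
  have := expand n (leqnn n); rewrite (_ : trunc n = h); last first.
    by apply: vec_ext => j; rewrite /trunc ltn_ord.
  by move=> ->; apply: eq_bigl => j; rewrite ltn_ord.
elim: k => [_|k IH kn].
  by rewrite big_pred0 // (_ : trunc O = vzero) ?clinear_zero.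
pose j0 := Ordinal kn; have {IH} IH := IH (ltnW kn).
have -> : trunc k.+1 = vadd (vscal (h j0) (basis n j0)) (trunc k).
  apply: vec_ext => j; rewrite /trunc /vadd /vscal /basis ltnS leq_eqVlt.
  case: eqP => [E|_] /=; last by case: ifP => _; ring.
  by have -> : j = j0; [exact: val_inj | rewrite ltnn; ring].
rewrite L_lin /vadd /vscal IH (bigD1 j0 (P := fun j : 'I_n => (j < k.+1)%N)) ?ltnSn //=.
congr Cadd; apply: eq_bigl => j; rewrite ltnS ltn_neqAle andbC.
by congr andb.
Qed.

End ComplexLinear.

Lemma Cmod_sum_le (n : nat) (f : 'I_n -> C) :
  Cmod (\big[Cadd/Czero]_(i < n) f i) <= \big[Rplus/0]_(i < n) Cmod (f i).
Proof.
apply: (big_ind2 (fun a b => Cmod a <= b)) => [|a b a' b' ab ab'|i _]; last by lra.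
  by rewrite Cmod0; lra.
by apply: Rle_trans (Cmod_add _ _) _; lra.
Qed.

Section Holomorphic.
Variables (n : nat) (G : vec n -> vec n) (dG : vec n -> vec n -> vec n).
Hypothesis G_diff : forall z, ball z -> is_cderiv G z (dG z).

Lemma dG_linear (z : vec n) : ball z -> Clinear (dG z).
Proof. by move=> /G_diff []. Qed.

Lemma is_cderiv_coord (z : vec n) (e : R) : ball z -> 0 < e ->
  exists delta, 0 < delta /\ forall h, norm1 h < delta -> ball (vadd z h) /\
    forall i, Cmod (G (vadd z h) i - G z i - dG z h i)%cx <= e * norm1 h.
Proof.
move=> z_ball e0; case: (ball_open z_ball) => d1 [d10 near_ball].
case: (proj2 (G_diff z_ball) e e0) => d2 [d20 near_z].
exists (Rmin d1 d2); split=> [|h h_small]; first exact: Rmin_pos.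
have h1 := Rlt_le_trans _ _ _ h_small (Rmin_l _ _).
have h2 := Rlt_le_trans _ _ _ h_small (Rmin_r _ _).
have zh_ball : ball (vadd z h) by apply: near_ball; rewrite vsub_vadd.
split=> // i; case: (Req_dec (norm1 h) 0) => [h0|h0].
  rewrite (norm1_eq0 h0) (clinear_zero (dG_linear z_ball)) vadd_vzero.
  by have -> : (G z i - G z i - 0)%cx = 0%cx; [ring | rewrite Cmod0 norm1_zero; lra].
have vnorm_gt0 : 0 < vnorm h.
  have := norm1_le_vnorm h; have := norm1_ge0 h; case: (sqrt_pos (vnorm2 h)) => [//|].
  by rewrite -/(vnorm h) => <-; rewrite Rmult_0_r; lra.
have := near_z h zh_ball (conj vnorm_gt0 (Rle_lt_trans _ _ _ (vnorm_le_norm1 h) h2)).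
move/(Rle_trans _ _ _ (Cmod_coord _ i)) => le_vnorm; apply: Rle_trans le_vnorm _.
by apply: Rmult_le_compat_l; [lra | exact: vnorm_le_norm1].
Qed.

Lemma is_cderive_line (z v : vec n) (a : C) (i : 'I_n) : ball (vadd z (vscal a v)) ->
  is_cderive (fun b => G (vadd z (vscal b v)) i) a (dG (vadd z (vscal a v)) v i).
Proof.
set p := vadd z _ => p_ball; apply/is_cderive_eps => e e0; have v0 := norm1_ge0 v.
have e'0 : 0 < e / (norm1 v + 1) by apply: Rdiv_lt_0_compat; lra.
case: (is_cderiv_coord p_ball e'0) => delta [d0 near_p].
exists (delta / (norm1 v + 1)); split=> [|h]; first by apply: Rdiv_lt_0_compat; lra.
move/Rlt_div_r => h_small; have h0 := Cmod_ge0 h.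
rewrite vadd_vscal_add -/p; have [|_ /(_ i)] := near_p (vscal h v).
  by rewrite norm1_scal; have := h_small ltac:(lra); nra.
rewrite clinear_scal ?norm1_scal; last exact: dG_linear.
have -> : (dG p v i * h)%cx = (h * dG p v i)%cx by ring.
move=> le_e; apply: Rle_trans le_e _.
have {2}-> : e = e / (norm1 v + 1) * (norm1 v + 1) by field; lra.
by rewrite Rmult_assoc; apply: Rmult_le_compat_l; [lra | nra].
Qed.

Lemma is_cderive_line0 (z v : vec n) (i : 'I_n) : ball z ->
  is_cderive (fun b => G (vadd z (vscal b v)) i) 0 (dG z v i).
Proof.
by move=> z_ball; have := @is_cderive_line z v 0 i; rewrite vadd_vscal0; apply.
Qed.

Lemma dG_bounded (z : vec n) : ball z ->
  exists K, 0 <= K /\ forall i h, Cmod (dG z h i) <= K * norm1 h.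
Proof.
move=> z_ball; apply: uniform_bound => [i x y xy le_x h|i].
  by apply: Rle_trans (le_x h) _; apply: Rmult_le_compat_r => //; exact: norm1_ge0.
exists (\big[Rplus/0]_(j < n) Cmod (dG z (basis n j) i)) => h.
rewrite (clinear_expand (dG_linear z_ball)) Rmult_comm -sumR_scal.
apply: Rle_trans (Cmod_sum_le _) _; apply: sumR_le => j.
by rewrite Cmod_mul; apply: Rmult_le_compat_r; [exact: Cmod_ge0 | exact: norm1_coord].
Qed.

Lemma locally_bounded (z : vec n) : ball z -> exists delta M, 0 < delta /\ 0 < M /\
  forall x, norm1 (vsub x z) < delta -> ball x /\ forall i, Cmod (G x i) <= M.
Proof.
move=> z_ball; case: (is_cderiv_coord z_ball Rlt_0_1) => delta [d0 near_z].
case: (dG_bounded z_ball) => K [K0 dG_le].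
have n0 := norm1_ge0 (G z); exists (Rmin 1 delta), (norm1 (G z) + K + 1).
split; first by apply: Rmin_pos; lra.
split; first lra.
move=> x x_near; have x1 := Rlt_le_trans _ _ _ x_near (Rmin_l _ _).
have x2 := Rlt_le_trans _ _ _ x_near (Rmin_r _ _).
case: (near_z _ x2); rewrite vadd_vsub => x_ball /= le_h; split=> // i.
have {}le_h := le_h i; have le_dG := dG_le i (vsub x z); have le_Gz := norm1_coord (G z) i.
have := Cmod_le_dist (G x i - G z i)%cx (dG z (vsub x z) i); have := Cmod_le_dist (G x i) (G z i).
have := norm1_ge0 (vsub x z); nra.
Qed.

Section LocalBound.
Variables (z : vec n) (delta M : R).
Hypotheses (delta_gt0 : 0 < delta)
  (G_le : forall h, norm1 h < delta -> ball (vadd z h) /\ forall i, Cmod (G (vadd z h) i) <= M).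

Let z_ball : ball z.
Proof. by case: (G_le (h := vzero)); rewrite ?norm1_zero ?vadd_vzero. Qed.

Let line_small (h : vec n) (a : C) : 0 < norm1 h -> Cmod a < delta / norm1 h -> norm1 (vscal a h) < delta.
Proof. by move=> h0 /Rlt_div_r; rewrite norm1_scal; apply. Qed.

Let line_diff (h : vec n) (i : 'I_n) (a : C) : 0 < norm1 h -> Cmod a < delta / norm1 h ->
  ex_cderive (fun b => G (vadd z (vscal b h)) i) a.
Proof.
move=> h0 /(line_small h0) /G_le [p_ball _]; eexists; exact: is_cderive_line.
Qed.

Let line_le (h : vec n) (i : 'I_n) (a : C) : 0 < norm1 h -> Cmod a < delta / norm1 h ->
  Cmod (G (vadd z (vscal a h)) i) <= M.
Proof. by move=> h0 /(line_small h0) /G_le [_]. Qed.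

Let vec_norm1_cases (h : vec n) : h = vzero \/ 0 < norm1 h.
Proof. by case: (norm1_ge0 h) => [|/esym /norm1_eq0]; [right | left]. Qed.

Lemma bounded_dG_le (h : vec n) (i : 'I_n) : Cmod (dG z h i) <= 4 * M / delta * norm1 h.
Proof.
case: (vec_norm1_cases h) => [->|h0].
  by rewrite (clinear_zero (dG_linear z_ball)) Cmod0 norm1_zero; lra.
have -> : 4 * M / delta * norm1 h = 4 * M / (delta / norm1 h) by field; lra.
apply: (@cauchy_estimate (fun a => G (vadd z (vscal a h)) i)).
- exact: Rdiv_lt_0_compat.
- by move=> a; exact: line_diff.
- exact: is_cderive_line0.
- by move=> a; exact: line_le.
Qed.

Lemma bounded_lipschitz (h : vec n) (i : 'I_n) : norm1 h < delta / 4 ->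
  Cmod (G (vadd z h) i - G z i)%cx <= 8 * M / delta * norm1 h.
Proof.
case: (vec_norm1_cases h) => [->|h0 h_small].
  by rewrite vadd_vzero norm1_zero (_ : (G z i - G z i)%cx = 0%cx) ?Cmod0; [lra | ring].
have rho0 : 0 < delta / norm1 h by exact: Rdiv_lt_0_compat.
have rho4 : 4 < delta / norm1 h by apply/(Rlt_div_r _ _ (norm1 h)); lra.
have := bounded_holomorphic_lipschitz rho0 (fun a => line_diff i h0) (fun a => line_le i h0)
  (z := 0%cx) (h := 1%cx).
rewrite Cmod0 (_ : (0 + 1 = 1)%cx) ?Cmod1 ?vadd_vscal0 ?vscal1; last by ring.
have -> : 8 * M / (delta / norm1 h) * 1 = 8 * M / delta * norm1 h by field; lra.
by apply; lra.
Qed.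

Lemma bounded_taylor (h : vec n) (i : 'I_n) : norm1 h < delta / 4 ->
  Cmod (G (vadd z h) i - G z i - dG z h i)%cx <= 128 * M / delta ^ 2 * norm1 h ^ 2.
Proof.
case: (vec_norm1_cases h) => [->|h0 h_small].
  rewrite vadd_vzero (clinear_zero (dG_linear z_ball)) norm1_zero => _.
  by have -> : (G z i - G z i - 0)%cx = 0%cx; [ring | rewrite Cmod0; lra].
have rho0 : 0 < delta / norm1 h by exact: Rdiv_lt_0_compat.
have rho4 : 4 < delta / norm1 h by apply/(Rlt_div_r _ _ (norm1 h)); lra.
have := bounded_holomorphic_taylor rho0 (fun a => line_diff i h0) (fun a => line_le i h0)
  (z := 1%cx) _ (is_cderive_line0 h i z_ball).
rewrite Cmod1 vadd_vscal0 vscal1 (_ : (dG z h i * 1)%cx = dG z h i); last by ring.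
have -> : 128 * M / (delta / norm1 h) ^ 2 * 1 ^ 2 = 128 * M / delta ^ 2 * norm1 h ^ 2 by field; lra.
by apply; lra.
Qed.

End LocalBound.

(* The reciprocal of the radius also serves as the bound, so that compactness of a time
   interval makes both uniform at once. *)
Definition controlled (z : vec n) (r : R) : Prop :=
  (forall h i, Cmod (dG z h i) <= / r * norm1 h) /\
  forall h i, norm1 h < r ->
    Cmod (G (vadd z h) i - G z i)%cx <= / r * norm1 h /\
    Cmod (G (vadd z h) i - G z i - dG z h i)%cx <= / r * norm1 h ^ 2.

Lemma controlled_le (z : vec n) (r r' : R) : 0 < r' -> r' <= r -> controlled z r -> controlled z r'.
Proof.
move=> r'0 r'r [dG_le G_near]; have inv_le : / r <= / r' by exact: Rinv_le_contravar.
split=> [h i|h i h_small].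
  by apply: Rle_trans (dG_le h i) _; apply: Rmult_le_compat_r => //; exact: norm1_ge0.
case: (G_near h i) => [|lip taylor]; first lra.
split; [apply: Rle_trans lip _ | apply: Rle_trans taylor _]; apply: Rmult_le_compat_r => //.
  exact: norm1_ge0.
exact: pow2_ge_0.
Qed.

Lemma locally_controlled (p : vec n) : ball p ->
  exists r, 0 < r /\ forall z, norm1 (vsub z p) < r -> controlled z r.
Proof.
move=> /locally_bounded [d [M [d0 [M0 G_le]]]]; pose delta := d / 2.
pose K := 8 * M / delta + 128 * M / delta ^ 2.
have K1 : 0 < 8 * M / delta by apply: Rdiv_lt_0_compat; rewrite /delta; lra.
have K2 : 0 < 128 * M / delta ^ 2 by apply: Rdiv_lt_0_compat; [lra | apply: pow_lt; rewrite /delta; lra].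
have iK : 0 < / K by apply: Rinv_0_lt_compat; rewrite /K; lra.
have d4 : 0 < delta / 4 by rewrite /delta; lra.
exists (Rmin (delta / 4) (/ K)); split=> [|z z_near]; first exact: Rmin_pos.
have r0 : 0 < Rmin (delta / 4) (/ K) by exact: Rmin_pos.
have := Rmin_l (delta / 4) (/ K); have := Rmin_r (delta / 4) (/ K).
set r := Rmin _ _ in z_near r0 * => r_iK r_delta.
have K_le : K <= / r by rewrite -(Rinv_inv K); exact: Rinv_le_contravar.
have G_le_z h : norm1 h < delta -> ball (vadd z h) /\ forall i, Cmod (G (vadd z h) i) <= M.
  move=> h_small; apply: G_le; have := norm1_dist_triangle (vadd z h) z p.
  by rewrite vsub_vadd /delta in h_small r_delta *; lra.
have delta0 : 0 < delta by lra.
split=> [h i|h i h_small]; have h0 := norm1_ge0 h.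
  apply: Rle_trans (bounded_dG_le delta0 G_le_z h i) _; apply: Rmult_le_compat_r => //.
  by have -> : 4 * M / delta = 8 * M / delta / 2; [field; lra | rewrite /K in K_le; lra].
have h4 : norm1 h < delta / 4 by lra.
split.
  apply: Rle_trans (bounded_lipschitz delta0 G_le_z i h4) _; apply: Rmult_le_compat_r => //.
  by rewrite /K in K_le; lra.
apply: Rle_trans (bounded_taylor delta0 G_le_z i h4) _; apply: Rmult_le_compat_r.
  exact: pow2_ge_0.
by rewrite /K in K_le; lra.
Qed.

End Holomorphic.

(** * Holomorphic dependence of trajectories on the initial point *)

Lemma continuity_bootstrap (f : R -> R) (T bar : R) :
  (forall t, 0 <= t <= T -> continuity_pt f t) ->
  (forall s, 0 <= s <= T -> (forall r, 0 <= r < s -> f r <= bar) -> f s < bar) ->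
  forall t, 0 <= t <= T -> f t < bar.
Proof.
move=> f_cont below_step t tT; apply: Rnot_le_lt => bad.
pose S s := 0 <= s <= t /\ forall r, 0 <= r <= s -> f r <= bar.
have S0 : S 0.
  split=> [|r r0]; first lra.
  by have -> : r = 0; [lra | apply/Rlt_le/below_step => [|q]; lra].
case: (completeness S) => [||s [ub lub]]; first by exists t => s [[_ st] _].
  by exists 0.
have s0 : 0 <= s by exact: ub.
have st : s <= t by apply: lub => r [[_ rt] _].
have below r : 0 <= r < s -> f r <= bar.
  move=> r_s; apply: Rnot_lt_le => N; suff : s <= r by lra.
  by apply: lub => q [q0 q_le]; apply: Rnot_lt_le => rq; have := q_le r; lra.
have fs : f s < bar by apply: below_step => //; lra.
have s_lt_t : s < t by case: st => // E; rewrite E in fs; lra.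
case: (f_cont s ltac:(lra) (bar - f s) ltac:(lra)) => a [a0 near_s].
pose q := Rmin t (s + a / 2).
have qt : q <= t by exact: Rmin_l.
have qs : q <= s + a / 2 by exact: Rmin_r.
have sq : s < q by apply: Rmin_glb_lt; lra.
suff : q <= s by lra.
apply: ub; split=> [|r r_q]; first lra.
case: (Rlt_le_dec r s) => [rs|sr]; first by apply: below; lra.
case: (Req_dec r s) => [->|rs]; first lra.
have := near_s r; rewrite /dist /= /R_dist /D_x /no_cond => near_r.
suff : Rabs (f r - f s) < bar - f s by move=> /Rabs_def2; lra.
by apply: near_r; rewrite Rabs_pos_eq; [split; [split=> //; exact/not_eq_sym | lra] | lra].
Qed.

Lemma gronwall_barrier (f df : R -> R) (T A B K bar : R) :
  0 <= A -> 0 <= B -> 0 <= K -> f 0 <= A -> (A + B * T) * exp (K * T) < bar ->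
  (forall t, 0 <= t <= T -> is_derive f t (df t)) ->
  (forall t, 0 < t < T -> f t <= bar -> df t <= K * f t + B) ->
  forall t, 0 <= t <= T -> f t <= (A + B * t) * exp (K * t) /\ f t < bar.
Proof.
move=> A0 B0 K0 f0 lt_bar f_df df_le.
have bound s : 0 <= s <= T -> (forall r, 0 <= r < s -> f r <= bar) ->
    f s <= (A + B * s) * exp (K * s).
  move=> sT below; apply: gronwall => // [|t ts|t ts]; [lra | apply: f_df; lra |].
  by apply: df_le; [lra | apply: below; lra].
have below : forall t, 0 <= t <= T -> f t < bar.
  apply: continuity_bootstrap => [t /f_df|s sT /(bound s sT) fs].
    exact: is_derive_continuity_pt.
  apply: Rle_lt_trans fs _; apply: Rle_lt_trans lt_bar.
  have : K * s <= K * T by apply: Rmult_le_compat_l; lra.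
  by move/exp_le => exp_sT; apply: Rmult_le_compat => //; [nra | exact/Rlt_le/exp_pos | nra].
move=> t tT; split; last exact: below.
by apply: bound => // r rt; apply/Rlt_le/below; lra.
Qed.

Lemma is_derive_sumR (n : nat) (f : 'I_n -> R -> R) (l : 'I_n -> R) (t : R) :
  (forall i, is_derive (f i) t (l i)) ->
  is_derive (fun s => \big[Rplus/0]_(i < n) f i s) t (\big[Rplus/0]_(i < n) l i).
Proof.
elim: n f l => [|n IH] f l f_l.
  rewrite big_ord0; apply: (is_derive_ext (fun _ => 0)); first by move=> s; rewrite big_ord0.
  exact: (is_derive_const (V := R_NormedModule)).
rewrite big_ord_recr /=.
apply: (is_derive_ext (fun s => plus (\big[Rplus/0]_(i < n) f (widen_ord (leqnSn n) i) s) (f ord_max s))).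
  by move=> s; rewrite big_ord_recr.
by apply: (is_derive_plus (V := R_NormedModule)); [apply: IH => i | apply: f_l].
Qed.

Section VectorPaths.
Variables (n : nat) (y y' : R -> vec n).

Definition energy_derive (t : R) : R := \big[Rplus/0]_(i < n) (2 * fst (y t i * Cconj (y' t i))%cx).

Lemma is_derive_energy (t : R) : (forall i, is_path_derive (fun s => y s i) t (y' t i)) ->
  is_derive (fun s => vnorm2 (y s)) t (energy_derive t).
Proof. by move=> y_y'; apply: is_derive_sumR => i; exact: is_derive_Cnorm2_path. Qed.

Lemma energy_derive_le (t K b : R) : 0 <= K ->
  (forall i, Cmod (y' t i) <= K * norm1 (y t) + b) ->
  energy_derive t <= (2 * K + 1) * INR n ^ 2 * vnorm2 (y t) + b ^ 2.
Proof.
move=> K0 y'_le; set N := norm1 (y t) in y'_le.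
apply: (Rle_trans _ (\big[Rplus/0]_(i < n) (2 * (K * N + b) * Cmod (y t i)))).
  apply: sumR_le => i; have := fst_mul_conj_le (y t i) (y' t i); have := y'_le i.
  by have := Cmod_ge0 (y t i); nra.
rewrite sumR_scal -/(norm1 _) -/N.
have : (2 * K + 1) * N ^ 2 <= (2 * K + 1) * (INR n ^ 2 * vnorm2 (y t)).
  by apply: Rmult_le_compat_l; [lra | exact: norm1_sqr_le].
by have := pow2_ge_0 (N - b); nra.
Qed.

Lemma vec_gronwall (T A K b bar : R) : let kappa := (2 * K + 1) * INR n ^ 2 in
  0 <= A -> 0 <= K -> vnorm2 (y 0) <= A -> (A + b ^ 2 * T) * exp (kappa * T) < bar ->
  (forall t i, 0 <= t -> is_path_derive (fun s => y s i) t (y' t i)) ->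
  (forall t i, 0 < t < T -> vnorm2 (y t) <= bar -> Cmod (y' t i) <= K * norm1 (y t) + b) ->
  forall t, 0 <= t <= T -> vnorm2 (y t) <= (A + b ^ 2 * t) * exp (kappa * t) /\ vnorm2 (y t) < bar.
Proof.
move=> kappa A0 K0 y0 lt_bar y_y' y'_le.
have kappa0 : 0 <= kappa by apply: Rmult_le_pos; [lra | exact: pow2_ge_0].
apply: (@gronwall_barrier _ energy_derive) => // [|t tT|t tT below]; first exact: pow2_ge_0.
  by apply: is_derive_energy => i; apply: y_y'; lra.
by apply: energy_derive_le => // i; exact: y'_le.
Qed.

End VectorPaths.

Definition trajectory (n : nat) (G : vec n -> vec n) (x : R -> vec n) (z : vec n) : Prop :=
  x 0 = z /\ (forall t, 0 <= t -> ball (x t)) /\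
  forall t i, 0 <= t -> is_path_derive (fun s => x s i) t (G (x t) i).

(* Beyond the half-line a solution is continued by its tangent, to have two-sided
   derivatives at every [t >= 0]. *)
Lemma halfline_solution_extends (n : nat) (x : R -> vec n) (f : R -> vec n) :
  (forall t, 0 <= t -> has_deriv_on_halfline x t (f t)) ->
  exists xe : R -> vec n, (forall t, 0 <= t -> xe t = x t) /\
    forall t i, 0 <= t -> is_path_derive (fun s => xe s i) t (f t i).
Proof.
move=> x_f; pose xe t := if Rle_dec 0 t then x t else vadd (x 0) (vscalR t (f 0)).
have xeE t : 0 <= t -> xe t = x t by rewrite /xe; case: Rle_dec.
exists xe; split=> // t i t0; apply: is_path_derive_eps => e e0.
case: (x_f t t0 e e0) => a [a0 near_t].
have right s : 0 <= s -> Rabs (s - t) < a ->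
    Cmod (xe s i - xe t i - RtoC (s - t) * f t i)%cx <= e * Rabs (s - t).
  move=> s0 s_a; rewrite !xeE //; case: (Req_dec s t) => [->|st].
    have -> : (x t i - x t i - RtoC (t - t) * f t i)%cx = 0%cx by cx_ring.
    by rewrite Cmod0; have := Rabs_pos (t - t); nra.
  apply: Rle_trans (near_t s s0 _); last by split=> //; apply: Rabs_pos_lt; lra.
  exact: (Cmod_coord (vsub (vsub (x s) (x t)) (vscalR (s - t) (f t)))).
case: t0 => [t0|t_0].
  exists (Rmin a t); split=> [|s s_small]; first exact: Rmin_pos.
  apply: right (Rlt_le_trans _ _ _ s_small (Rmin_l _ _)).
  by have := Rlt_le_trans _ _ _ s_small (Rmin_r _ _); move=> /Rabs_def2; lra.
subst t; exists a; split=> // s s_a; case: (Rle_lt_dec 0 s) => s0; first exact: right.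
have -> : xe s = vadd (x 0) (vscalR s (f 0)) by rewrite /xe; case: Rle_dec => // ?; lra.
rewrite xeE; last lra.
have -> : (vadd (x 0%R) (vscalR s (f 0%R)) i - x 0%R i - RtoC (s - 0) * f 0%R i)%cx = 0%cx.
  by rewrite /vadd /vscalR /vscal; cx_ring.
by rewrite Cmod0; have := Rabs_pos (s - 0); nra.
Qed.

Lemma inf_generator_flow (n : nat) (G : vec n -> vec n) : inf_generator G ->
  exists X : vec n -> R -> vec n, forall z, ball z -> trajectory G (X z) z.
Proof.
move=> G_gen; exists (fun z => epsilon (inhabits (fun _ => z)) (fun x => trajectory G x z)) => z z_ball.
apply: (epsilon_spec (inhabits (fun _ => z)) (fun x => trajectory G x z)).
case: (G_gen z z_ball) => x [x0 [x_ball x_G]].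
case: (halfline_solution_extends (f := fun t => G (x t)) x_G) => xe [xeE xe_G].
exists xe; split; first by rewrite xeE; [exact: vec_ext | lra].
by split=> [t t0|t i t0]; rewrite xeE //; [exact: x_ball | exact: xe_G].
Qed.

Lemma is_cderive_of_quotient_le (F : C -> C) (a d : C) (h0 K : R) : 0 < h0 -> 0 <= K ->
  (forall h, 0 < Cmod h < h0 -> Cmod ((F (a + h) - F a) / h - d)%cx <= K * Cmod h) ->
  is_cderive F a d.
Proof.
move=> h0_gt0 K0 q_le; have K1 : 0 < K + 1 by lra.
apply/is_cderive_eps => e e0; exists (Rmin h0 (e / (K + 1))); split=> [|h h_small].
  by apply: Rmin_pos => //; exact: Rdiv_lt_0_compat.
have h_lt := Rlt_le_trans _ _ _ h_small (Rmin_l _ _).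
move: (Rlt_le_trans _ _ _ h_small (Rmin_r _ _)) => /(Rlt_div_r _ _ _ K1) h_e.
case: (Cmod_ge0 h) => [h_gt0|/esym /Cmod_eq0 ->]; last first.
  have -> : (F (a + 0) - F a - d * 0)%cx = 0%cx by have -> : (a + 0)%cx = a; ring.
  by rewrite Cmod0; lra.
have h_neq0 := Cmod_neq0 h_gt0.
have -> : (F (a + h) - F a - d * h)%cx = (((F (a + h) - F a) / h - d) * h)%cx by field.
rewrite Cmod_mul; have := q_le h (conj h_gt0 h_lt); set q := Cmod (_ - d)%cx.
by nra.
Qed.

Lemma ex_cderive_of_cauchy (F : C -> C) (a : C) (h0 K : R) : 0 < h0 -> 0 <= K ->
  (forall h k, 0 < Cmod h < h0 -> 0 < Cmod k < h0 ->
     Cmod ((F (a + h) - F a) / h - (F (a + k) - F a) / k)%cx <= K * (Cmod h + Cmod k)) ->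
  ex_cderive F a.
Proof.
move=> h0_gt0 K0 cauchy; pose q (h : C) : C := ((F (a + h) - F a) / h)%cx.
have small e : 0 < e -> at_right 0 (fun r => 0 < r < h0 /\ r < e).
  move=> e0; have m0 : 0 < Rmin h0 e by exact: Rmin_pos.
  exists (mkposreal _ m0) => r /= /Rabs_def2 r_m r0; rewrite /minus /plus /opp /= in r_m.
  by have := Rmin_l h0 e; have := Rmin_r h0 e; lra.
have RtoC_in r : 0 < r < h0 -> 0 < Cmod (RtoC r) < h0 by move=> r_h0; rewrite Cmod_RtoC_ge0; lra.
have K1 : 0 < K + 1 by lra.
have [d q_d] : exists d : CR, filterlim (fun r => q (RtoC r) : CR) (at_right 0) (locally d).
  apply/(filterlim_locally_cauchy (U := Coquelicot.Complex.C_R_CompleteNormedModule)) => e.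
  have e0 := cond_pos e; exists (fun r => 0 < r < h0 /\ r < e / 2 / (K + 1)); split.
    by apply: small; repeat apply: Rdiv_lt_0_compat; lra.
  move=> u v [u_in u_small] [v_in v_small].
  apply: Coquelicot.Complex.C_NormedModule_mixin_compat1 => /=.
  apply: Rle_lt_trans (cauchy _ _ (RtoC_in _ v_in) (RtoC_in _ u_in)) _.
  rewrite !Cmod_RtoC_ge0; try lra.
  move: u_small v_small => /(Rlt_div_r _ _ _ K1) ? /(Rlt_div_r _ _ _ K1) ?; nra.
have q_le h : 0 < Cmod h < h0 -> Cmod (q h - d)%cx <= K * Cmod h.
  move=> h_in; apply: le_epsilon => e e0.
  have e2 : 0 < e / 2 / (K + 1) by repeat apply: Rdiv_lt_0_compat; lra.
  have e4 : 0 < e / 4 by lra.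
  have near_d : at_right 0 (fun r => Hierarchy.ball d (e / 4) (q (RtoC r))).
    exact: (proj1 (filterlim_locally _ _) q_d (mkposreal _ e4)).
  case: (filter_ex _ (filter_and _ _ near_d (small _ e2))) => r [[/= near1 near2] [r_in]].
  move/(Rlt_div_r _ _ _ K1) => r_small.
  have := Cmod_dist_triangle (q h) (q (RtoC r)) d; have := cauchy _ _ h_in (RtoC_in _ r_in).
  have := Cmod_le_fst_snd (q (RtoC r) - d)%cx; rewrite (Cmod_RtoC_ge0 (x := r)); last lra.
  rewrite /q in near1 near2 *; move: near1 near2.
  rewrite /Hierarchy.ball /= /AbsRing_ball /abs /minus /plus /opp /=.
  rewrite -/(q h); set s := q (RtoC r); lra.
by exists d; exact: is_cderive_of_quotient_le h0_gt0 K0 q_le.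
Qed.

Section Flow.
Variables (n : nat) (G : vec n -> vec n) (dG : vec n -> vec n -> vec n).
Hypothesis G_diff : forall z, ball z -> is_cderiv G z (dG z).

Lemma trajectory_continuous (x : R -> vec n) (z : vec n) (t e : R) :
  trajectory G x z -> 0 <= t -> 0 < e -> exists delta, 0 < delta /\
    forall s, Rabs (s - t) < delta -> norm1 (vsub (x s) (x t)) < e.
Proof.
move=> [_ [_ x_G]] t0 e0; pose y s := vsub (x s) (x t).
have y_t : y t = vzero by apply: vec_ext => i; rewrite /y /vsub /vzero; ring.
have y_G i : is_path_derive (fun s => y s i) t (G (x t) i - 0)%cx.
  apply: is_path_derive_sub; first exact: x_G.
  exact: (is_derive_const (V := CR) (x t i)).
have := is_derive_continuity_pt (@is_derive_energy n y (fun _ i => G (x t) i - 0)%cx t y_G).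
have n2 := pow2_ge_0 (INR n).
case/(_ (e ^ 2 / (INR n ^ 2 + 1))) => [|delta [d0 near_t]].
  by apply: Rdiv_lt_0_compat; [exact: pow_lt | lra].
exists delta; split=> // s s_near; case: (Req_dec s t) => [->|st].
  by rewrite -/(y t) y_t norm1_zero.
have := near_t s; rewrite /dist /= /R_dist y_t vnorm2_zero Rminus_0_r => near_s.
apply: norm1_lt_of_vnorm2 e0 _; apply: Rle_trans (Rle_abs _) (Rlt_le _ _ (near_s _)).
by split=> //; split=> //; exact/not_eq_sym.
Qed.

Lemma trajectory_controlled (x : R -> vec n) (z : vec n) (T : R) : trajectory G x z ->
  exists r, 0 < r /\ forall t, 0 <= t <= T -> controlled G dG (x t) r.
Proof.
move=> x_traj.
have near t : 0 <= t -> exists r : posreal, forall s, Rabs (s - t) < r -> controlled G dG (x s) r.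
  move=> t0; case: (locally_controlled G_diff (proj1 (proj2 x_traj) t t0)) => r [r0 G_ctrl].
  case: (trajectory_continuous x_traj t0 r0) => delta [d0 x_near].
  have m0 : 0 < Rmin r delta by exact: Rmin_pos.
  exists (mkposreal _ m0) => s /= s_near; apply: controlled_le m0 (Rmin_l _ _) _.
  by apply/G_ctrl/x_near/(Rlt_le_trans _ _ _ s_near)/Rmin_r.
pose P t (r : posreal) := forall s, Rabs (s - t) < r -> controlled G dG (x s) r.
pose delta t := epsilon (inhabits (mkposreal 1 Rlt_0_1)) (P t).
have delta_P t : 0 <= t -> P t (delta t).
  by move=> /near; exact: epsilon_spec.
case: (compactness_value_1d 0 T delta) => r r_le; exists r; split=> [|s sT]; first exact: cond_pos.
apply: NNPP => N; apply: (r_le s sT) => -[t [tT [st rt]]]; apply: N.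
by apply: controlled_le (cond_pos r) rt _; apply: delta_P; lra.
Qed.

Section NearbyTrajectories.
Variables (x : R -> vec n) (p : vec n) (T r : R).
Hypotheses (T0 : 0 <= T) (r0 : 0 < r) (x_traj : trajectory G x p).
Hypothesis x_ctrl : forall t, 0 <= t <= T -> controlled G dG (x t) r.

Let kappa : R := (2 * / r + 1) * INR n ^ 2.
Let growth : R := exp (kappa * T).

Let inv_r_gt0 : 0 < / r. Proof. exact: Rinv_0_lt_compat. Qed.

Let kappa_ge0 : 0 <= kappa.
Proof. by apply: Rmult_le_pos; [lra | exact: pow2_ge_0]. Qed.

Let exp_le_growth (t : R) : 0 <= t <= T -> exp (kappa * t) <= growth.
Proof. by move=> tT; apply/exp_le/Rmult_le_compat_l; [exact: kappa_ge0 | lra]. Qed.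

Lemma trajectory_gap (x' : R -> vec n) (p' : vec n) : trajectory G x' p' ->
  norm1 (vsub p' p) ^ 2 * growth < r ^ 2 / (INR n ^ 2 + 1) ->
  forall t, 0 <= t <= T -> vnorm2 (vsub (x' t) (x t)) <= norm1 (vsub p' p) ^ 2 * growth /\
    norm1 (vsub (x' t) (x t)) < r.
Proof.
move=> x'_traj p'_near; pose y t := vsub (x' t) (x t).
have y_G t i : 0 <= t -> is_path_derive (fun s => y s i) t (G (x' t) i - G (x t) i)%cx.
  move: x_traj x'_traj => [_ [_ x_G]] [_ [_ x'_G]] t0.
  by apply: is_path_derive_sub; [exact: x'_G | exact: x_G].
have y0 : vnorm2 (y 0) <= norm1 (vsub p' p) ^ 2.
  by rewrite /y; case: x_traj x'_traj => [-> _] [-> _]; exact: vnorm2_le_norm1.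
have gap := @vec_gronwall n y (fun t i => G (x' t) i - G (x t) i)%cx T (norm1 (vsub p' p) ^ 2) (/ r) 0
  (r ^ 2 / (INR n ^ 2 + 1)) (pow2_ge_0 _) (Rlt_le _ _ inv_r_gt0) y0.
rewrite -/kappa (_ : 0 ^ 2 = 0) ?Rmult_0_l ?Rplus_0_r in gap; last by ring.
move=> t tT; case: (gap p'_near y_G _ t tT) => [s i sT /(norm1_lt_of_vnorm2 r0) y_s|y_le y_lt].
  have [_ /(_ (y s) i y_s)] := x_ctrl (conj (Rlt_le _ _ (proj1 sT)) (Rlt_le _ _ (proj2 sT))).
  by rewrite /y vadd_vsub Rplus_0_r => -[].
split; last by apply: norm1_lt_of_vnorm2 r0 _; exact: Rlt_le.
apply: Rle_trans y_le _; rewrite Rmult_0_l Rplus_0_r.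
by apply: Rmult_le_compat_l; [exact: pow2_ge_0 | exact: exp_le_growth].
Qed.

Lemma quotient_remainder_le (x' : R -> vec n) (p' : vec n) (h : C) (m t : R) (i : 'I_n) :
  trajectory G x' p' -> h <> 0%cx -> norm1 (vsub p' p) = Cmod h * m ->
  norm1 (vsub p' p) ^ 2 * growth < r ^ 2 / (INR n ^ 2 + 1) -> 0 <= t <= T ->
  Cmod (Cinv h * (G (x' t) i - G (x t) i - dG (x t) (vsub (x' t) (x t)) i))%cx
    <= / r * (INR n ^ 2 * (m ^ 2 * growth)) * Cmod h.
Proof.
move=> x'_traj /[dup] h_neq0 /Cmod_gt0 h0 p'p p'_near tT.
case: (trajectory_gap x'_traj p'_near tT); rewrite p'p; set y := vsub _ _ => y_le y_r.
have [_ /(_ y i y_r)] := x_ctrl tT; rewrite /y vadd_vsub -/y => -[_ taylor].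
rewrite Cmod_mul Cmod_inv // Rmult_comm; apply/Rle_div_l => //; apply: Rle_trans taylor _.
have -> : / r * (INR n ^ 2 * (m ^ 2 * growth)) * Cmod h * Cmod h =
  / r * (INR n ^ 2 * ((Cmod h * m) ^ 2 * growth)) by ring.
apply: Rmult_le_compat_l; first lra.
by apply: Rle_trans (norm1_sqr_le y) _; apply: Rmult_le_compat_l => //; exact: pow2_ge_0.
Qed.

Let quotient (y : R -> vec n) (h : C) (t : R) : vec n := vscal (Cinv h) (vsub (y t) (x t)).

Let quotient_derive (y : R -> vec n) (h : C) (t : R) : vec n :=
  vscal (Cinv h) (vsub (G (y t)) (G (x t))).

Let is_path_derive_quotient (y : R -> vec n) (p' : vec n) (h : C) (t : R) (i : 'I_n) :
  trajectory G y p' -> 0 <= t ->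
  is_path_derive (fun s => quotient y h s i) t (quotient_derive y h t i).
Proof.
move: x_traj => [_ [_ x_G]] [_ [_ y_G]] t0; apply: is_path_derive_scal.
by apply: is_path_derive_sub; [exact: y_G | exact: x_G].
Qed.

Section DifferenceQuotients.
Variables (v : vec n) (h k : C) (xh xk : R -> vec n).
Hypotheses (h0 : h <> 0%cx) (k0 : k <> 0%cx).
Hypothesis xh_traj : trajectory G xh (vadd p (vscal h v)).
Hypothesis xk_traj : trajectory G xk (vadd p (vscal k v)).
Hypothesis h_small : (Cmod h * norm1 v) ^ 2 * growth < r ^ 2 / (INR n ^ 2 + 1).
Hypothesis k_small : (Cmod k * norm1 v) ^ 2 * growth < r ^ 2 / (INR n ^ 2 + 1).

Let w (t : R) : vec n := vsub (quotient xh h t) (quotient xk k t).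
Let w' (t : R) : vec n := vsub (quotient_derive xh h t) (quotient_derive xk k t).
Let K : R := / r * (INR n ^ 2 * (norm1 v ^ 2 * growth)).

Let is_path_derive_w (t : R) (i : 'I_n) : 0 <= t -> is_path_derive (fun s => w s i) t (w' t i).
Proof.
move=> t0; apply: is_path_derive_sub.
  exact: is_path_derive_quotient xh_traj t0.
exact: is_path_derive_quotient xk_traj t0.
Qed.

Let w_start : w 0 = vzero.
Proof.
rewrite /w /quotient; case: x_traj xh_traj xk_traj => [-> _] [-> _] [-> _].
by rewrite !vsub_vadd; apply: vec_ext => i; rewrite /vsub /vscal /vzero; field.
Qed.

Let w'_le (t : R) (i : 'I_n) : 0 < t < T ->
  Cmod (w' t i) <= / r * norm1 (w t) + K * (Cmod h + Cmod k).
Proof.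
move=> tT; have {}tT : 0 <= t <= T by lra.
have gap_norm a : norm1 (vsub (vadd p (vscal a v)) p) = Cmod a * norm1 v.
  by rewrite vsub_vadd norm1_scal.
have := quotient_remainder_le i xh_traj h0 (gap_norm h) _ tT; rewrite gap_norm => /(_ h_small).
have := quotient_remainder_le i xk_traj k0 (gap_norm k) _ tT; rewrite gap_norm => /(_ k_small).
set Rh := (Cinv h * _)%cx; set Rk := (Cinv k * _)%cx; rewrite -/K => Rk_le Rh_le.
have [/(_ (w t) i) dG_le _] := x_ctrl tT.
have x_lin : Clinear (dG (x t)).
  by apply: (dG_linear G_diff); case: x_traj => [_ [x_ball _]]; apply: x_ball; lra.
have -> : w' t i = (dG (x t) (w t) i + (Rh - Rk))%cx.
  by rewrite /w clinear_sub // !clinear_scal // /w' /Rh /Rk /quotient_derive /vsub /vscal; ring.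
by apply: Rle_trans (Cmod_add _ _) _; have := Cmod_sub Rh Rk; lra.
Qed.

Lemma difference_quotient_gap (i : 'I_n) :
  Cmod ((xh T i - x T i) / h - (xk T i - x T i) / k)%cx <=
    / r * (INR n ^ 2 * (norm1 v ^ 2 * growth)) * sqrt (T * growth) * (Cmod h + Cmod k).
Proof.
have growth0 : 0 <= growth by exact/Rlt_le/exp_pos.
have := @vec_gronwall n w w' T 0 (/ r) (K * (Cmod h + Cmod k))
  ((0 + (K * (Cmod h + Cmod k)) ^ 2 * T) * growth + 1) (Rle_refl 0) (Rlt_le _ _ inv_r_gt0).
rewrite w_start vnorm2_zero -/kappa -/growth => w_bound.
case: (w_bound (Rle_refl 0) _ is_path_derive_w (fun t j tT _ => w'_le j tT) T (conj T0 (Rle_refl T))).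
  by lra.
move=> wT _; rewrite -/K.
have -> : ((xh T i - x T i) / h - (xk T i - x T i) / k)%cx = w T i.
  by rewrite /w /quotient /vsub /vscal; field.
have K0 : 0 <= K.
  apply: Rmult_le_pos; first lra; apply: Rmult_le_pos; first exact: pow2_ge_0.
  by apply: Rmult_le_pos => //; exact: pow2_ge_0.
apply: Cmod_le_of_Cnorm2.
  repeat apply: Rmult_le_pos => //; first exact: sqrt_pos.
  by have := Cmod_ge0 h; have := Cmod_ge0 k; lra.
have -> : (K * sqrt (T * growth) * (Cmod h + Cmod k)) ^ 2 =
  (K * (Cmod h + Cmod k)) ^ 2 * sqrt (T * growth) ^ 2 by ring.
rewrite pow2_sqrt; last exact: Rmult_le_pos.
apply: Rle_trans (Cnorm2_coord _ i) _; apply: Rle_trans wT _.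
by rewrite -/growth; apply: Req_le; ring.
Qed.

End DifferenceQuotients.

End NearbyTrajectories.

Variable X : vec n -> R -> vec n.
Hypothesis X_traj : forall z, ball z -> trajectory G (X z) z.

Lemma flow_line_ex_cderive (z v : vec n) (a : C) (T : R) (i : 'I_n) : 0 <= T ->
  ball (vadd z (vscal a v)) -> ex_cderive (fun b => X (vadd z (vscal b v)) T i) a.
Proof.
move=> T0 p_ball; set p := vadd z (vscal a v) in p_ball; have Xp := X_traj p_ball.
case: (trajectory_controlled T Xp) => r [r0 p_ctrl].
case: (ball_open p_ball) => b [b0 near_p].
set growth := exp ((2 * / r + 1) * INR n ^ 2 * T); have growth0 : 0 < growth by exact: exp_pos.
have v0 := norm1_ge0 v; have v1 : 0 < norm1 v + 1 by lra.
pose s := sqrt (r ^ 2 / (INR n ^ 2 + 1) / growth).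
have s2 : 0 < r ^ 2 / (INR n ^ 2 + 1) / growth.
  by repeat apply: Rdiv_lt_0_compat => //; [exact: pow_lt | have := pow2_ge_0 (INR n); lra].
have s0 : 0 < s by exact: sqrt_lt_R0.
pose h0 := Rmin (b / (norm1 v + 1)) (s / (norm1 v + 1)).
have h00 : 0 < h0 by apply: Rmin_pos; exact: Rdiv_lt_0_compat.
have X_traj_near h : Cmod h < h0 -> trajectory G (X (vadd z (vscal (a + h) v))) (vadd p (vscal h v)).
  move=> h_small; rewrite vadd_vscal_add -/p; apply/X_traj/near_p; rewrite vsub_vadd norm1_scal.
  move/Rlt_div_r: (Rlt_le_trans _ _ _ h_small (Rmin_l _ _)) => /(_ v1).
  by have := Cmod_ge0 h; lra.
have small h : Cmod h < h0 -> (Cmod h * norm1 v) ^ 2 * growth < r ^ 2 / (INR n ^ 2 + 1).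
  move=> h_small; apply/(Rlt_div_r _ _ growth) => //; rewrite -(pow2_sqrt _ (Rlt_le _ _ s2)) -/s.
  move/Rlt_div_r: (Rlt_le_trans _ _ _ h_small (Rmin_r _ _)) => /(_ v1).
  have hv0 : 0 <= Cmod h * norm1 v by apply: Rmult_le_pos => //; exact: Cmod_ge0.
  by have := Cmod_ge0 h; nra.
apply: (ex_cderive_of_cauchy (h0 := h0)
  (K := / r * (INR n ^ 2 * (norm1 v ^ 2 * growth)) * sqrt (T * growth)))
  => // [|h k [h_pos h_h0] [k_pos k_h0]].
  apply: Rmult_le_pos; last exact: sqrt_pos; apply: Rmult_le_pos; first exact/Rlt_le/Rinv_0_lt_compat.
  apply: Rmult_le_pos; first exact: pow2_ge_0.
  by apply: Rmult_le_pos; [exact: pow2_ge_0 | lra].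
have := difference_quotient_gap T0 r0 Xp p_ctrl (Cmod_neq0 h_pos) (Cmod_neq0 k_pos)
  (X_traj_near h h_h0) (X_traj_near k k_h0) (small h h_h0) (small k k_h0) i.
exact.
Qed.

End Flow.

(** * Siegel coordinates *)

Section InnerProduct.
Variable n : nat.
Implicit Types u v w : vec n.

Lemma inner_addl u v w : inner (vadd u v) w = (inner u w + inner v w)%cx.
Proof. by rewrite /inner -big_split; apply: eq_bigr => i _; rewrite /vadd /=; ring. Qed.

Lemma inner_scall (a : C) u w : inner (vscal a u) w = (a * inner u w)%cx.
Proof.
rewrite /inner (big_morph (fun x => a * x)%cx (id1 := Czero) (op1 := Cadd)).
- by apply: eq_bigr => i _; rewrite /vscal; ring.
- by move=> x y; ring.
- by ring.
Qed.

Lemma inner_conj u v : Cconj (inner u v) = inner v u.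
Proof.
rewrite /inner (big_morph Cconj (id1 := Czero) (op1 := Cadd)); first by apply: eq_bigr => i _; cx_ring.
  by move=> x y; cx_ring.
by cx_ring.
Qed.

Lemma inner_addr u v w : inner w (vadd u v) = (inner w u + inner w v)%cx.
Proof. by rewrite -inner_conj inner_addl -(inner_conj u) -(inner_conj v); cx_ring. Qed.

Lemma inner_scalr (a : C) u w : inner w (vscal a u) = (Cconj a * inner w u)%cx.
Proof. by rewrite -inner_conj inner_scall -(inner_conj u); cx_ring. Qed.

Lemma inner_self u : inner u u = RtoC (vnorm2 u).
Proof.
rewrite /inner /vnorm2 (big_morph RtoC (id1 := Czero) (op1 := Cadd)) //; last by move=> a b; cx_ring.
by apply: eq_bigr => i _; cx_ring.
Qed.

Lemma vnorm2_add u v : vnorm2 (vadd u v) = vnorm2 u + 2 * fst (inner u v) + vnorm2 v.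
Proof.
have fst_norm w : vnorm2 w = fst (inner w w) by rewrite inner_self.
by rewrite !fst_norm inner_addl !inner_addr -(inner_conj u v); cx_unfold; ring.
Qed.

Lemma vnorm2_scal (a : C) u : vnorm2 (vscal a u) = Cnorm2 a * vnorm2 u.
Proof.
by rewrite /vnorm2 -sumR_scal; apply: eq_bigr => i _; rewrite /vscal; cx_unfold; ring.
Qed.

Lemma vnorm2_sub u v : vnorm2 (vsub u v) = vnorm2 u - 2 * fst (inner u v) + vnorm2 v.
Proof.
have -> : vsub u v = vadd u (vscal (- (1)) v).
  by apply: vec_ext => i; rewrite /vsub /vadd /vscal; ring.
by rewrite vnorm2_add inner_scalr vnorm2_scal; cx_unfold; ring.
Qed.

Lemma inner_vzero u : inner u vzero = 0%cx.
Proof. by rewrite /inner big1 // => i _; rewrite /vzero; cx_ring. Qed.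

Lemma inner_basis u (i : 'I_n) : inner u (basis n i) = u i.
Proof.
rewrite /inner (bigD1 i) //= big1 => [|j ji]; first by rewrite /basis eqxx; cx_ring.
by rewrite /basis (_ : (nat_of_ord j == i) = false); [cx_ring | exact: negbTE].
Qed.

Lemma vnorm2_basis (i : 'I_n) : vnorm2 (basis n i) = 1.
Proof.
have := inner_self (basis n i); rewrite inner_basis /basis eqxx.
by move/(congr1 fst) => /= <-.
Qed.

Lemma vnorm2_add_basis u (a : C) (j : 'I_n) :
  vnorm2 (vadd u (vscal a (basis n j))) = vnorm2 u + 2 * fst (u j * Cconj a)%cx + Cnorm2 a.
Proof.
by rewrite vnorm2_add inner_scalr inner_basis vnorm2_scal vnorm2_basis; cx_unfold; ring.
Qed.

End InnerProduct.

Lemma filterdiff_inner (U : NormedModule R_AbsRing) (n : nat) (f lf : U -> vec n) (c : vec n) (x : U) :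
  (forall i, filterdiff (V := CR) (fun t => f t i) (locally x) (fun h => lf h i)) ->
  filterdiff (V := CR) (fun t => inner (f t) c) (locally x) (fun h => inner (lf h) c).
Proof.
rewrite /inner; elim: n f lf c => [|n IH] f lf c f_lf.
  apply: (filterdiff_ext (V := CR) (fun _ => 0%cx)); first by move=> t; rewrite big_ord0.
  by apply: filterdiff_eq_Clin (filterdiff_Cconst 0%cx x) => h; rewrite big_ord0.
pose low (v : vec n.+1) : vec n := fun i => v (widen_ord (leqnSn n) i).
have low_recr v : \big[Cadd/Czero]_(i < n.+1) (v i * Cconj (c i))%cx =
    (\big[Cadd/Czero]_(i < n) (low v i * Cconj (low c i)) + v ord_max * Cconj (c ord_max))%cx.
  by rewrite big_ord_recr.
apply: (filterdiff_ext (V := CR) (fun t => _)) => [t|]; first by rewrite low_recr.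
apply: filterdiff_eq_Clin (filterdiff_Cadd (IH (fun t => low (f t)) (fun h => low (lf h)) (low c) _)
  (filterdiff_Cmul (f_lf ord_max) (filterdiff_Cconst (Cconj (c ord_max)) x))) => [h|i].
  by rewrite low_recr; ring.
exact: f_lf.
Qed.

(* In the Siegel model [(w, v) = ((1 + z_1) / (1 - z_1), z'' / (1 - z_1))] of the ball,
   [siegel c] is [w - 2 <v, c> + |c|^2], whose real part is [- uB z + |v - c|^2]. Hence it
   maps the ball to the right half-plane, and along the complex geodesic [v = c] through
   [e_1] its real part is exactly [- uB]. *)

Section Siegel.
Variable n : nat.
Implicit Types c z w u : vec n.+1.

Definition axis (a : C) : vec n.+1 := vscal a (basis n.+1 0).

Definition siegel c z : C := (RtoC 2 * (1 - inner z c) / (1 - z ord0) - 1 + RtoC (vnorm2 c))%cx.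

Definition dsiegel c z w : C :=
  (RtoC 2 * ((1 - inner z c) * w ord0 - inner w c * (1 - z ord0)) / ((1 - z ord0) * (1 - z ord0)))%cx.

Definition slice c (t : C) : vec n.+1 := vadd (axis (1 - t)) (vscal t c).

Lemma basis0E (i : 'I_n.+1) : basis n.+1 0 i = if i == ord0 then 1%cx else 0%cx.
Proof. by []. Qed.

Lemma inner_e1 z : inner z (basis n.+1 0) = z ord0.
Proof. exact: (inner_basis z ord0). Qed.

Lemma coord1E z : coord1 z = z ord0.
Proof. exact: inner_e1. Qed.

Lemma axis_ord0 (a : C) : axis a ord0 = a.
Proof. by rewrite /axis /vscal basis0E eqxx; ring. Qed.

Lemma axis_neq0 (a : C) (i : 'I_n.+1) : i != ord0 -> axis a i = 0%cx.
Proof. by move=> /negbTE i0; rewrite /axis /vscal basis0E i0; ring. Qed.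

Lemma inner_axis z (a : C) : inner z (axis a) = (Cconj a * z ord0)%cx.
Proof. by rewrite inner_scalr inner_e1. Qed.

Lemma vnorm2_axis (a : C) : vnorm2 (axis a) = Cnorm2 a.
Proof. by rewrite vnorm2_scal (vnorm2_basis ord0) Rmult_1_r. Qed.

Lemma slice_ord0 c (t : C) : c ord0 = 0%cx -> slice c t ord0 = (1 - t)%cx.
Proof. by move=> c0; rewrite /slice /vadd axis_ord0 /vscal c0; ring. Qed.

Lemma slice_neq0 c (t : C) (i : 'I_n.+1) : i != ord0 -> slice c t i = (t * c i)%cx.
Proof. by move=> i0; rewrite /slice /vadd axis_neq0 // /vscal; ring. Qed.

Lemma slice_vzero (t : C) : slice vzero t = axis (1 - t).
Proof. by apply: vec_ext => i; rewrite /slice /vadd /vscal /vzero; ring. Qed.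

Lemma inner_slice u c (t : C) : inner u (slice c t) =
  (Cconj (1 - t) * u ord0 + Cconj t * inner u c)%cx.
Proof. by rewrite inner_addr inner_axis inner_scalr. Qed.

Lemma vnorm2_slice c (t : C) : c ord0 = 0%cx ->
  vnorm2 (slice c t) = Cnorm2 (1 - t)%cx + Cnorm2 t * vnorm2 c.
Proof.
move=> c0; rewrite vnorm2_add vnorm2_axis vnorm2_scal inner_scalr -inner_conj inner_axis c0.
by cx_unfold; ring.
Qed.

Lemma ball_coord1_neq1 z : ball z -> (1 - z ord0)%cx <> 0%cx.
Proof.
move=> /(ball_Cmod_lt1 ord0) z1; apply: Cmod_neq0.
by have := Cmod_sub_ge 1 (z ord0); rewrite Cmod1; lra.
Qed.

Lemma ball_coord1_sub1_neq0 z : ball z -> (z ord0 - 1)%cx <> 0%cx.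
Proof.
by move=> /ball_coord1_neq1 /Cmod_gt0 z1; apply: Cmod_neq0; rewrite Cmod_subC.
Qed.

Lemma siegel_re c z : c ord0 = 0%cx -> (1 - z ord0)%cx <> 0%cx ->
  Cnorm2 (1 - z ord0)%cx * fst (siegel c z) =
    1 - vnorm2 z + vnorm2 (vsub z (slice c (1 - z ord0)%cx)).
Proof.
move=> c0 /Cnorm2_gt0; rewrite vnorm2_sub vnorm2_slice // inner_slice /siegel.
move: (inner z c) (z ord0) (vnorm2 c) (vnorm2 z) => a b N M.
by cx_unfold => D; field; lra.
Qed.

Lemma siegel_re_ge0 c z : c ord0 = 0%cx -> ball z -> 0 <= fst (siegel c z).
Proof.
move=> c0 z_ball; have z1 := ball_coord1_neq1 z_ball; have := siegel_re c0 z1.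
have := vnorm2_ge0 (vsub z (slice c (1 - z ord0)%cx)); have := Cnorm2_gt0 z1.
by rewrite /ball in z_ball; nra.
Qed.

Lemma dsiegel_scal c z w (a : C) : dsiegel c z (vscal a w) = (a * dsiegel c z w)%cx.
Proof. by rewrite /dsiegel inner_scall /vscal /Cdiv; ring. Qed.

Lemma filterdiff_siegel (U : NormedModule R_AbsRing) c (f lf : U -> vec n.+1) (x : U) :
  (1 - f x ord0)%cx <> 0%cx ->
  (forall i, filterdiff (V := CR) (fun t => f t i) (locally x) (fun h => lf h i)) ->
  filterdiff (V := CR) (fun t => siegel c (f t)) (locally x) (fun h => dsiegel c (f x) (lf h)).
Proof.
move=> f1 f_lf; have const a := filterdiff_Cconst (U := U) a x.
have num := filterdiff_Cmul (const (RtoC 2)) (filterdiff_Csub (const 1%cx) (filterdiff_inner c f_lf)).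
have den := filterdiff_Csub (const 1%cx) (f_lf ord0); have frac := filterdiff_Cdiv (x := x) f1 num den.
have siegel_diff := filterdiff_Cadd (filterdiff_Csub frac (const 1%cx)) (const (RtoC (vnorm2 c))).
apply: filterdiff_eq_Clin siegel_diff => h.
by rewrite /dsiegel; field.
Qed.

Lemma is_path_derive_siegel c (f : R -> vec n.+1) (f' : vec n.+1) (t : R) :
  (1 - f t ord0)%cx <> 0%cx -> (forall i, is_path_derive (fun s => f s i) t (f' i)) ->
  is_path_derive (fun s => siegel c (f s)) t (dsiegel c (f t) f').
Proof.
move=> f1 f_f'; have f_lf i :
    filterdiff (V := CR) (fun s => f s i) (locally t) (fun h => vscal (RtoC h) f' i).
  by apply: (@filterdiff_eq_Clin R_NormedModule) (f_f' i) => h; exact: scal_RtoC.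
apply: (@filterdiff_eq_Clin R_NormedModule) (filterdiff_siegel c f1 f_lf) => h.
by rewrite scal_RtoC dsiegel_scal.
Qed.

Lemma ex_cderive_siegel c (f : C -> vec n.+1) (a : C) :
  (1 - f a ord0)%cx <> 0%cx -> (forall i, ex_cderive (fun s => f s i) a) ->
  ex_cderive (fun s => siegel c (f s)) a.
Proof.
move=> f1 f_diff; pose f' : vec n.+1 := fun i => Cderive (fun s => f s i) a.
exists (dsiegel c (f a) f').
apply: (@filterdiff_eq_Clin CR) (filterdiff_siegel (lf := fun h => vscal h f') c f1 _) => [h|i].
  by rewrite dsiegel_scal; ring.
apply: (@filterdiff_eq_Clin CR) (Cderive_correct (f_diff i)) => h.
by rewrite /vscal /f'; ring.
Qed.

(* The value of [1 - z_1] at the point of the geodesic where [siegel c] is [w]. *)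
Definition tau c (w : C) : C := (RtoC 2 / (w + RtoC (1 + vnorm2 c)))%cx.

Definition geodesic c (w : C) : vec n.+1 := slice c (tau c w).

Lemma RtoC2_neq0 : RtoC 2 <> 0%cx.
Proof. by case; lra. Qed.

Lemma tau_denom_neq0 c (w : C) : half_plane w -> (w + RtoC (1 + vnorm2 c))%cx <> 0%cx.
Proof. by rewrite /half_plane => w0 /(congr1 fst); have := vnorm2_ge0 c; cx_unfold; lra. Qed.

Lemma tau_neq0 c (w : C) : half_plane w -> tau c w <> 0%cx.
Proof.
move=> /(tau_denom_neq0 (c := c)) d0; apply: Cmod_neq0; rewrite Cmod_div //.
by apply: Rdiv_lt_0_compat; apply: Cmod_gt0 => //; exact: RtoC2_neq0.
Qed.

Lemma ex_cderive_tau c (w : C) : half_plane w -> ex_cderive (tau c) w.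
Proof.
move=> w0; have den := is_cderive_add (is_cderive_id w) (is_cderive_const (RtoC (1 + vnorm2 c)) w).
by eexists; exact: is_cderive_div (is_cderive_const (RtoC 2) w) den (tau_denom_neq0 w0).
Qed.

Lemma geodesic_ord0 c (w : C) : c ord0 = 0%cx -> (1 - geodesic c w ord0)%cx = tau c w.
Proof. by move=> c0; rewrite /geodesic slice_ord0 //; ring. Qed.

Lemma siegel_slice c (t : C) : c ord0 = 0%cx -> t <> 0%cx ->
  siegel c (slice c t) = (RtoC 2 / t - RtoC (1 + vnorm2 c))%cx.
Proof.
move=> c0 t0; rewrite /siegel -inner_conj inner_slice inner_self slice_ord0 // c0.
have -> : (1 - (1 - t))%cx = t by ring.
have -> : Cconj (Cconj (1 - t) * 0 + Cconj t * RtoC (vnorm2 c))%cx = (t * RtoC (vnorm2 c))%cx by cx_ring.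
have -> : RtoC (1 + vnorm2 c) = (1 + RtoC (vnorm2 c))%cx by cx_ring.
have -> : RtoC 2 = (1 + 1)%cx by cx_ring.
by field.
Qed.

Lemma siegel_geodesic c (w : C) : c ord0 = 0%cx -> half_plane w -> siegel c (geodesic c w) = w.
Proof.
move=> c0 w0; rewrite siegel_slice //; last exact: tau_neq0.
have d0 := tau_denom_neq0 (c := c) w0; have two := RtoC2_neq0.
by rewrite /tau; field.
Qed.

Lemma geodesic_defect c (w : C) : c ord0 = 0%cx -> half_plane w ->
  1 - vnorm2 (geodesic c w) = Cnorm2 (tau c w) * fst w.
Proof.
move=> c0 w0; have t0 := tau_neq0 (c := c) w0.
have := siegel_re (z := geodesic c w) c0; rewrite siegel_geodesic // geodesic_ord0 // => /(_ t0) ->.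
rewrite vnorm2_sub inner_self /= -/(geodesic c w); ring.
Qed.

Lemma geodesic_ball c (w : C) : c ord0 = 0%cx -> half_plane w -> ball (geodesic c w).
Proof.
move=> c0 w0; have := geodesic_defect c0 w0; have := Cnorm2_gt0 (tau_neq0 (c := c) w0).
by rewrite /ball /half_plane in w0 *; nra.
Qed.

Definition slice_param z : vec n.+1 :=
  fun i => if i == ord0 then 0%cx else (z i / (1 - z ord0))%cx.

Lemma slice_param_ord0 z : slice_param z ord0 = 0%cx.
Proof. by []. Qed.

Lemma slice_slice_param z : ball z -> slice (slice_param z) (1 - z ord0)%cx = z.
Proof.
move=> /ball_coord1_neq1 z1; apply: vec_ext => i; case: (eqVneq i ord0) => [->|i0].
  by rewrite slice_ord0 //; ring.
by rewrite slice_neq0 // /slice_param (negbTE i0); field.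
Qed.

Lemma geodesic_siegel_param z : ball z ->
  geodesic (slice_param z) (siegel (slice_param z) z) = z.
Proof.
move=> z_ball; have z1 := ball_coord1_neq1 z_ball.
suff tauE : tau (slice_param z) (siegel (slice_param z) z) = (1 - z ord0)%cx.
  by rewrite /geodesic tauE; exact: slice_slice_param.
rewrite -{3}(slice_slice_param z_ball) siegel_slice // /tau; set N := RtoC (1 + _).
have -> : (RtoC 2 / (1 - z ord0) - N + N)%cx = (RtoC 2 / (1 - z ord0))%cx by ring.
by have two := RtoC2_neq0; field.
Qed.

Lemma slice_param_geodesic c (w : C) : c ord0 = 0%cx -> half_plane w ->
  slice_param (geodesic c w) = c.
Proof.
move=> c0 w0; apply: vec_ext => i; rewrite /slice_param; case: (eqVneq i ord0) => [->|i0] //.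
have t0 := tau_neq0 (c := c) w0.
by rewrite geodesic_ord0 // /geodesic slice_neq0 //; field.
Qed.

Lemma siegel_param_re z : ball z -> fst (siegel (slice_param z) z) = - uB z.
Proof.
move=> z_ball; have z1 := ball_coord1_neq1 z_ball; have D := Cnorm2_gt0 z1.
have := siegel_re (slice_param_ord0 z) z1; rewrite slice_slice_param // vnorm2_sub inner_self /=.
move=> E; rewrite /uB coord1E; apply: (Rmult_eq_reg_l (Cnorm2 (1 - z ord0)%cx)); last lra.
by rewrite E; field; lra.
Qed.

Lemma siegel_param_half_plane z : ball z -> half_plane (siegel (slice_param z) z).
Proof.
move=> z_ball; have D := Cnorm2_gt0 (ball_coord1_neq1 z_ball).
rewrite /half_plane siegel_param_re // /uB coord1E -Rdiv_opp_l Ropp_involutive.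
by apply: Rdiv_lt_0_compat => //; rewrite /ball in z_ball; lra.
Qed.

Lemma inner_slice_param u z : ball z ->
  inner u (slice_param z) = ((inner u z - u ord0 * Cconj (z ord0)) / Cconj (1 - z ord0))%cx.
Proof.
move=> /ball_coord1_neq1 z1; have cz1 : Cconj (1 - z ord0)%cx <> 0%cx.
  by apply: Cmod_neq0; rewrite Cmod_conj; exact: Cmod_gt0.
have scale_param : inner u z =
    (u ord0 * Cconj (z ord0) + Cconj (1 - z ord0) * inner u (slice_param z))%cx.
  rewrite -inner_scalr /inner !big_ord_recl /vscal slice_param_ord0.
  rewrite (_ : (u ord0 * Cconj ((1 - z ord0) * 0))%cx = 0%cx) ?Cadd0; last by cx_ring.
  by congr Cadd; apply: eq_bigr => i _; congr (Cmul _ (Cconj _)); rewrite /slice_param /=; field.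
by rewrite scale_param; field.
Qed.

Lemma uB_line z w (t : R) : let a := (1 - z ord0)%cx in let b := w ord0 in
  uB (vadd z (vscalR t w)) = - (1 - (vnorm2 z + 2 * (t * fst (inner z w)) + t ^ 2 * vnorm2 w)) /
    ((fst a - t * fst b) ^ 2 + (snd a - t * snd b) ^ 2).
Proof.
move=> a b; rewrite /uB vnorm2_add inner_scalr vnorm2_scal coord1E; congr (- _ / _).
  by cx_unfold; ring.
by rewrite /a /b /vadd /vscalR /vscal; cx_unfold; ring.
Qed.

Lemma du_is_dsiegel z w : ball z -> du_is z w (- fst (dsiegel (slice_param z) z w)).
Proof.
move=> z_ball; apply/is_derive_Reals.
apply: is_derive_ext; first by move=> t; symmetry; exact: uB_line.
have := Cnorm2_gt0 (ball_coord1_neq1 z_ball); rewrite /dsiegel !inner_slice_param // inner_self.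
rewrite -(inner_conj z w).
move: (inner z w) (z ord0) (w ord0) (vnorm2 z) (vnorm2 w) => [p q] [a b] [u v] S N.
cx_unfold => D; auto_derive; rewrite !Rmult_0_l !Ropp_0 !Rplus_0_r; [by lra | field].
by split; [move=> E; nra | lra].
Qed.

Lemma du_is_unique z w (l : R) : ball z -> du_is z w l -> l = - fst (dsiegel (slice_param z) z w).
Proof. by move=> z_ball du; apply: uniqueness_limite du (du_is_dsiegel w z_ball). Qed.

(* [(1 + a) / (1 - a)], in a form where adding [1] gives [2 / (1 - a)] at once. *)
Definition cayley (a : C) : C := (RtoC 2 / (1 - a) - 1)%cx.

Lemma geodesic_cayley (a : C) : (1 - a)%cx <> 0%cx -> geodesic vzero (cayley a) = axis a.
Proof.
move=> a1; have two := RtoC2_neq0; rewrite /geodesic slice_vzero /tau vnorm2_zero; congr axis.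
have -> : (cayley a + RtoC (1 + 0))%cx = (RtoC 2 / (1 - a))%cx.
  by rewrite /cayley; have -> : RtoC (1 + 0) = 1%cx; [cx_ring | ring].
by field.
Qed.

Lemma cayley_re (a : C) : (1 - a)%cx <> 0%cx ->
  fst (cayley a) = (1 - Cnorm2 a) / Cnorm2 (1 - a)%cx.
Proof. by move/Cnorm2_gt0; rewrite /cayley; cx_unfold => D; field; lra. Qed.

Lemma Cmod_cayley_le (a : C) : Cmod a <= 1 -> (1 - a)%cx <> 0%cx ->
  Cmod (cayley a) <= 2 / Cmod (1 - a)%cx.
Proof.
move=> a_le1 a1; have -> : cayley a = ((1 + a) / (1 - a))%cx.
  by rewrite /cayley; have -> : RtoC 2 = (1 + 1)%cx; [cx_ring | field].
rewrite Cmod_div //; apply: Rmult_le_compat_r; first exact/Rlt_le/Rinv_0_lt_compat/Cmod_gt0.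
by apply: Rle_trans (Cmod_add _ _) _; rewrite Cmod1; lra.
Qed.

Lemma inv_Cmod_le_cayley_re (M : R) (a : C) : 0 <= M -> (1 - a)%cx <> 0%cx ->
  Cmod (1 - a)%cx <= M * (1 - Cmod a) -> / Cmod (1 - a)%cx <= M * fst (cayley a).
Proof.
move=> M0 a1 a_le; have t0 := Cmod_gt0 a1; have a0 := Cmod_ge0 a.
rewrite cayley_re // -!Cmod_sqr.
apply: (Rmult_le_reg_r (Cmod (1 - a)%cx ^ 2)); first by apply: pow_lt.
have -> : / Cmod (1 - a)%cx * Cmod (1 - a)%cx ^ 2 = Cmod (1 - a)%cx by field; lra.
rewrite (_ : M * (_ / _) * _ = M * (1 - Cmod a ^ 2)); last by field; lra.
have a_le1 : Cmod a <= 1 by apply: Rnot_lt_le => a_gt1; nra.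
by apply: Rle_trans a_le _; apply: Rmult_le_compat_l => //; nra.
Qed.

End Siegel.

(** * Monotonicity along slices *)

Lemma is_derive_ge0_of_min (f : R -> R) (l : R) : is_derive f 0 l ->
  (forall t, 0 <= t -> f 0 <= f t) -> 0 <= l.
Proof.
move=> /is_derive_Reals f_l f_ge; apply: Rnot_lt_le => l0.
case: (f_l (- l / 2)) => [|d f_near]; first lra.
have d0 := cond_pos d; have := f_near (d / 2) ltac:(lra).
rewrite Rplus_0_l Rabs_pos_eq; last lra.
move=> /(_ ltac:(lra)) /Rabs_def2.
have : 0 <= (f (d / 2) - f 0) / (d / 2).
  by apply: Rdiv_le_0_compat; [have := f_ge (d / 2); lra | lra].
lra.
Qed.

Section SliceField.
Variables (n : nat) (G : vec n.+1 -> vec n.+1) (dG : vec n.+1 -> vec n.+1 -> vec n.+1).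
Hypothesis G_diff : forall z, ball z -> is_cderiv G z (dG z).

Definition slice_field (c : vec n.+1) (w : C) : C :=
  dsiegel c (geodesic c w) (G (geodesic c w)).

Lemma slice_field_param (z : vec n.+1) : ball z ->
  slice_field (slice_param z) (siegel (slice_param z) z) = dsiegel (slice_param z) z (G z).
Proof. by move=> z_ball; rewrite /slice_field geodesic_siegel_param. Qed.

Lemma ex_cderive_geodesic (F : vec n.+1 -> C) (c : vec n.+1) (w : C) : half_plane w ->
  ex_cderive (fun b => F (slice c b)) (tau c w) -> ex_cderive (fun w => F (geodesic c w)) w.
Proof.
move=> /(ex_cderive_tau c) [d tau_d] [e F_e]; exists (e * d)%cx.
exact: (is_cderive_comp tau_d F_e).
Qed.

Lemma slice_line (c : vec n.+1) (t : C) :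
  slice c t = vadd (basis n.+1 0) (vscal t (vsub c (basis n.+1 0))).
Proof. by apply: vec_ext => i; rewrite /slice /axis /vadd /vscal /vsub; ring. Qed.

Section FlowOnSlice.
Variables (X : vec n.+1 -> R -> vec n.+1) (c : vec n.+1).
Hypotheses (X_traj : forall z, ball z -> trajectory G (X z) z) (c0 : c ord0 = 0%cx).

Let flow_map (t : R) (w : C) : C := siegel c (X (geodesic c w) t).

Let X_ball (t : R) (w : C) : 0 <= t -> half_plane w -> ball (X (geodesic c w) t).
Proof. by move=> t0 /(geodesic_ball c0) /X_traj [_ [x_ball _]]; exact: x_ball. Qed.

Lemma flow_map_re_ge0 (t : R) (w : C) : 0 <= t -> half_plane w -> 0 <= fst (flow_map t w).
Proof. by move=> t0 w0; apply: siegel_re_ge0 => //; exact: X_ball. Qed.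

Lemma flow_map_ex_cderive (t : R) (w : C) : 0 <= t -> half_plane w -> ex_cderive (flow_map t) w.
Proof.
move=> t0 w0; apply: (@ex_cderive_geodesic (fun z => siegel c (X z t))) => //.
apply: (@ex_cderive_siegel n c (fun b => X (slice c b) t)).
  exact/ball_coord1_neq1/X_ball.
move=> i; have [d Xd] : ex_cderive
    (fun b => X (vadd (basis n.+1 0) (vscal b (vsub c (basis n.+1 0)))) t i) (tau c w).
  by apply: (flow_line_ex_cderive G_diff X_traj i t0); rewrite -slice_line; exact: geodesic_ball.
by exists d; apply: is_cderive_ext Xd => b; rewrite slice_line.
Qed.

Lemma flow_map_0 (w : C) : half_plane w -> flow_map 0 w = w.
Proof.
move=> w0; rewrite /flow_map; have [-> _] := X_traj (geodesic_ball c0 w0).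
exact: siegel_geodesic.
Qed.

Lemma flow_map_derive_0 (w : C) : half_plane w ->
  is_derive (fun t => fst (flow_map t w)) 0 (fst (slice_field c w)).
Proof.
move=> w0; apply: (@is_derive_fst_path (fun t => flow_map t w)).
have [X0 [_ X_G]] := X_traj (geodesic_ball c0 w0).
rewrite /slice_field -{1}X0; apply: is_path_derive_siegel.
  exact/ball_coord1_neq1/X_ball/w0/Rle_refl.
by move=> i; rewrite -{2}X0; apply: X_G; exact: Rle_refl.
Qed.

End FlowOnSlice.

(* The half-plane monotonicity of the maps [flow_map t], differentiated at [t = 0]. *)
Lemma slice_field_ratio_nonincreasing (c : vec n.+1) (x x' y : R) : inf_generator G ->
  c ord0 = 0%cx -> 0 < x -> x <= x' ->
  fst (slice_field c (x', y)) / x' <= fst (slice_field c (x, y)) / x.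
Proof.
move=> G_gen c0 x0 xx'; case: (inf_generator_flow G_gen) => X X_traj.
pose h t w := siegel c (X (geodesic c w) t).
have w'0 : half_plane (x', y) by rewrite /half_plane /=; lra.
have h_derive v (v0 : half_plane v) :
    is_derive (fun t => / fst v * fst (h t v)) 0 (/ fst v * fst (slice_field c v)).
  by apply: is_derive_scal; exact: flow_map_derive_0.
have := @is_derive_ge0_of_min (fun t => / x * fst (h t (x, y)) - / x' * fst (h t (x', y)))
   (/ x * fst (slice_field c (x, y)) - / x' * fst (slice_field c (x', y))) => K.
suff : 0 <= / x * fst (slice_field c (x, y)) - / x' * fst (slice_field c (x', y)) by rewrite /Rdiv; lra.
apply: K => [|t t0].
  by apply: (is_derive_minus (V := R_NormedModule)); [exact: (h_derive (x, y)) | exact: (h_derive (x', y))].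
have := @halfplane_ratio_nonincreasing (h t) (fun w => @flow_map_ex_cderive X c X_traj c0 t w t0)
  (fun w => @flow_map_re_ge0 X c X_traj c0 t w t0) x x' y x0 xx'.
rewrite /h !(flow_map_0 X_traj c0) //= /Rdiv.
have -> : / x * x - / x' * x' = 0 by field; lra.
lra.
Qed.

End SliceField.

(** * Estimates in Koranyi regions *)

Section Koranyi.
Variable n : nat.
Implicit Types z h : vec n.+1.

Definition gap z : R := Cmod (1 - z ord0)%cx.

Definition Koranyi_bigO (f : vec n.+1 -> C) (g : vec n.+1 -> R) : Prop :=
  forall r, 1 <= r -> exists M, 0 <= M /\ forall z, Koranyi r z -> Cmod (f z) <= M * g z.

Lemma koranyiE (r : R) z : Koranyi r z <-> ball z /\ gap z <= r / 2 * (1 - vnorm2 z).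
Proof. by rewrite /Koranyi coord1E. Qed.

Lemma koranyi_ball (r : R) z : Koranyi r z -> ball z.
Proof. by case. Qed.

Lemma gap_gt0 z : ball z -> 0 < gap z.
Proof. by move/ball_coord1_neq1; exact: Cmod_gt0. Qed.

Lemma gap_le2 z : ball z -> gap z <= 2.
Proof.
move=> /(ball_Cmod_lt1 ord0) z1; apply: Rle_trans (Cmod_sub _ _) _.
by rewrite Cmod1; lra.
Qed.

Lemma Cnorm2_coord_le_gap z (j : 'I_n.+1) : ball z -> j != ord0 -> Cnorm2 (z j) <= 2 * gap z.
Proof.
move=> z_ball j0; have := Cnorm2_coord2 z j0; rewrite /ball in z_ball.
by have := one_sub_Cnorm2_le (Rlt_le _ _ (ball_Cmod_lt1 ord0 z_ball)); rewrite -/(gap z); lra.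
Qed.

Lemma Koranyi_bigO_eq (f : vec n.+1 -> C) (g g' : vec n.+1 -> R) :
  (forall z, ball z -> g z = g' z) -> Koranyi_bigO f g -> Koranyi_bigO f g'.
Proof.
move=> gg' f_g r /f_g [M [M0 f_le]]; exists M; split=> // z z_K.
by rewrite -gg'; [exact: f_le | exact: koranyi_ball z_K].
Qed.

Lemma Koranyi_bigO_uniform (f : 'I_n.+1 -> vec n.+1 -> C) (g : vec n.+1 -> R) (r : R) :
  (forall z, 0 <= g z) -> (forall j, j != ord0 -> Koranyi_bigO (f j) g) -> 1 <= r ->
  exists M, 0 <= M /\ forall j, j != ord0 -> forall z, Koranyi r z -> Cmod (f j z) <= M * g z.
Proof.
move=> g0 f_g r1; apply: uniform_bound => [j x y xy x_le j0 z z_K|j].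
  by apply: Rle_trans (x_le j0 z z_K) _; exact: Rmult_le_compat_r.
case: (eqVneq j ord0) => [_|/f_g /(_ r r1) [M [_ M_le]]]; first by exists 0.
by exists M => _.
Qed.

Lemma koranyi_perturb (r : R) z z' : 1 <= r -> Koranyi r z ->
  vnorm2 z' <= vnorm2 z + (1 - vnorm2 z) / 4 -> gap z' <= 2 * gap z -> Koranyi (4 * r) z'.
Proof.
move=> r1 /koranyiE [z_ball z_K] z'_le gap_le; rewrite /ball in z_ball.
apply/koranyiE; split; first by rewrite /ball; lra.
have : r * (1 - vnorm2 z) <= r * (4 / 3 * (1 - vnorm2 z')) by apply: Rmult_le_compat_l; lra.
have : 0 <= r * (1 - vnorm2 z') by apply: Rmult_le_pos; lra.
lra.
Qed.

Lemma koranyi_add_e1 (r : R) z (a : C) : 1 <= r -> Koranyi r z -> Cmod a <= gap z / (8 * r) ->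
  let z' := vadd z (vscal a (basis n.+1 0)) in Koranyi (4 * r) z' /\ gap z' <= 2 * gap z.
Proof.
move=> r1 z_K /Rle_div_r a_le z'; have {a_le} a_le := a_le ltac:(lra).
have /koranyiE [z_ball z_r] := z_K; have z1 := ball_Cmod_lt1 ord0 z_ball.
have gap2 := gap_le2 z_ball; have a0 := Cmod_ge0 a; rewrite /ball in z_ball.
have a_gap : Cmod a <= gap z / 8 by nra.
have gap_le : gap z' <= 2 * gap z.
  rewrite /gap /z' /vadd /vscal basis0E eqxx.
  have -> : (1 - (z ord0 + a * 1))%cx = ((1 - z ord0) - a)%cx by ring.
  by apply: Rle_trans (Cmod_sub _ _) _; rewrite -/(gap z); lra.
split=> //; apply: (koranyi_perturb r1 z_K _ gap_le).
rewrite (vnorm2_add_basis z a ord0) -(Cmod_sqr a).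
have za_le : fst (z ord0 * Cconj a)%cx <= Cmod a.
  by apply: Rle_trans (fst_mul_conj_le _ _) _; have := Cmod_ge0 (z ord0); nra.
have : 3 * Cmod a <= (1 - vnorm2 z) / 4 by nra.
nra.
Qed.

Lemma koranyi_add_ej (r : R) z (a : C) (j : 'I_n.+1) : 1 <= r -> Koranyi r z -> j != ord0 ->
  Cmod a <= sqrt (gap z) / (8 * r) ->
  let z' := vadd z (vscal a (basis n.+1 j)) in Koranyi (4 * r) z' /\ gap z' = gap z.
Proof.
move=> r1 z_K j0 /Rle_div_r a_le z'; have {a_le} a_le := a_le ltac:(lra).
have /koranyiE [z_ball z_r] := z_K; have a0 := Cmod_ge0 a; have gap0 := gap_gt0 z_ball.
have z'_ord0 : z' ord0 = z ord0.
  rewrite /z' /vadd /vscal /basis (_ : (nat_of_ord ord0 == j) = false); first by ring.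
  by rewrite eq_sym; exact: negbTE.
have gap_eq : gap z' = gap z by rewrite /gap z'_ord0.
split=> //; apply: (koranyi_perturb r1 z_K); last lra.
have q0 := sqrt_pos (gap z); have qq := sqrt_sqrt _ (Rlt_le _ _ gap0); set q := sqrt (gap z) in a_le q0 qq.
have zj : Cmod (z j) <= 3 / 2 * q.
  apply: Cmod_le_of_Cnorm2; first lra.
  apply: Rle_trans (Cnorm2_coord_le_gap z_ball j0) _; rewrite -qq; nra.
have za : Cmod (z j) * Cmod a <= 3 / 2 * q * Cmod a by apply: Rmult_le_compat_r.
rewrite (vnorm2_add_basis z a j) -Cmod_sqr; have := fst_mul_conj_le (z j) a.
suff : 3 * (q * Cmod a) + Cmod a ^ 2 <= (1 - vnorm2 z) / 4 by lra.
have qa : q * (Cmod a * (8 * r)) <= q * q by apply: Rmult_le_compat_l.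
have aa : Cmod a * (Cmod a * (8 * r)) <= Cmod a * q by apply: Rmult_le_compat_l.
have aq0 : 0 <= Cmod a * q by apply: Rmult_le_pos; lra.
have aq : 1 * (Cmod a * q) <= r * (Cmod a * q) by apply: Rmult_le_compat_r.
by apply: (Rmult_le_reg_l r); lra.
Qed.

Lemma koranyi_segment (r t : R) z z' : 0 < r -> Koranyi r z -> Koranyi r z' -> 0 <= t <= 1 ->
  let q := vadd z' (vscal (RtoC t) (vsub z z')) in
  Koranyi r q /\ gap q <= Rmax (gap z) (gap z').
Proof.
move=> r0 /koranyiE [z_ball z_r] /koranyiE [z'_ball z'_r] t01 q; rewrite /ball in z_ball z'_ball.
have norm_convex : vnorm2 q <= t * vnorm2 z + (1 - t) * vnorm2 z'.
  rewrite /vnorm2 -!sumR_scal -sumR_add; apply: sumR_le => i.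
  rewrite /q /vadd /vscal /vsub; cx_unfold; move: (z i) (z' i) => [a b] [c d] /=.
  have : 0 <= t * (1 - t) by apply: Rmult_le_pos; lra.
  by have := pow2_ge_0 (a - c); have := pow2_ge_0 (b - d); nra.
have gap_convex : gap q <= t * gap z + (1 - t) * gap z'.
  have E : (1 - q ord0)%cx = (RtoC t * (1 - z ord0) + RtoC (1 - t) * (1 - z' ord0))%cx.
    by rewrite /q /vadd /vscal /vsub; cx_ring.
  rewrite {1}/gap E; apply: Rle_trans (Cmod_add _ _) _.
  by rewrite !Cmod_mul !Cmod_RtoC_ge0 /gap; lra.
split; last first.
  by have := Rmax_l (gap z) (gap z'); have := Rmax_r (gap z) (gap z'); nra.
apply/koranyiE; split; first by rewrite /ball; case: (Rle_lt_dec t (1 / 2)) => ?; nra.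
have : r / 2 * (t * (1 - vnorm2 z) + (1 - t) * (1 - vnorm2 z')) <= r / 2 * (1 - vnorm2 q).
  by apply: Rmult_le_compat_l; lra.
have : t * gap z <= t * (r / 2 * (1 - vnorm2 z)) by apply: Rmult_le_compat_l; lra.
have : (1 - t) * gap z' <= (1 - t) * (r / 2 * (1 - vnorm2 z')) by apply: Rmult_le_compat_l; lra.
lra.
Qed.

Lemma koranyi_axis (r : R) z : 0 < r -> Koranyi r z -> Koranyi r (@axis n (z ord0)).
Proof.
move=> r0 /koranyiE [z_ball z_r]; have z_coord := Cnorm2_coord z ord0; rewrite /ball in z_ball.
apply/koranyiE; rewrite /ball vnorm2_axis /gap axis_ord0 -/(gap z); split; first lra.
by apply: Rle_trans z_r _; apply: Rmult_le_compat_l; lra.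
Qed.

End Koranyi.

Section KoranyiDerivatives.
Variables (n : nat) (G : vec n.+1 -> vec n.+1) (dG : vec n.+1 -> vec n.+1 -> vec n.+1).
Hypothesis G_diff : forall z, ball z -> is_cderiv G z (dG z).

Lemma cauchy_basis (z : vec n.+1) (k : nat) (i : 'I_n.+1) (rho m : R) : 0 < rho -> ball z ->
  (forall a, Cmod a < rho -> ball (vadd z (vscal a (basis n.+1 k))) /\
     Cmod (G (vadd z (vscal a (basis n.+1 k))) i) <= m) ->
  Cmod (dG z (basis n.+1 k) i) <= 4 * m / rho.
Proof.
move=> rho0 z_ball G_le; apply: (@cauchy_estimate (fun a => G (vadd z (vscal a (basis n.+1 k))) i)) => //.
- by move=> a /G_le [p_ball _]; eexists; exact: (is_cderive_line G_diff).
- exact: (is_cderive_line0 G_diff).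
- by move=> a /G_le [].
Qed.

Lemma derive_e1_bigO (phi : R -> R) (i : 'I_n.+1) :
  (forall x y, 0 <= x <= 2 * y -> phi x <= 2 * phi y) ->
  Koranyi_bigO (fun z => G z i) (fun z => phi (gap z)) ->
  Koranyi_bigO (fun z => dG z (basis n.+1 0) i) (fun z => phi (gap z) / gap z).
Proof.
move=> phi_doubling G_phi r r1; case: (G_phi (4 * r)) => [|M [M0 G_le]]; first lra.
exists (64 * r * M); split=> [|z z_K]; first by apply: Rmult_le_pos; lra.
have z_ball := koranyi_ball z_K; have gap0 := gap_gt0 z_ball.
have -> : 64 * r * M * (phi (gap z) / gap z) = 4 * (M * (2 * phi (gap z))) / (gap z / (8 * r)).
  by field; lra.
apply: cauchy_basis => // [|a a_small]; first by apply: Rdiv_lt_0_compat; lra.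
case: (koranyi_add_e1 r1 z_K (Rlt_le _ _ a_small)) => z'_K gap_le.
split; first exact: koranyi_ball z'_K.
apply: Rle_trans (G_le _ z'_K) _; apply: Rmult_le_compat_l => //.
by apply: phi_doubling; split=> //; exact: Cmod_ge0.
Qed.

Lemma derive_ej_bigO (phi : R -> R) (i j : 'I_n.+1) : j != ord0 ->
  Koranyi_bigO (fun z => G z i) (fun z => phi (gap z)) ->
  Koranyi_bigO (fun z => dG z (basis n.+1 j) i) (fun z => phi (gap z) / sqrt (gap z)).
Proof.
move=> j0 G_phi r r1; case: (G_phi (4 * r)) => [|M [M0 G_le]]; first lra.
exists (32 * r * M); split=> [|z z_K]; first by apply: Rmult_le_pos; lra.
have z_ball := koranyi_ball z_K; have q0 := sqrt_lt_R0 _ (gap_gt0 z_ball).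
have -> : 32 * r * M * (phi (gap z) / sqrt (gap z)) = 4 * (M * phi (gap z)) / (sqrt (gap z) / (8 * r)).
  by field; lra.
apply: cauchy_basis => // [|a a_small]; first by apply: Rdiv_lt_0_compat; lra.
case: (koranyi_add_ej r1 z_K j0 (Rlt_le _ _ a_small)) => z'_K gap_eq.
by split; [exact: koranyi_ball z'_K | rewrite -gap_eq; exact: G_le].
Qed.

Hypothesis G1_bigO : Koranyi_bigO (fun z => G z ord0) (@gap n).

Lemma derive_e1_G1_bigO : Koranyi_bigO (fun z => dG z (basis n.+1 0) ord0) (fun _ => 1).
Proof.
apply: Koranyi_bigO_eq (derive_e1_bigO (phi := id) _ G1_bigO) => [z /gap_gt0 gap0|x y [_ xy]] //.
by field; lra.
Qed.

Lemma derive_ej_G1_bigO (j : 'I_n.+1) : j != ord0 ->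
  Koranyi_bigO (fun z => dG z (basis n.+1 j) ord0) (fun z => sqrt (gap z)).
Proof.
move=> j0; apply: Koranyi_bigO_eq (derive_ej_bigO (phi := id) j0 G1_bigO) => z /gap_gt0 gap0.
have q0 := sqrt_lt_R0 _ gap0; rewrite -{1}(sqrt_sqrt (gap z)); last lra.
by field; lra.
Qed.

Lemma dG1_apply_le (r : R) : 1 <= r -> exists A, 0 <= A /\ forall z h, Koranyi r z ->
  Cmod (dG z h ord0) <= A * (Cmod (h ord0) + sqrt (gap z) * norm1 h).
Proof.
move=> r1; case: (derive_e1_G1_bigO r1) => M [M0 e1_le].
case: (Koranyi_bigO_uniform (fun z => sqrt_pos (gap z)) derive_ej_G1_bigO r1) => M' [M'0 ej_le].
exists (M + M'); split=> [|z h z_K]; first lra.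
rewrite (clinear_expand (dG_linear G_diff (koranyi_ball z_K))); apply: Rle_trans (Cmod_sum_le _) _.
have -> : (M + M') * (Cmod (h ord0) + sqrt (gap z) * norm1 h) = \big[Rplus/0]_(j < n.+1)
    ((if j == ord0 then (M + M') * Cmod (h ord0) else 0) + (M + M') * sqrt (gap z) * Cmod (h j)).
  by rewrite sumR_add sumR_scal sumR_delta -/(norm1 h); ring.
apply: sumR_le => j; rewrite Cmod_mul; have hj := Cmod_ge0 (h j); have q0 := sqrt_pos (gap z).
have Mq : 0 <= (M + M') * sqrt (gap z) by apply: Rmult_le_pos; lra.
case: eqP => [->|/eqP j0].
  rewrite -[nat_of_ord ord0]/O; have h0 := Cmod_ge0 (h ord0).
  have := Rmult_le_compat_l _ _ _ h0 (e1_le z z_K).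
  by have := Rmult_le_pos _ _ Mq h0; have := Rmult_le_pos _ _ M'0 h0; lra.
have := Rmult_le_compat_l _ _ _ hj (ej_le j j0 z z_K).
by have := Rmult_le_pos _ _ (Rmult_le_pos _ _ M0 q0) hj; lra.
Qed.

Lemma G1_lipschitz (r : R) : 1 <= r -> exists A, 0 <= A /\ forall z z' b,
  Koranyi r z -> Koranyi r z' -> gap z <= b -> gap z' <= b ->
  Cmod (G z ord0 - G z' ord0)%cx <= A * (Cmod (z ord0 - z' ord0)%cx + sqrt b * norm1 (vsub z z')).
Proof.
move=> r1; case: (dG1_apply_le r1) => A [A0 dG_le]; exists A; split=> // z z' b z_K z'_K z_b z'_b.
pose line a := vadd z' (vscal a (vsub z z')).
have line0 : line 0%cx = z' by exact: vadd_vscal0.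
have line1 : line (0 + 1)%cx = z by rewrite (_ : (0 + 1 = 1)%cx); [exact: vadd_vscal1_vsub | ring].
have on_segment t : 0 <= t <= 1 ->
    Koranyi r (line (0 + RtoC t * 1)%cx) /\ gap (line (0 + RtoC t * 1)%cx) <= b.
  have -> : (0 + RtoC t * 1)%cx = RtoC t by ring.
  move=> t01; have r0 : 0 < r by lra.
  case: (koranyi_segment r0 z_K z'_K t01) => q_K gap_q; split=> //.
  by apply: Rle_trans gap_q _; exact: Rmax_lub.
have := @mean_value_ineq (fun a => G (line a) ord0) (fun a => dG (line a) (vsub z z') ord0) 0 1
   (A * (Cmod (z ord0 - z' ord0)%cx + sqrt b * norm1 (vsub z z'))).
rewrite line0 line1.
apply=> t /on_segment [q_K gap_q]; first exact: (is_cderive_line G_diff) (koranyi_ball q_K).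
rewrite Cmod_mul Cmod1 Rmult_1_r; apply: Rle_trans (dG_le _ _ q_K) _.
apply: Rmult_le_compat_l => //; apply: Rplus_le_compat_l; apply: Rmult_le_compat_r.
  exact: norm1_ge0.
exact: sqrt_le_1_alt.
Qed.

Hypothesis Gj_bigO : forall j, j != ord0 -> Koranyi_bigO (fun z => G z j) (fun z => sqrt (gap z)).

Lemma derive_e1_Gj_bigO (j : 'I_n.+1) : j != ord0 ->
  Koranyi_bigO (fun z => dG z (basis n.+1 0) j) (fun z => / sqrt (gap z)).
Proof.
move=> /Gj_bigO Gj; apply: Koranyi_bigO_eq (derive_e1_bigO _ Gj) => [z /gap_gt0 gap0|x y [x0 xy]].
  have q0 := sqrt_lt_R0 _ gap0; rewrite -{2}(sqrt_sqrt (gap z)); last lra.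
  by field; lra.
rewrite -(sqrt_pow2 2) -?sqrt_mult; try lra.
by apply: sqrt_le_1_alt; lra.
Qed.

Lemma derive_ej_Gk_bigO (j k : 'I_n.+1) : j != ord0 -> k != ord0 ->
  Koranyi_bigO (fun z => dG z (basis n.+1 j) k) (fun _ => 1).
Proof.
move=> j0 /Gj_bigO Gk; apply: Koranyi_bigO_eq (derive_ej_bigO j0 Gk) => z /gap_gt0 gap0.
by have := sqrt_lt_R0 _ gap0 => q0; field; lra.
Qed.

Lemma inner_G_bigO (c : vec n.+1) : c ord0 = 0%cx ->
  Koranyi_bigO (fun z => inner (G z) c) (fun z => sqrt (gap z)).
Proof.
move=> c0 r /(Koranyi_bigO_uniform (fun z => sqrt_pos (gap z)) Gj_bigO) [M [M0 Gj_le]].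
exists (M * norm1 c); split=> [|z z_K]; first by apply: Rmult_le_pos => //; exact: norm1_ge0.
apply: Rle_trans (Cmod_sum_le _) _; rewrite Rmult_assoc (Rmult_comm (norm1 c)) -Rmult_assoc -sumR_scal.
apply: sumR_le => j; rewrite Cmod_mul Cmod_conj; case: (eqVneq j ord0) => [->|j0].
  by rewrite c0 Cmod0; lra.
by apply: Rmult_le_compat_r; [exact: Cmod_ge0 | exact: Gj_le].
Qed.

End KoranyiDerivatives.

(** * Asymptotics along slices *)

Lemma div_sqrt_small (K e : R) : 0 <= K -> 0 < e ->
  exists x0, 1 <= x0 /\ forall x, x0 <= x -> K / sqrt x <= e.
Proof.
move=> K0 e0; exists (Rmax 1 ((K / e) ^ 2)); split=> [|x x_ge]; first exact: Rmax_l.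
have x1 := Rle_trans _ _ _ (Rmax_l _ _) x_ge; have x2 := Rle_trans _ _ _ (Rmax_r _ _) x_ge.
have s0 : 0 < sqrt x by apply: sqrt_lt_R0; lra.
apply/Rle_div_l => //; rewrite Rmult_comm; apply/Rle_div_l => //.
rewrite -(sqrt_pow2 (K / e)); last exact: Rdiv_le_0_compat.
exact: sqrt_le_1_alt.
Qed.

Section Asymptotics.
Variables (n : nat) (G : vec n.+1 -> vec n.+1) (dG : vec n.+1 -> vec n.+1 -> vec n.+1).
Hypothesis G_diff : forall z, ball z -> is_cderiv G z (dG z).
Hypothesis G1_bigO : Koranyi_bigO (fun z => G z ord0) (@gap n).
Hypothesis Gj_bigO : forall j, j != ord0 -> Koranyi_bigO (fun z => G z j) (fun z => sqrt (gap z)).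
Implicit Types (c z : vec n.+1) (w : C).

Definition rate z : C := (G z ord0 / (z ord0 - 1))%cx.

Lemma rate_bigO : Koranyi_bigO rate (fun _ => 1).
Proof.
move=> r /G1_bigO [M [M0 G1_le]]; exists M; split=> // z z_K; rewrite Rmult_1_r.
have z_ball := koranyi_ball z_K; have gap0 := gap_gt0 z_ball.
rewrite Cmod_div; last exact: ball_coord1_sub1_neq0.
by rewrite Cmod_subC -/(gap z); apply/Rle_div_l => //; exact: G1_le.
Qed.

Lemma rate_dist (r : R) : 1 <= r -> exists A, 0 <= A /\ forall z z' b,
  Koranyi r z -> Koranyi r z' -> gap z <= b -> gap z' <= b ->
  gap z * Cmod (rate z - rate z')%cx <= A * (Cmod (z ord0 - z' ord0)%cx + sqrt b * norm1 (vsub z z')).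
Proof.
move=> r1; case: (G1_lipschitz G_diff G1_bigO r1) => A [A0 lip]; case: (rate_bigO r1) => M [M0 rate_le].
exists (A + M); split=> [|z z' b z_K z'_K z_b z'_b]; first lra.
have z1 := ball_coord1_sub1_neq0 (koranyi_ball z_K).
have z'1 := ball_coord1_sub1_neq0 (koranyi_ball z'_K).
rewrite -Cmod_mul.
have -> : ((1 - z ord0) * (rate z - rate z'))%cx =
    (rate z' * (z ord0 - z' ord0) - (G z ord0 - G z' ord0))%cx.
  by rewrite /rate; field.
apply: Rle_trans (Cmod_sub _ _) _; rewrite Cmod_mul.
have := lip z z' b z_K z'_K z_b z'_b; have := rate_le z' z'_K.
set m := Cmod (z ord0 - z' ord0)%cx; have m0 : 0 <= m by exact: Cmod_ge0.
have : 0 <= sqrt b * norm1 (vsub z z') by apply: Rmult_le_pos; [exact: sqrt_pos | exact: norm1_ge0].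
by nra.
Qed.

Lemma slice_fieldE c w : c ord0 = 0%cx -> half_plane w ->
  slice_field G c w = (- ((w + RtoC (1 - vnorm2 c)) * rate (geodesic c w))
    - (w + RtoC (1 + vnorm2 c)) * inner (G (geodesic c w)) c)%cx.
Proof.
move=> c0 w0; have t0 := tau_neq0 (c := c) w0; have W0 := tau_denom_neq0 (c := c) w0.
have W_tau : (w + RtoC (1 + vnorm2 c))%cx = (RtoC 2 / tau c w)%cx.
  by rewrite /tau; field; split=> //; exact: RtoC2_neq0.
have -> : (w + RtoC (1 - vnorm2 c))%cx = (RtoC 2 / tau c w - RtoC 2 * RtoC (vnorm2 c))%cx.
  by rewrite -W_tau; cx_ring.
have inner_z : inner (geodesic c w) c = (tau c w * RtoC (vnorm2 c))%cx.
  by rewrite -inner_conj inner_slice inner_self c0; cx_ring.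
have -> : rate (geodesic c w) = (- (G (geodesic c w) ord0 / tau c w))%cx.
  rewrite /rate -(geodesic_ord0 w c0) in t0 *; field; split=> //.
  by apply/ball_coord1_sub1_neq0/geodesic_ball.
by rewrite W_tau /slice_field /dsiegel geodesic_ord0 // inner_z; field.
Qed.

Lemma geodesic_gap_mul c w : c ord0 = 0%cx -> half_plane w ->
  gap (geodesic c w) * Cmod (w + RtoC (1 + vnorm2 c))%cx = 2.
Proof.
move=> c0 w0; have W0 := tau_denom_neq0 (c := c) w0; have W_gt0 := Cmod_gt0 W0.
by rewrite /gap geodesic_ord0 // /tau Cmod_div // Cmod_RtoC_ge0; [field; lra | lra].
Qed.

Lemma geodesic_koranyi c w : c ord0 = 0%cx -> half_plane w ->
  Cmod (w + RtoC (1 + vnorm2 c))%cx <= 2 * fst w -> Koranyi 2 (geodesic c w).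
Proof.
move=> c0 w0 W_le; have z_ball := geodesic_ball c0 w0; apply/koranyiE; split=> //.
rewrite geodesic_defect // -(geodesic_ord0 w c0) -Cmod_sqr -/(gap _).
have gap0 := gap_gt0 z_ball; have := geodesic_gap_mul c0 w0; nra.
Qed.

(* How far out the geodesic of parameter [c] has to be followed at height [y]. *)
Definition slice_start c (y : R) : R := 1 + vnorm2 c + Rabs y.

Lemma slice_start_ge1 c (y : R) : 1 <= slice_start c y.
Proof. by have := vnorm2_ge0 c; have := Rabs_pos y; rewrite /slice_start; lra. Qed.

Definition radial (x : R) : vec n.+1 := geodesic vzero (RtoC x).

Lemma radial_ord0 (x : R) : 0 < x -> (1 - radial x ord0)%cx = RtoC (2 / (x + 1)).
Proof.
by move=> x0; rewrite geodesic_ord0 // /tau vnorm2_zero; apply C_ext; cx_unfold; field; nra.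
Qed.

Section FarOnGeodesic.
Variables (c : vec n.+1) (y x : R).
Hypotheses (c0 : c ord0 = 0%cx) (x_far : slice_start c y <= x).

Let x_ge1 : 1 <= x. Proof. by have := slice_start_ge1 c y; lra. Qed.

Let xy_half_plane : half_plane (x, y).
Proof. by rewrite /half_plane /=; lra. Qed.

Lemma tau_denom_bounds : x <= Cmod ((x, y) + RtoC (1 + vnorm2 c))%cx <= 2 * x.
Proof.
have e0 := vnorm2_ge0 c; split; first by apply: Rle_trans (fst_le_Cmod _); cx_unfold; lra.
have -> : ((x, y) + RtoC (1 + vnorm2 c))%cx = (x + (1 + vnorm2 c), y) by cx_ring.
apply: Rle_trans (Cmod_le_fst_snd _) _; rewrite /= Rabs_pos_eq; last lra.
by move: x_far; rewrite /slice_start; lra.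
Qed.

Lemma geodesic_gap_bounds : / x <= gap (geodesic c (x, y)) <= 2 / x.
Proof.
have := geodesic_gap_mul c0 xy_half_plane; have := tau_denom_bounds.
set W := Cmod _ => W_x gapW.
split; last by apply/Rle_div_r; [lra | nra].
by apply: (Rmult_le_reg_r x); [lra | rewrite Rinv_l; nra].
Qed.

Lemma geodesic_far_koranyi : Koranyi 2 (geodesic c (x, y)).
Proof. by apply: geodesic_koranyi => //; have := tau_denom_bounds; rewrite /=; lra. Qed.

Lemma geodesic_sub_radial_ord0 :
  Cmod (geodesic c (x, y) ord0 - radial x ord0)%cx <= 2 * slice_start c y / (x * x).
Proof.
set W := ((x, y) + RtoC (1 + vnorm2 c))%cx; have W0 : W <> 0%cx by exact: tau_denom_neq0.
have x1 : RtoC (x + 1) <> 0%cx by case; lra.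
have -> : (geodesic c (x, y) ord0 - radial x ord0)%cx =
    (RtoC 2 * (W - RtoC (x + 1)) / (W * RtoC (x + 1)))%cx.
  have -> : (geodesic c (x, y) ord0 - radial x ord0)%cx =
      ((1 - radial x ord0) - (1 - geodesic c (x, y) ord0))%cx by ring.
  rewrite radial_ord0; last lra.
  rewrite geodesic_ord0 // /tau -/W.
  have -> : RtoC (2 / (x + 1)) = (RtoC 2 / RtoC (x + 1))%cx by apply C_ext; cx_unfold; field; nra.
  by field.
have W_sub : Cmod (W - RtoC (x + 1))%cx <= slice_start c y.
  have -> : (W - RtoC (x + 1))%cx = (vnorm2 c, y) by rewrite /W; cx_ring.
  apply: Rle_trans (Cmod_le_fst_snd _) _; have c_ge0 := vnorm2_ge0 c.
  by rewrite /= Rabs_pos_eq // /slice_start; lra.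
have [+ _] := tau_denom_bounds; rewrite -/W => W_x.
have Wx1 : 0 < Cmod W * (x + 1) by apply: Rmult_lt_0_compat; lra.
rewrite Cmod_div; last by apply: Cmod_neq0; rewrite Cmod_mul Cmod_RtoC_ge0; lra.
rewrite !Cmod_mul !Cmod_RtoC_ge0; try lra.
apply: Rmult_le_compat; [have := Cmod_ge0 (W - RtoC (x + 1))%cx; lra | | lra |].
  exact/Rlt_le/Rinv_0_lt_compat.
by apply: Rinv_le_contravar; [nra | apply: Rmult_le_compat; lra].
Qed.

Lemma vsub_geodesic_radial : vsub (geodesic c (x, y)) (radial x) =
  vadd (vscal (tau c (x, y)) c) (axis (geodesic c (x, y) ord0 - radial x ord0)%cx).
Proof.
apply: vec_ext => i; rewrite /vsub /vadd; case: (eqVneq i ord0) => [->|i0].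
  by rewrite axis_ord0 /vscal c0; ring.
by rewrite axis_neq0 // /radial /geodesic !slice_neq0 // /vscal /vzero; ring.
Qed.

Lemma norm1_geodesic_sub_radial :
  norm1 (vsub (geodesic c (x, y)) (radial x)) <=
  (2 * norm1 c + 2 * slice_start c y * norm1 (basis n.+1 0)) / x.
Proof.
rewrite vsub_geodesic_radial; apply: Rle_trans (norm1_add _ _) _; rewrite !norm1_scal.
have := norm1_ge0 c; have := norm1_ge0 (basis n.+1 0).
set b := norm1 (basis _ _); set N := norm1 c => b0 N0.
have t_le : Cmod (tau c (x, y)) * N <= 2 / x * N.
  by apply: Rmult_le_compat_r => //; rewrite -geodesic_ord0 //; case: geodesic_gap_bounds.
have kb0 : 0 <= 2 * slice_start c y * b.
  by apply: Rmult_le_pos => //; have := slice_start_ge1 c y; lra.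
have xx : 2 * slice_start c y / (x * x) * b <= 2 * slice_start c y * b / x.
  have -> : 2 * slice_start c y / (x * x) * b = 2 * slice_start c y * b / x * / x by field; lra.
  rewrite -[X in _ <= X]Rmult_1_r; apply: Rmult_le_compat_l; first by apply: Rdiv_le_0_compat; lra.
  by rewrite -Rinv_1; apply: Rinv_le_contravar; lra.
have := Rmult_le_compat_r _ _ _ b0 geodesic_sub_radial_ord0; rewrite /Rdiv; rewrite /Rdiv in t_le xx; lra.
Qed.

End FarOnGeodesic.

Lemma radial_far (x : R) : 1 <= x -> slice_start (@vzero n.+1) 0 <= x.
Proof. by rewrite /slice_start vnorm2_zero Rabs_R0; lra. Qed.

Lemma radial_koranyi (x : R) : 1 <= x -> Koranyi 2 (radial x).
Proof. by move/radial_far; exact: geodesic_far_koranyi. Qed.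

Lemma radial_gap_le (x : R) : 1 <= x -> gap (radial x) <= 2 / x.
Proof. by move/radial_far => x_far; case: (geodesic_gap_bounds (c := @vzero n.+1) erefl x_far). Qed.

Lemma rate_sub_radial_le c (y : R) : c ord0 = 0%cx ->
  exists K, 0 <= K /\ forall x, slice_start c y <= x ->
  Cmod (rate (geodesic c (x, y)) - rate (radial x))%cx <= K / sqrt x.
Proof.
move=> c0; case: (rate_dist (r := 2)) => [|A [A0 dist_le]]; first lra.
set k := slice_start c y; set N := 2 * norm1 c + 2 * k * norm1 (basis n.+1 0).
have k1 : 1 <= k by exact: slice_start_ge1.
have N0 : 0 <= N.
  have := norm1_ge0 c; have := norm1_ge0 (basis n.+1 0) => b0 nc0.
  by have : 0 <= k * norm1 (basis n.+1 0); [apply: Rmult_le_pos; lra | rewrite /N; lra].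
exists (A * (2 * k + 2 * N)); split=> [|x x_far]; first by apply: Rmult_le_pos; lra.
have x1 : 1 <= x by lra.
have [z_gap z_gap2] := geodesic_gap_bounds c0 x_far.
have := dist_le _ _ _ (geodesic_far_koranyi c0 x_far) (radial_koranyi x1) z_gap2 (radial_gap_le x1).
set D := Cmod (rate _ - _)%cx => D_le; have D0 : 0 <= D by exact: Cmod_ge0.
have s0 : 0 < sqrt x by apply: sqrt_lt_R0; lra.
have ss := sqrt_sqrt x ltac:(lra).
have s1 : 1 <= sqrt x by rewrite -sqrt_1; apply: sqrt_le_1_alt.
have sqrt_le : sqrt (2 / x) <= 2 / sqrt x.
  rewrite sqrt_div_alt; last lra.
  apply: Rmult_le_compat_r; first exact/Rlt_le/Rinv_0_lt_compat.
  by have := sqrt_sqrt 2 ltac:(lra); have := sqrt_pos 2; nra.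
apply/Rle_div_r => //.
have first_le := geodesic_sub_radial_ord0 c0 x_far; have norm_le := norm1_geodesic_sub_radial c0 x_far.
have : / x * D <= A * (2 * k / (x * x) + 2 / sqrt x * (N / x)).
  apply: Rle_trans (Rmult_le_compat_r _ _ _ D0 z_gap) _; apply: Rle_trans D_le _.
  apply: Rmult_le_compat_l => //; apply: Rplus_le_compat => //.
  by apply: Rmult_le_compat => //; [exact: sqrt_pos | exact: norm1_ge0].
have -> : / x * D = D * sqrt x * / (x * sqrt x) by field; lra.
have -> : A * (2 * k / (x * x) + 2 / sqrt x * (N / x)) = A * (2 * k * / sqrt x + 2 * N) * / (x * sqrt x).
  by rewrite -{2}ss; field; lra.
have xs0 : 0 < / (x * sqrt x) by apply: Rinv_0_lt_compat; apply: Rmult_lt_0_compat; lra.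
move/(Rmult_le_reg_r _ _ _ xs0) => D_sqrt_le; apply: Rle_trans D_sqrt_le _.
apply: Rmult_le_compat_l => //; apply: Rplus_le_compat_r.
rewrite -[X in _ <= X]Rmult_1_r; apply: Rmult_le_compat_l; first lra.
by rewrite -Rinv_1; apply: Rinv_le_contravar; lra.
Qed.

Lemma slice_field_add_rate_le c (y : R) : c ord0 = 0%cx ->
  exists K, 0 <= K /\ forall x, slice_start c y <= x ->
  Cmod (slice_field G c (x, y) + RtoC x * rate (geodesic c (x, y)))%cx <= K * sqrt x.
Proof.
move=> c0; case: (rate_bigO (r := 2)) => [|M [M0 rate_le]]; first lra.
case: (inner_G_bigO Gj_bigO c0 (r := 2)) => [|M' [M'0 inner_le]]; first lra.
have start1 := slice_start_ge1 c y; exists (slice_start c y * M + 2 * M'); split=> [|x x_far].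
  by have : 0 <= slice_start c y * M; [apply: Rmult_le_pos; lra | lra].
have z_K := geodesic_far_koranyi c0 x_far; have w0 : half_plane (x, y) by rewrite /half_plane /=; lra.
have [_ W_le] := tau_denom_bounds x_far; have gapW := geodesic_gap_mul c0 w0.
have gap0 := gap_gt0 (koranyi_ball z_K); rewrite slice_fieldE //.
set W := (_ + RtoC (1 + _))%cx in W_le gapW *; set z := geodesic _ _ in z_K gapW gap0 *.
have -> : (- (((x, y) + RtoC (1 - vnorm2 c)) * rate z) - W * inner (G z) c + RtoC x * rate z)%cx =
    (- (((1 - vnorm2 c)%R, y) * rate z + W * inner (G z) c))%cx.
  by have -> : ((1 - vnorm2 c)%R, y) = ((x, y) + RtoC (1 - vnorm2 c) - RtoC x)%cx; [cx_ring | ring].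
rewrite Cmod_opp; apply: Rle_trans (Cmod_add _ _) _; rewrite (Cmod_mul _ (rate z)) (Cmod_mul W).
have coef_le : Cmod ((1 - vnorm2 c)%R, y) <= slice_start c y.
  apply: Rle_trans (Cmod_le_fst_snd _) _; rewrite /slice_start /=; have e0 := vnorm2_ge0 c.
  by apply: Rplus_le_compat_r; apply: Rabs_le; lra.
have sqrt_x : 1 <= sqrt x by rewrite -sqrt_1; apply: sqrt_le_1_alt; lra.
have W0 := Cmod_ge0 W.
have Wq_le : Cmod W * sqrt (gap z) <= 2 * sqrt x.
  rewrite -{1}(sqrt_sqrt (Cmod W)) // Rmult_assoc -sqrt_mult //; last lra.
  rewrite (Rmult_comm (Cmod W) (gap z)) gapW -sqrt_mult //; last lra.
  have four : 2 = sqrt 4 by rewrite (_ : 4 = 2 * 2); [rewrite sqrt_square; lra | ring].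
  by rewrite [X in _ <= X * _]four -sqrt_mult; [apply: sqrt_le_1_alt; lra | lra | lra].
have : Cmod ((1 - vnorm2 c)%R, y) * Cmod (rate z) <= slice_start c y * (M * 1).
  by apply: Rmult_le_compat => //; try exact: Cmod_ge0; exact: rate_le.
have : Cmod W * Cmod (inner (G z) c) <= Cmod W * (M' * sqrt (gap z)).
  by apply: Rmult_le_compat_l => //; exact: inner_le.
have := Rmult_le_compat_l _ _ _ M'0 Wq_le.
have : slice_start c y * M * 1 <= slice_start c y * M * sqrt x.
  by apply: Rmult_le_compat_l => //; apply: Rmult_le_pos; lra.
lra.
Qed.

Lemma slice_field_asymptotic c (y e : R) : c ord0 = 0%cx -> 0 < e ->
  exists x0, 1 <= x0 /\ forall x, x0 <= x ->
  Rabs (fst (slice_field G c (x, y)) / x + fst (rate (radial x))) <= e.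
Proof.
move=> c0 e0; case: (slice_field_add_rate_le y c0) => K [K0 field_le].
case: (rate_sub_radial_le y c0) => K' [K'0 rate_le].
case: (div_sqrt_small (Rplus_le_le_0_compat _ _ K0 K'0) e0) => x0 [x01 small].
exists (x0 + slice_start c y); have start1 := slice_start_ge1 c y; split=> [|x x_ge]; first lra.
have := field_le x ltac:(lra); have := rate_le x ltac:(lra); have := small x ltac:(lra).
set r := rate (geodesic _ _); set r' := rate _; set Q := slice_field _ _ _ => sum_le sub_le add_le.
have -> : fst Q / x + fst r' = fst (RtoC (/ x) * (Q + RtoC x * r) - (r - r'))%cx.
  by move: Q r r' {sum_le sub_le add_le} => Q r r'; cx_unfold; field; lra.
have s0 : 0 < sqrt x by apply: sqrt_lt_R0; lra.
apply: Rle_trans (Rabs_fst_le_Cmod _) _; apply: Rle_trans (Cmod_sub _ _) _.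
have ix0 : 0 < / x by apply: Rinv_0_lt_compat; lra.
rewrite Cmod_mul Cmod_RtoC_ge0; last lra.
have := Rmult_le_compat_l _ _ _ (Rlt_le _ _ ix0) add_le.
have -> : / x * (K * sqrt x) = K / sqrt x by rewrite -{1}(sqrt_sqrt x); [field | ]; lra.
have : K / sqrt x + K' / sqrt x = (K + K') / sqrt x by field; lra.
lra.
Qed.

Hypothesis G_gen : inf_generator G.

Lemma slice_field_ratio_ge c w (e : R) : c ord0 = 0%cx -> half_plane w -> 0 < e ->
  exists x0, 1 <= x0 /\ forall x, x0 <= x ->
  - fst (rate (radial x)) - e <= fst (slice_field G c w) / fst w.
Proof.
case: w => u y c0 u0 e0; case: (slice_field_asymptotic y c0 e0) => x0 [x01 far].
exists (Rmax x0 u); split=> [|x x_ge]; first exact: Rle_trans x01 (Rmax_l _ _).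
have /Rabs_le_between [] := far x (Rle_trans _ _ _ (Rmax_l _ _) x_ge).
have := slice_field_ratio_nonincreasing G_diff y G_gen c0 u0 (Rle_trans _ _ _ (Rmax_r _ _) x_ge).
rewrite /=; lra.
Qed.

Lemma slice_field_lower_bound : exists M, forall c w, c ord0 = 0%cx -> half_plane w ->
  - M <= fst (slice_field G c w) / fst w.
Proof.
case: (rate_bigO (r := 2)) => [|M [M0 rate_le]]; first lra.
exists M => c w c0 w0; apply: le_epsilon => e e0.
case: (slice_field_ratio_ge c0 w0 e0) => x [x1 /(_ x (Rle_refl x))].
have /Rabs_le_between := Rle_trans _ _ _ (Rabs_fst_le_Cmod _) (rate_le _ (radial_koranyi x1)).
lra.
Qed.

Lemma generator_BRNP : BRNP G.
Proof.
case: slice_field_lower_bound => M field_ge; exists M => z z_ball.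
eexists; split; first exact: du_is_dsiegel.
have w0 := siegel_param_half_plane z_ball.
have /(Rle_div_r _ _ _ w0) := field_ge _ _ (slice_param_ord0 z) w0.
by rewrite slice_field_param // siegel_param_re //; lra.
Qed.

Lemma is_dilation_slices (beta : R) : is_dilation G beta ->
  is_lub (fun b => exists c w, c ord0 = 0%cx /\ half_plane w /\
    b = - (fst (slice_field G c w) / fst w)) beta.
Proof.
have quotientE z l : ball z -> du_is z (G z) l -> - (l / uB z) =
    - (fst (slice_field G (slice_param z) (siegel (slice_param z) z)) / fst (siegel (slice_param z) z)).
  move=> z_ball /(du_is_unique z_ball) ->; rewrite slice_field_param //.
  have := siegel_param_half_plane z_ball; rewrite /half_plane siegel_param_re // => u0.
  by field; lra.
case=> ub lub; split=> [b [c [w [c0 [w0 ->]]]]|b b_ub].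
  have z_ball := geodesic_ball c0 w0; have du := du_is_dsiegel (G (geodesic c w)) z_ball.
  apply: ub; exists (geodesic c w); eexists; do 2 (split; first eassumption).
  by rewrite (quotientE _ _ z_ball du) slice_param_geodesic // siegel_geodesic.
apply: lub => _ [z [l [z_ball [du ->]]]]; apply: b_ub; rewrite (quotientE z l z_ball du).
exists (slice_param z), (siegel (slice_param z) z); split; first exact: slice_param_ord0.
by split=> //; exact: siegel_param_half_plane.
Qed.

Section Dilation.
Variable beta : R.
Hypothesis beta_dil : is_dilation G beta.

(* Its real part is nonnegative, and [o(w)] in every sector: [- beta] is both the infimum and
   the limit at infinity of [Re slice_field / Re w]. *)
Definition excess w : C := (slice_field G vzero w + RtoC beta * w)%cx.

Lemma excess_fst w : fst (excess w) = fst (slice_field G vzero w) + beta * fst w.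
Proof. by rewrite /excess; set Q := slice_field _ _ _; cx_unfold; ring. Qed.

Lemma slice_field_vzero w : slice_field G vzero w =
  (RtoC 2 * G (geodesic vzero w) ord0 / (tau (@vzero n.+1) w * tau (@vzero n.+1) w))%cx.
Proof. by rewrite /slice_field /dsiegel !inner_vzero geodesic_ord0 // /Cdiv; ring. Qed.

Lemma ex_cderive_excess w : half_plane w -> ex_cderive excess w.
Proof.
move=> w0; have [t' tau_t'] := ex_cderive_tau (@vzero n.+1) w0.
have [g G_g] : ex_cderive (fun v => G (geodesic vzero v) ord0) w.
  apply: (@ex_cderive_geodesic n (fun z => G z ord0)) => //.
  have p_ball := geodesic_ball (c := @vzero n.+1) erefl w0; rewrite /geodesic slice_line in p_ball.
  have G_line := is_cderive_line G_diff ord0 p_ball.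
  by eexists; apply: is_cderive_ext G_line => b; rewrite slice_line.
have t0 := tau_neq0 (c := @vzero n.+1) w0.
have tt0 : (tau (@vzero n.+1) w * tau (@vzero n.+1) w)%cx <> 0%cx.
  by apply: Cmod_neq0; rewrite Cmod_mul; have := Cmod_gt0 t0; nra.
have quot := is_cderive_div (is_cderive_scal (RtoC 2) G_g) (is_cderive_mul tau_t' tau_t') tt0.
eexists; apply: is_cderive_add (is_cderive_scal (RtoC beta) (is_cderive_id w)).
by apply: is_cderive_ext quot => v; rewrite slice_field_vzero.
Qed.

Lemma excess_ge0 w : half_plane w -> 0 <= fst (excess w).
Proof.
move=> w0; have [ub _] := is_dilation_slices beta_dil.
have /Ropp_le_contravar : - (fst (slice_field G vzero w) / fst w) <= beta by apply: ub; exists vzero, w.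
by rewrite Ropp_involutive => /(Rle_div_r _ _ _ w0); rewrite excess_fst; lra.
Qed.

Lemma dilation_approx (e : R) : 0 < e -> exists c w, c ord0 = 0%cx /\ half_plane w /\
  fst (slice_field G c w) / fst w < - beta + e.
Proof.
move=> e0; apply: NNPP => no_approx; have [_ lub] := is_dilation_slices beta_dil.
suff : beta <= beta - e by lra.
apply: lub => b [c [w [c0 [w0 ->]]]]; apply: Rnot_lt_le => b_gt.
by apply: no_approx; exists c, w; do 2 (split=> //); lra.
Qed.

Lemma excess_radial (e : R) : 0 < e -> exists x0, 0 < x0 /\
  forall x, x0 <= x -> fst (excess (x, 0)) <= e * x.
Proof.
move=> e0; case: (dilation_approx (e := e / 3)) => [|c [w [c0 [w0 approx]]]]; first lra.
case: (slice_field_ratio_ge c0 w0 (e := e / 3)) => [|x0 [x01 ratio_ge]]; first lra.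
case: (@slice_field_asymptotic vzero 0 (e / 3)) => // [|x1 [x11 far]]; first lra.
exists (Rmax x0 x1); split=> [|x x_ge]; first by apply: Rlt_le_trans (Rmax_l _ _); lra.
have x_ge0 := Rle_trans _ _ _ (Rmax_l _ _) x_ge; have x_ge1 := Rle_trans _ _ _ (Rmax_r _ _) x_ge.
have /Rabs_le_between [_ far_x] := far x x_ge1; have ratio_x := ratio_ge x x_ge0.
have /Rle_div_l field_le : fst (slice_field G vzero (x, 0)) / x <= - beta + e by lra.
by have := field_le ltac:(lra); rewrite excess_fst -[fst (x, 0)]/x; lra.
Qed.

Lemma excess_sublinear (M e : R) : 0 <= M -> 0 < e -> exists x1, 0 < x1 /\
  forall w, x1 <= fst w -> Rabs (snd w) <= M * fst w -> Cmod (excess w) <= e * fst w.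
Proof.
move=> M0 e0; have eM : 0 <= M * exp M by apply: Rmult_le_pos (Rlt_le _ _ (exp_pos M)).
set e' := e / (2 * (1 + M * exp M)); have e'0 : 0 < e' by apply: Rdiv_lt_0_compat; lra.
case: (excess_radial e'0) => x0 [x00 radial_le].
set m := Cmod (excess (x0, 0)); exists (Rmax x0 (2 * m / e)).
split=> [|[x y] x_ge y_le]; first exact: Rlt_le_trans x00 (Rmax_l _ _).
have x0_le := Rle_trans _ _ _ (Rmax_l _ _) x_ge.
have /Rle_div_l m_le := Rle_trans _ _ _ (Rmax_r _ _) x_ge; have {m_le} m_le := m_le e0.
have := halfplane_sublinear ex_cderive_excess excess_ge0 x00 x0_le (Rlt_le _ _ e'0) y_le radial_le.
rewrite -/m.
have -> : (1 + M * exp M) * e' * x = e / 2 * x by rewrite /e'; field; lra.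
by rewrite /= in m_le *; lra.
Qed.

Lemma excess_rate w : half_plane w ->
  ((w + 1) * (rate (geodesic vzero w) - RtoC beta))%cx = (- (excess w + RtoC beta))%cx.
Proof.
move=> w0; rewrite /excess slice_fieldE // inner_vzero vnorm2_zero.
by rewrite (_ : RtoC (1 - 0) = 1%cx); [ring | cx_ring].
Qed.

Lemma rate_axis (M e : R) : 1 <= M -> 0 < e -> exists delta, 0 < delta /\ forall a : C,
  (1 - a)%cx <> 0%cx -> Cmod (1 - a)%cx < delta -> Cmod (1 - a)%cx <= M * (1 - Cmod a) ->
  Cmod (rate (axis a) - RtoC beta)%cx <= e.
Proof.
move=> M1 e0; case: (excess_sublinear (M := 2 * M) (e := e / 2)) => [||x1 [x10 excess_le]]; try lra.
have b0 := Rabs_pos beta; have Mx0 : 0 < M * x1 by apply: Rmult_lt_0_compat; lra.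
exists (Rmin (/ (M * x1)) (e / (Rabs beta + 1))); split=> [|a a1].
  by apply: Rmin_pos; [exact: Rinv_0_lt_compat | apply: Rdiv_lt_0_compat; lra].
have t0 := Cmod_gt0 a1; have := inv_Cmod_le_cayley_re (M := M) _ a1.
set t := Cmod _ in t0 *; set w := cayley a => w_re t_small stolz; have {w_re} w_re := w_re ltac:(lra) stolz.
have /Rlt_div_r beta_t := Rlt_le_trans _ _ _ t_small (Rmin_r _ _).
have a_le1 : Cmod a <= 1 by nra.
have w_le := Cmod_cayley_le a_le1 a1; rewrite -/t -/w in w_le.
have w_far : x1 <= fst w.
  apply: (Rmult_le_reg_l M); first lra.
  apply: Rle_trans w_re; rewrite -(Rinv_inv (M * x1)).
  by apply: Rinv_le_contravar => //; exact/Rlt_le/(Rlt_le_trans _ _ _ t_small)/Rmin_l.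
have w_sector : Rabs (snd w) <= 2 * M * fst w.
  by apply: Rle_trans (Rabs_snd_le_Cmod _) _; rewrite /Rdiv in w_le; lra.
have w0 : half_plane w by rewrite /half_plane; lra.
have := excess_rate w0; rewrite geodesic_cayley // => /(congr1 Cmod).
rewrite Cmod_mul Cmod_opp.
have -> : (w + 1)%cx = (RtoC 2 / (1 - a))%cx by rewrite /w /cayley; ring.
rewrite Cmod_div // Cmod_RtoC_ge0 -/t; last lra.
set D := Cmod (rate _ - _)%cx => rateE.
have : 2 / t * D <= e / 2 * (2 / t) + Rabs beta.
  rewrite rateE; apply: Rle_trans (Cmod_add _ _) _; rewrite Cmod_RtoC; apply: Rplus_le_compat_r.
  apply: Rle_trans (excess_le w w_far w_sector) _; apply: Rmult_le_compat_l; first lra.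
  exact: Rle_trans (fst_le_Cmod _) w_le.
move/(Rmult_le_compat_l t _ _ (Rlt_le _ _ t0)).
have -> : t * (2 / t * D) = 2 * D by field; lra.
have -> : t * (e / 2 * (2 / t) + Rabs beta) = e + t * Rabs beta by field; lra.
lra.
Qed.

End Dilation.
End Asymptotics.

(** * Restricted K-limits *)

Section KLimits.
Variable n : nat.
Implicit Types z : vec n.+1.

Definition near_e1 (M delta : R) z : Prop :=
  ball z /\ gap z < delta /\ gap z <= M * (1 - Cmod (z ord0)) /\
  vnorm2 (vsub z (axis (z ord0))) <= delta * (1 - Cnorm2 (z ord0)).

Lemma near_e1_ball (M delta : R) z : near_e1 M delta z -> ball z.
Proof. by case. Qed.

Lemma near_e1_gap (M delta : R) z : near_e1 M delta z -> gap z < delta.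
Proof. by case=> _ []. Qed.

Lemma near_e1_widen (M delta delta' : R) z : delta <= delta' ->
  near_e1 M delta z -> near_e1 M delta' z.
Proof.
move=> le_delta [z_ball [z_gap [z_stolz z_perp]]]; split=> //; split; first lra.
split=> //.
apply: Rle_trans z_perp _; apply: Rmult_le_compat_r => //.
by have := Cnorm2_coord z ord0; rewrite /ball in z_ball; lra.
Qed.

Lemma vnorm2_sub_axis z : vnorm2 (vsub z (axis (z ord0))) = vnorm2 z - Cnorm2 (z ord0).
Proof. by rewrite vnorm2_sub vnorm2_axis inner_axis; cx_unfold; ring. Qed.

Lemma near_e1_koranyi (M delta : R) z : 1 <= M -> delta <= / 2 -> near_e1 M delta z ->
  Koranyi (4 * M) z.
Proof.
move=> M1 d2 [z_ball [_ [z_stolz]]]; rewrite vnorm2_sub_axis => z_perp.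
apply/koranyiE; split=> //; apply: Rle_trans z_stolz _.
have z1 := ball_Cmod_lt1 ord0 z_ball; have z0 := Cmod_ge0 (z ord0).
have le_sqr : 1 - Cmod (z ord0) <= 1 - Cnorm2 (z ord0) by rewrite -Cmod_sqr; nra.
have : delta * (1 - Cnorm2 (z ord0)) <= / 2 * (1 - Cnorm2 (z ord0)) by apply: Rmult_le_compat_r; lra.
move=> half_le; have : M * (1 - Cmod (z ord0)) <= M * (2 * (1 - vnorm2 z)) by apply: Rmult_le_compat_l; lra.
lra.
Qed.

Lemma near_e1_norm1 (M delta : R) z : near_e1 M delta z ->
  norm1 (vsub z (axis (z ord0))) <= INR n.+1 * sqrt (2 * delta) * sqrt (gap z).
Proof.
move=> [z_ball [z_gap [_ z_perp]]]; have z1 := ball_Cmod_lt1 ord0 z_ball.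
apply: Rle_trans (norm1_le_vnorm _) _; rewrite Rmult_assoc; apply: Rmult_le_compat_l; first exact: pos_INR.
have gap0 := gap_gt0 z_ball; rewrite -sqrt_mult; try lra.
apply: sqrt_le_1_alt; apply: Rle_trans z_perp _; have := one_sub_Cnorm2_le (Rlt_le _ _ z1).
by rewrite -/(gap z) => /(Rmult_le_compat_l delta _ _ ltac:(lra)); lra.
Qed.

Lemma near_e1_move (M delta : R) z (a : C) : 1 <= M -> delta <= / 8 -> near_e1 M delta z ->
  Cmod a < gap z / (4 * M) ->
  near_e1 (4 * M) (4 * delta) (vadd z (axis a)).
Proof.
move=> M1 d8 [z_ball [z_gap [z_stolz z_perp]]] /Rlt_div_r a_lt; have {a_lt} a_lt := a_lt ltac:(lra).
set z' := vadd _ _; have z'0 : z' ord0 = (z ord0 + a)%cx by rewrite /z' /vadd axis_ord0.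
have a0 := Cmod_ge0 a; have z'_ge0 := Cmod_ge0 (z' ord0).
have a_gap : Cmod a <= gap z / 4 by nra.
have a_le : Cmod a <= (1 - Cmod (z ord0)) / 4 by apply: (Rmult_le_reg_r (4 * M)); nra.
have gap_le : gap z' <= gap z + Cmod a.
  rewrite /gap z'0; have -> : (1 - (z ord0 + a))%cx = ((1 - z ord0) - a)%cx by ring.
  exact: Cmod_sub.
have z'_le : Cmod (z' ord0) <= Cmod (z ord0) + Cmod a by rewrite z'0; exact: Cmod_add.
have z1 := ball_Cmod_lt1 ord0 z_ball.
have defect_le : 1 - Cnorm2 (z ord0) <= 2 * (1 - Cmod (z ord0)) by rewrite -Cmod_sqr; nra.
have defect'_ge : 1 - Cmod (z' ord0) <= 1 - Cnorm2 (z' ord0) by rewrite -Cmod_sqr; nra.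
have z'_perp : vnorm2 (vsub z' (axis (z' ord0))) <= 4 * delta * (1 - Cnorm2 (z' ord0)).
  have -> : vsub z' (axis (z' ord0)) = vsub z (axis (z ord0)).
    by apply: vec_ext => i; rewrite z'0 /z' /vsub /vadd /axis /vscal; ring.
  apply: Rle_trans z_perp _.
  have : delta * (1 - Cnorm2 (z ord0)) <= delta * (4 * (1 - Cnorm2 (z' ord0))).
    by apply: Rmult_le_compat_l; lra.
  lra.
split; [|split; [lra|split=> //]].
  rewrite vnorm2_sub_axis in z'_perp; rewrite /ball.
  have : 4 * delta * (1 - Cnorm2 (z' ord0)) <= / 2 * (1 - Cnorm2 (z' ord0)).
    by apply: Rmult_le_compat_r; lra.
  lra.
apply: Rle_trans gap_le _.
have : M * (1 - Cmod (z ord0)) <= M * (4 / 3 * (1 - Cmod (z' ord0))) by apply: Rmult_le_compat_l; lra.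
have : 0 <= M * (1 - Cmod (z' ord0)) by apply: Rmult_le_pos; lra.
lra.
Qed.

Lemma K_lim_near (f : vec n.+1 -> C) (L : C) :
  (forall M e, 1 <= M -> 0 < e -> exists delta, 0 < delta /\
     forall z, near_e1 M delta z -> Cmod (f z - L)%cx <= e) -> K_lim f L.
Proof.
move=> f_near zs zs_ball _ zs_perp zs_lim [M zs_stolz] e e0.
case: (f_near (Rmax 1 M) (e / 2) (Rmax_l _ _)) => [|delta [d0 f_le]]; first lra.
case: (zs_perp delta d0) => N perp_lt; case: (zs_lim delta d0) => N' lim_lt.
exists (Nat.max N N') => k k_ge; have := perp_lt k ltac:(lia); have := lim_lt k ltac:(lia).
have := zs_stolz k; have := zs_ball k; rewrite /Rdist !Rminus_0_r !coord1E.
move: (zs k) => z z_ball z_stolz z_lim z_perp.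
rewrite Rabs_pos_eq in z_lim; last exact: Cmod_ge0.
rewrite Rabs_pos_eq; last exact: Cmod_ge0.
apply: (Rle_lt_trans _ (e / 2)); last lra.
have z1 : Cnorm2 (z ord0) < 1 by have := Cnorm2_coord z ord0; rewrite /ball in z_ball; lra.
apply: f_le; split=> //; split; first by rewrite /gap Cmod_subC.
split.
  apply: Rle_trans z_stolz _; apply: Rmult_le_compat_r; last exact: Rmax_r.
  by have := ball_Cmod_lt1 ord0 z_ball; lra.
by apply/Rle_div_l; [lra | exact: Rlt_le (Rle_lt_trans _ _ _ (Rle_abs _) z_perp)].
Qed.

Lemma sqrt_gap_gt0 z : ball z -> 0 < sqrt (gap z).
Proof. by move/gap_gt0; exact: sqrt_lt_R0. Qed.

Lemma Cmod_Csqrt_coord1 z : Cmod (Csqrt (1 - coord1 z)%cx) = sqrt (gap z).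
Proof. by rewrite Cmod_Csqrt coord1E. Qed.

Lemma K_lim_ext (f g : vec n.+1 -> C) (L : C) : (forall z, f z = g z) -> K_lim f L -> K_lim g L.
Proof. by move=> /functional_extensionality ->. Qed.

Lemma bounded_on_KoranyiE (f : vec n.+1 -> C) (g u : vec n.+1 -> R) :
  (forall z, ball z -> 0 < g z /\ u z = Cmod (f z) / g z) ->
  bounded_on_Koranyi u <-> Koranyi_bigO f g.
Proof.
move=> uE; split=> f_le r /f_le [M]; last first.
  move=> [M0 M_le]; exists M => z z_K; have [g0 ->] := uE z (koranyi_ball z_K).
  rewrite Rabs_pos_eq; first by apply/Rle_div_l => //; exact: M_le.
  by apply: Rdiv_le_0_compat => //; exact: Cmod_ge0.
move=> M_le; exists (Rmax 0 M); split=> [|z z_K]; first exact: Rmax_l.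
have [g0 z_u] := uE z (koranyi_ball z_K); apply/Rle_div_l => //; rewrite -z_u.
exact: Rle_trans (Rle_abs _) (Rle_trans _ _ _ (M_le z z_K) (Rmax_r _ _)).
Qed.

End KLimits.

Section BoundedForms.
Variables (n : nat) (G : vec n.+1 -> vec n.+1) (dG : vec n.+1 -> vec n.+1 -> vec n.+1).

Lemma bounded_G1P :
  bounded_on_Koranyi (fun z => Cmod (inner (G z) (basis n.+1 0)) / Cmod (coord1 z - 1)%cx) <->
  Koranyi_bigO (fun z => G z ord0) (@gap n).
Proof.
apply: bounded_on_KoranyiE => z /gap_gt0 gap0; split=> //.
by rewrite inner_e1 coord1E Cmod_subC.
Qed.

Lemma bounded_GjP (j : 'I_n.+1) :
  bounded_on_Koranyi (fun z => Cmod (inner (G z) (basis n.+1 j)) / sqrt (Cmod (coord1 z - 1)%cx)) <->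
  Koranyi_bigO (fun z => G z j) (fun z => sqrt (gap z)).
Proof.
apply: bounded_on_KoranyiE => z /sqrt_gap_gt0 q0; split=> //.
by rewrite inner_basis coord1E Cmod_subC.
Qed.

Hypothesis G_diff : forall z, ball z -> is_cderiv G z (dG z).
Hypothesis G1_bigO : Koranyi_bigO (fun z => G z ord0) (@gap n).
Hypothesis Gj_bigO : forall j, j != ord0 -> Koranyi_bigO (fun z => G z j) (fun z => sqrt (gap z)).

Lemma derive_e1_G1_bounded :
  bounded_on_Koranyi (fun z => Cmod (inner (dG z (basis n.+1 0)) (basis n.+1 0))).
Proof.
apply: (iffRL (bounded_on_KoranyiE _)) (derive_e1_G1_bigO G_diff G1_bigO) => z _.
by rewrite inner_e1 Rdiv_1_r; lra.
Qed.

Lemma derive_ej_Gk_bounded (j k : 'I_n.+1) : j != ord0 -> k != ord0 ->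
  bounded_on_Koranyi (fun z => Cmod (inner (dG z (basis n.+1 j)) (basis n.+1 k))).
Proof.
move=> j0 k0; apply: (iffRL (bounded_on_KoranyiE _)) (derive_ej_Gk_bigO G_diff Gj_bigO j0 k0) => z _.
by rewrite inner_basis Rdiv_1_r; lra.
Qed.

Lemma derive_ej_G1_bounded (j : 'I_n.+1) : j != ord0 ->
  bounded_on_Koranyi
    (fun z => Cmod (inner (dG z (basis n.+1 j)) (basis n.+1 0) / Csqrt (1 - coord1 z))%cx).
Proof.
move=> j0; apply: (iffRL (bounded_on_KoranyiE _)) (derive_ej_G1_bigO G_diff G1_bigO j0).
move=> z /sqrt_gap_gt0 q0; split=> //; rewrite inner_e1 Cmod_div ?Cmod_Csqrt_coord1 //.
by apply: Cmod_neq0; rewrite Cmod_Csqrt_coord1.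
Qed.

Lemma derive_e1_Gj_bounded (j : 'I_n.+1) : j != ord0 ->
  bounded_on_Koranyi
    (fun z => Cmod (Csqrt (1 - coord1 z) * inner (dG z (basis n.+1 0)) (basis n.+1 j))%cx).
Proof.
move=> j0; apply: (iffRL (bounded_on_KoranyiE _)) (derive_e1_Gj_bigO G_diff Gj_bigO j0).
move=> z /sqrt_gap_gt0 q0; split; first exact: Rinv_0_lt_compat.
by rewrite inner_basis Cmod_mul Cmod_Csqrt_coord1 /Rdiv Rinv_inv Rmult_comm.
Qed.

End BoundedForms.

Section Limits.
Variables (n : nat) (G : vec n.+1 -> vec n.+1) (dG : vec n.+1 -> vec n.+1 -> vec n.+1).
Hypothesis G_diff : forall z, ball z -> is_cderiv G z (dG z).
Hypothesis G1_bigO : Koranyi_bigO (fun z => G z ord0) (@gap n).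

Lemma K_lim_derive_ej_G1 (j : 'I_n.+1) : j != ord0 ->
  K_lim (fun z => dG z (basis n.+1 j) ord0) 0%cx.
Proof.
move=> j0; apply: K_lim_near => M e M1 e0.
case: (derive_ej_G1_bigO G_diff G1_bigO j0 (r := 4 * M)) => [|B [B0 dG_le]]; first lra.
have s0 : 0 < e / (B + 1) by apply: Rdiv_lt_0_compat; lra.
exists (Rmin (/ 2) ((e / (B + 1)) ^ 2)); split=> [|z z_near].
  by apply: Rmin_pos; [lra | exact: pow_lt].
rewrite (_ : (dG z (basis n.+1 j) ord0 - 0)%cx = dG z (basis n.+1 j) ord0); last by ring.
apply: Rle_trans (dG_le z (near_e1_koranyi M1 (Rmin_l _ _) z_near)) _.
have : sqrt (gap z) <= e / (B + 1).
  rewrite -(sqrt_pow2 (e / (B + 1))); last lra.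
  apply/sqrt_le_1_alt/Rlt_le; exact: Rlt_le_trans (near_e1_gap z_near) (Rmin_r _ _).
move=> /(Rmult_le_compat_l _ _ _ B0) B_le; apply: Rle_trans B_le _.
rewrite [X in _ <= X](_ : e = (B + 1) * (e / (B + 1))); last by field; lra.
by apply: Rmult_le_compat_r; lra.
Qed.

Lemma rate_near_axis (M e : R) : 1 <= M -> 0 < e -> exists delta, 0 < delta /\
  forall z, near_e1 M delta z -> Cmod (rate G z - rate G (axis (z ord0)))%cx <= e.
Proof.
move=> M1 e0; case: (rate_dist G_diff G1_bigO (r := 4 * M)) => [|A [A0 dist_le]]; first lra.
have AN : 0 <= A * INR n.+1 by apply: Rmult_le_pos => //; exact: pos_INR.
pose s := e / (A * INR n.+1 + 1); have s0 : 0 < s by apply: Rdiv_lt_0_compat; lra.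
have s2 : 0 < s ^ 2 / 2 by have := pow_lt s 2 s0; lra.
exists (Rmin (/ 2) (s ^ 2 / 2)); split=> [|z]; first by apply: Rmin_pos => //; lra.
have delta_2 := Rmin_l (/ 2) (s ^ 2 / 2); have delta_s := Rmin_r (/ 2) (s ^ 2 / 2).
set delta := Rmin _ _ in delta_2 delta_s * => z_near.
have z_K := near_e1_koranyi M1 delta_2 z_near; have gap0 := gap_gt0 (koranyi_ball z_K).
have gap_axis : gap (@axis n (z ord0)) = gap z by rewrite /gap axis_ord0.
have := dist_le z (axis (z ord0)) (gap z) z_K (koranyi_axis _ z_K) (Rle_refl _).
rewrite gap_axis axis_ord0 => /(_ ltac:(lra) (Rle_refl _)).
rewrite (_ : (z ord0 - z ord0)%cx = 0%cx); last by ring.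
rewrite Cmod0 Rplus_0_l => dist_z.
apply: (Rmult_le_reg_l (gap z)) => //; apply: Rle_trans dist_z _.
have q0 := sqrt_pos (gap z); have qq := sqrt_sqrt _ (Rlt_le _ _ gap0).
have /(Rmult_le_compat_l _ _ _ q0) := near_e1_norm1 z_near.
move/(Rmult_le_compat_l _ _ _ A0) => norm_le; apply: Rle_trans norm_le _.
rewrite (_ : A * (sqrt (gap z) * (INR n.+1 * sqrt (2 * delta) * sqrt (gap z))) =
    sqrt (gap z) * sqrt (gap z) * (A * INR n.+1 * sqrt (2 * delta))); last by ring.
rewrite qq; apply: Rmult_le_compat_l; first lra.
have sqrt_delta : sqrt (2 * delta) <= s.
  by rewrite -(sqrt_pow2 s); [apply: sqrt_le_1_alt; lra | lra].
apply: Rle_trans (Rmult_le_compat_l _ _ _ AN sqrt_delta) _.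
rewrite [X in _ <= X](_ : e = (A * INR n.+1 + 1) * s); last by rewrite /s; field; lra.
by apply: Rmult_le_compat_r; lra.
Qed.

Hypothesis Gj_bigO : forall j, j != ord0 -> Koranyi_bigO (fun z => G z j) (fun z => sqrt (gap z)).
Hypothesis G_gen : inf_generator G.
Variable beta : R.
Hypothesis beta_dil : is_dilation G beta.

Lemma rate_near (M e : R) : 1 <= M -> 0 < e -> exists delta, 0 < delta /\
  forall z, near_e1 M delta z -> Cmod (rate G z - RtoC beta)%cx <= e.
Proof.
move=> M1 e0; have e2 : 0 < e / 2 by lra.
case: (rate_axis G_diff G1_bigO Gj_bigO G_gen beta_dil M1 e2) => d [d0 axis_le].
case: (rate_near_axis M1 e2) => d' [d'0 dist_le].
exists (Rmin d d'); split=> [|z z_near]; first exact: Rmin_pos.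
have [z_ball [z_gap [z_stolz _]]] := z_near.
have := axis_le _ (ball_coord1_neq1 z_ball) (Rlt_le_trans _ _ _ z_gap (Rmin_l _ _)) z_stolz.
have := dist_le z (near_e1_widen (Rmin_r _ _) z_near).
have := Cmod_dist_triangle (rate G z) (rate G (axis (z ord0))) (RtoC beta); lra.
Qed.

Lemma K_lim_rate : K_lim (rate G) (RtoC beta).
Proof. exact: K_lim_near rate_near. Qed.

Lemma K_lim_derive_e1_G1 : K_lim (fun z => dG z (basis n.+1 0) ord0) (RtoC beta).
Proof.
apply: K_lim_near => M e M1 e0; have e'0 : 0 < e / (32 * M) by apply: Rdiv_lt_0_compat; lra.
case: (rate_near (M := 4 * M) _ e'0) => [|d [d0 rate_le]]; first lra.
exists (Rmin (d / 4) (/ 8)); split=> [|z z_near]; first by apply: Rmin_pos; lra.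
set delta := Rmin _ _ in z_near; have delta_d : delta <= d / 4 by exact: Rmin_l.
have z_ball := near_e1_ball z_near; have gap0 := gap_gt0 z_ball.
pose error a := (G (vadd z (axis a)) ord0 - RtoC beta * (z ord0 + a - 1))%cx.
have near_move a : Cmod a < gap z / (4 * M) -> near_e1 (4 * M) d (vadd z (axis a)).
  move=> a_lt; apply: near_e1_widen (near_e1_move M1 (Rmin_r _ _) z_near a_lt).
  by rewrite -/delta; lra.
have error_derive a : ball (vadd z (axis a)) ->
    is_cderive error a (dG (vadd z (axis a)) (basis n.+1 0) ord0 - RtoC beta)%cx.
  move=> a_ball; have arg := is_cderive_add (is_cderive_const (z ord0) a) (is_cderive_id a).
  apply: is_cderive_sub; first exact: (is_cderive_line G_diff).
  have target := is_cderive_scal (RtoC beta) (is_cderive_sub arg (is_cderive_const 1%cx a)).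
  by apply: is_cderive_val target _; ring.
rewrite (_ : e = 4 * (e / (32 * M) * (2 * gap z)) / (gap z / (4 * M))); last by field; lra.
apply: (@cauchy_estimate error) => [|a /near_move /near_e1_ball a_ball||a a_lt].
- by apply: Rdiv_lt_0_compat; lra.
- by eexists; exact: error_derive.
- by have := error_derive 0%cx; rewrite vadd_vscal0; apply.
have a_near := near_move a a_lt; have p1 := ball_coord1_sub1_neq0 (near_e1_ball a_near).
have p0 : vadd z (axis a) ord0 = (z ord0 + a)%cx by rewrite /vadd axis_ord0.
have -> : error a = ((rate G (vadd z (axis a)) - RtoC beta) * (vadd z (axis a) ord0 - 1))%cx.
  by rewrite /error /rate -p0; field.
rewrite Cmod_mul; apply: Rmult_le_compat; try exact: Cmod_ge0; first exact: rate_le.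
rewrite Cmod_subC p0; have -> : (1 - (z ord0 + a))%cx = ((1 - z ord0) - a)%cx by ring.
apply: Rle_trans (Cmod_sub _ _) _; rewrite -/(gap z).
have : Cmod a * (4 * M) < gap z by apply/Rlt_div_r => //; lra.
by have := Cmod_ge0 a; nra.
Qed.

End Limits.

Lemma nonzero_ord_of_range (n j : nat) : (1 <= j < n.+1)%N ->
  exists i : 'I_n.+1, i != ord0 /\ nat_of_ord i = j.
Proof.
by move=> /andP [j_gt0 j_lt]; exists (Ordinal j_lt); split=> //; rewrite -val_eqE /= -lt0n.
Qed.

Theorem theorem1p2 (n : nat) (G : vec n -> vec n) (dG : vec n -> vec n -> vec n) :
  (0 < n)%N ->
  inf_generator G ->
  (forall z : vec n, ball z -> is_cderiv G z (dG z)) ->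
  bounded_on_Koranyi (fun z => Cmod (inner (G z) (basis n 0)) / Cmod (Csub (coord1 z) Cone)) ->
  (forall j, (1 <= j < n)%N ->
     bounded_on_Koranyi (fun z => Cmod (inner (G z) (basis n j))
                                  / sqrt (Cmod (Csub (coord1 z) Cone)))) ->
  BRNP G /\
  forall beta : R, is_dilation G beta ->
    bounded_on_Koranyi (fun z => Cmod (inner (dG z (basis n 0)) (basis n 0))) /\
    (forall h k, (1 <= h < n)%N -> (1 <= k < n)%N ->
       bounded_on_Koranyi (fun z => Cmod (inner (dG z (basis n h)) (basis n k)))) /\
    (forall j, (1 <= j < n)%N ->
       bounded_on_Koranyi (fun z => Cmod (Cdiv (inner (dG z (basis n j)) (basis n 0))
                                               (Csqrt (Csub Cone (coord1 z)))))) /\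
    (forall j, (1 <= j < n)%N ->
       bounded_on_Koranyi (fun z => Cmod (Cmul (Csqrt (Csub Cone (coord1 z)))
                                               (inner (dG z (basis n 0)) (basis n j))))) /\
    K_lim (fun z => Cdiv (inner (G z) (basis n 0)) (Csub (coord1 z) Cone)) (RtoC beta) /\
    K_lim (fun z => inner (dG z (basis n 0)) (basis n 0)) (RtoC beta) /\
    (forall j, (1 <= j < n)%N ->
       K_lim (fun z => inner (dG z (basis n j)) (basis n 0)) Czero).
Proof.
case: n G dG => // n G dG _ G_gen G_diff /bounded_G1P G1_bigO Gj_bounded.
have Gj_bigO j : j != ord0 -> Koranyi_bigO (fun z => G z j) (fun z => sqrt (gap z)).
  by move=> j0; apply/bounded_GjP/Gj_bounded; rewrite ltn_ord andbT lt0n.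
split=> [|beta beta_dil]; first exact: (generator_BRNP G_diff).
split; [|split; [|split; [|split; [|split; [|split]]]]].
- exact: (derive_e1_G1_bounded G_diff).
- move=> _ _ /nonzero_ord_of_range [h [h0 <-]] /nonzero_ord_of_range [k [k0 <-]].
  exact: (derive_ej_Gk_bounded G_diff).
- by move=> _ /nonzero_ord_of_range [j [j0 <-]]; exact: (derive_ej_G1_bounded G_diff).
- by move=> _ /nonzero_ord_of_range [j [j0 <-]]; exact: (derive_e1_Gj_bounded G_diff).
- apply: K_lim_ext (K_lim_rate G_diff G1_bigO Gj_bigO G_gen beta_dil) => z.
  by rewrite inner_e1 coord1E.
- by apply: K_lim_ext (K_lim_derive_e1_G1 G_diff G1_bigO Gj_bigO G_gen beta_dil) => z; rewrite inner_e1.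
- move=> _ /nonzero_ord_of_range [j [j0 <-]].
  by apply: K_lim_ext (K_lim_derive_ej_G1 G_diff G1_bigO j0) => z; rewrite inner_e1.
Qed.
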